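(* Let $\Omega\subset\mathbb R^n$, $n\ge2$, be a bounded domain with smooth boundary and $0<\sigma\in C^\infty(\overline\Omega)$. Let $\mathfrak m(s,x)=s^{p-1}m(s,x)$ with $0<p<1$ and $0\le m\in C^\infty([0,\infty)\times\mathbb R^n)$, with compact $x$-support, and assume $\partial_s\mathfrak m\le0$ and $\mathfrak m\in L^1((0,\infty);L^\infty_x)$. Then the operator $L$ (defined in the context) with domain $D(L)$ generates a strongly continuous contraction semigroup $e^{tL}$, $t\ge0$, on $\mathcal H=H_D(\Omega)\oplus L^2(\Omega)\oplus\mathcal M$.
   Context: $H_D(\Omega)$ is the completion of $C_0^\infty(\Omega)$ in the norm $\|u\|_{H_D}^2=\int_\Omega\sigma|\nabla u|^2dx$; $H_D'$ is its dual. $\mathcal M$: on $\widetilde{\mathcal M}_0=C_0^\infty((0,\infty)\times\Omega)$ consider the seminorm induced by $(\eta_1,\eta_2)_{\mathcal M}=\int_0^\infty\int_\Omega\mathfrak m(s,x)\nabla\eta_1\cdot\overline{\nabla\eta_2}\,dx\,ds$; let $\mathcal N$ be its null space; $\mathcal M$ is the completion of $\widetilde{\mathcal M}_0/\mathcal N$. $A$: the infinitesimal generator of the strongly continuous contraction semigroup $S(t)$ on $\mathcal M$ induced by the zero-filled right shift $(\widetilde S(t)\eta)(s,x)=0$ for $0<s\le t$, $=\eta(s-t,x)$ for $s>t$, on representatives. $J:H_D(\Omega)\to\mathcal M$: the bounded operator which for $v\in C_0^\infty(\Omega)$ is the limit in $\mathcal M$ of $[\chi_j(s)v(x)]$, where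 $\chi_j\in C_0^\infty((0,\infty))$, $0\le\chi_j\le1$, $\chi_j\to1$ pointwise (so $Jv$ is the $s$-independent history $v$), extended by continuity. $Q:\mathcal M\to H_D(\Omega)'$: the continuous extension of $\langle Q\eta,\varphi\rangle=-\int_0^\infty\int_\Omega\mathfrak m(s,x)\nabla\eta(s,x)\cdot\overline{\nabla\varphi(x)}\,dx\,ds$, i.e. $Q\eta=\nabla\cdot\int_0^\infty\mathfrak m(s,\cdot)\nabla\eta(s)\,ds$. Similarly $\Delta_\sigma=\nabla\cdot\sigma\nabla:H_D\to H_D'$, $\langle\Delta_\sigma u,\varphi\rangle=-\int_\Omega\sigma\nabla u\cdot\overline{\nabla\varphi}\,dx$. $L(u,v,\eta)=(v,\ \Delta_\sigma u+Q\eta,\ A\eta+Jv)$ with domain $D(L)=\{(u,v,\eta)\in\mathcal H:\ v\in H_D(\Omega),\ \Delta_\sigma u+Q\eta\in L^2(\Omega),\ \eta\in D(A)\}$. *)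

(* Defs.v *)
From HB Require Import structures.
From mathcomp Require Import all_boot all_order all_algebra.
From mathcomp Require Import complex.
From mathcomp Require Import all_classical all_reals all_analysis.
Set Implicit Arguments. Unset Strict Implicit. Unset Printing Implicit Defensive.
Import Order.TTheory GRing.Theory Num.Theory numFieldNormedType.Exports.
Local Open Scope classical_set_scope.
Local Open Scope complex_scope.
Local Open Scope ring_scope.

(* R^n is 'rV[R]_n, with its library normed-space structure; it gets here the
   product (= Borel) sigma-algebra, generated by the coordinates, and Lebesgue
   measure. *)
Definition rV_display : measure_display.
Proof. exact: default_measure_display. Qed.

Section borel_rV.
Variables (R : realType) (n : nat).

Definition rV_coord (i : 'I_n) (x : 'rV[R]_n) : measurableTypeR R := x ord0 i.

Let rV_set0 : g_sigma_preimage rV_coord set0.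
Proof. exact: sigma_algebra0. Qed.

Let rV_setC A : g_sigma_preimage rV_coord A -> g_sigma_preimage rV_coord (~` A).
Proof. exact: sigma_algebraC. Qed.

Let rV_bigcup (F : (set 'rV[R]_n)^nat) :
  (forall i, g_sigma_preimage rV_coord (F i)) ->
  g_sigma_preimage rV_coord (\bigcup_i (F i)).
Proof. exact: sigma_algebra_bigcup. Qed.

HB.instance Definition _ := @isMeasurable.Build rV_display
  'rV[R]_n (g_sigma_preimage rV_coord) rV_set0 rV_setC rV_bigcup.

Lemma measurable_rV_coord i : measurable_fun [set: 'rV[R]_n] (rV_coord i).
Proof.
move=> _ Y mY; rewrite setTI; apply: sub_sigma_algebra => /=.
rewrite -bigcup_seq/=; exists i => /=; first by rewrite mem_index_enum.
by exists Y => //; rewrite setTI.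
Qed.

Lemma measurable_rVP d (T : measurableType d) (f : T -> 'rV[R]_n) :
  (forall i, measurable_fun [set: T] (rV_coord i \o f)) ->
  measurable_fun [set: T] f.
Proof.
move=> mf; move=> _ A mA; rewrite setTI.
pose G := image_set_system setT f (@measurable _ T).
suff : g_sigma_preimage rV_coord `<=` G.
  by move=> /(_ _ mA); rewrite /G /image_set_system /= setTI.
apply: smallest_sub.
  exact/sigma_algebra_image/sigma_algebra_measurable.
rewrite -bigcup_seq; apply: bigcup_sub => i _ B [C mC <-].
rewrite /G /image_set_system /= !setTI -comp_preimage.
by rewrite -[X in measurable X]setTI; exact: mf.
Qed.

End borel_rV.

Section lebesgue_rV.
Variable R : realType.
Local Open Scope ereal_scope.

Definition rV_cons n (p : measurableTypeR R * 'rV[R]_n) : 'rV[R]_n.+1 :=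
  \row_i if unlift ord0 i is Some j then p.2 ord0 j else p.1.

Lemma measurable_rV_cons n : measurable_fun setT (@rV_cons n).
Proof.
apply: measurable_rVP => i.
case: (unliftP ord0 i) => [j ->|->].
  rewrite (_ : _ \o _ = (fun p => rV_coord j p.2)); last first.
    by apply/funext => p; rewrite /= /rV_coord mxE liftK.
  by apply: measurableT_comp => //; exact: measurable_rV_coord.
rewrite (_ : _ \o _ = fst) //.
by apply/funext => p; rewrite /= /rV_coord mxE unlift_none.
Qed.


Definition rV_uncons n (x : 'rV[R]_n.+1) : measurableTypeR R * 'rV[R]_n :=
  (x ord0 ord0, \row_j x ord0 (lift ord0 j)).

Lemma rV_consK n : cancel (@rV_cons n) (@rV_uncons n).
Proof.
case=> a y; rewrite /rV_uncons /rV_cons; congr pair.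
  by rewrite mxE unlift_none.
by apply/rowP => j; rewrite !mxE liftK.
Qed.

Lemma measurable_rV_uncons n : measurable_fun setT (@rV_uncons n).
Proof.
apply/measurable_fun_pairP; split; first exact: (@measurable_rV_coord R n.+1 ord0).
apply: measurable_rVP => i.
rewrite (_ : _ \o _ = rV_coord (lift ord0 i)); first exact: measurable_rV_coord.
by apply/funext => x; rewrite /= /rV_coord mxE.
Qed.

Section lebesgue_step.
Variables (n : nat) (mu : {sigma_finite_measure set 'rV[R]_n -> \bar R}).

Definition lebesgue_step : set 'rV[R]_n.+1 -> \bar R :=
  pushforward (@lebesgue_measure R \x mu) (@rV_cons n).

Let meas : {measure set 'rV[R]_n.+1 -> \bar R} :=
  measure_function_pushforward__canonical__measure_function_Measure
    (@lebesgue_measure R \x mu) (@measurable_rV_cons n).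

HB.instance Definition _ := Measure.copy lebesgue_step meas.

Let lebesgue_step_sigma_finite : sigma_finite setT lebesgue_step.
Proof.
have /sigma_finiteP[F [FT ndF Ffin]] := sigma_finiteT (@lebesgue_measure R).
have /sigma_finiteP[G [GT ndG Gfin]] := sigma_finiteT mu.
exists (fun k => @rV_uncons n @^-1` (F k `*` G k)) => [|k].
  rewrite -preimage_bigcup -[LHS](preimage_setT (@rV_uncons n)); congr preimage.
  apply/esym; rewrite -subTset => -[a y] _.
  have [i _ Fi] : (\bigcup_i F i) a by rewrite -FT.
  have [j _ Gj] : (\bigcup_i G i) y by rewrite -GT.
  exists (maxn i j) => //; split=> /=.
    by apply: (subsetPset _ _ (ndF _ _ (leq_maxl i j))).
  by apply: (subsetPset _ _ (ndG _ _ (leq_maxr i j))).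
have [[mF Fk] [mG Gk]] := (Ffin k, Gfin k); split.
  by rewrite -[X in measurable X]setTI; apply: measurable_rV_uncons => //;
    exact: measurableX.
rewrite /lebesgue_step /pushforward -comp_preimage.
rewrite (_ : _ \o _ = id); last by apply/funext => p; exact: rV_consK.
by rewrite preimage_id product_measure1E// lte_mul_pinfty// ge0_fin_numE.
Qed.

HB.instance Definition _ :=
  Measure_isSigmaFinite.Build _ _ _ lebesgue_step lebesgue_step_sigma_finite.

End lebesgue_step.

(* 'rV[R]_0 is a point; R^(n+1) = R x R^n carries the product measure. *)
Fixpoint lebesgue_rV n : {sigma_finite_measure set 'rV[R]_n -> \bar R} :=
  match n with
  | 0 => dirac (0%R : 'rV[R]_0)
  | n'.+1 => lebesgue_step (lebesgue_rV n')
  end.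

End lebesgue_rV.

Section smoothness.
Context {R : realType}.

(* C^k for k finite: derivatives along all directions, iterated k times, exist
   and are continuous. *)
Fixpoint differentiable_class (W : normedModType R) (k : nat) (f : W -> R)
    : Prop :=
  match k with
  | 0 => continuous f
  | k'.+1 => continuous f /\ forall v : W, (forall x, derivable f x v) /\
      differentiable_class k' (fun x => 'D_v f x)
  end.

Definition smooth (W : normedModType R) (f : W -> R) :=
  forall k, differentiable_class k f.

Definition csmooth (W : normedModType R) (f : W -> R[i]) :=
  smooth (fun x => complex.Re (f x)) /\ smooth (fun x => complex.Im (f x)).

(* C^oo of a set that need not be open, e.g. C^oo(closure Omega) or
   C^oo([0,oo) x R^n): restrictions of smooth functions on the whole space. *)
Definition smooth_on (W : normedModType R) (D : set W) (f : W -> R) :=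
  exists2 g : W -> R, smooth g & forall x, D x -> f x = g x.

Definition tsupport (W : normedModType R) (V : zmodType) (f : W -> V) : set W :=
  closure [set x | f x != 0].

(* C_0^oo(U), its elements being extended by 0 to the whole space. *)
Definition test_fun (W : normedModType R) (U : set W) : set (W -> R[i]) :=
  [set f | [/\ csmooth f, compact (tsupport f) & tsupport f `<=` U]].

Definition smooth_bounded_domain n (Omega : set 'rV[R]_n) :=
  [/\ Omega !=set0, open Omega, connected Omega, bounded_set Omega &
    (* near each boundary point, Omega is a strict sublevel set of a smooth
       function with nonzero differential at this point *)
    forall x, (closure Omega `\` Omega) x ->
      exists (U : set 'rV[R]_n) (rho : 'rV[R]_n -> R),
        [/\ nbhs x U, smooth rho, exists v, 'D_v rho x != 0 &
            forall y, U y -> (Omega y <-> rho y < 0)]].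

End smoothness.

Section forms.
Context {R : realType}.

Definition cintegral d (T : measurableType d) (mu : {measure set T -> \bar R})
    (D : set T) (f : T -> R[i]) : R[i] :=
  (\int[mu]_(x in D) complex.Re (f x)) +i* (\int[mu]_(x in D) complex.Im (f x)).

Definition grad n (f : 'rV[R]_n -> R[i]) (x : 'rV[R]_n) : 'rV[R[i]]_n :=
  \row_i ('D_(delta_mx ord0 i) (fun y => complex.Re (f y)) x
        +i* 'D_(delta_mx ord0 i) (fun y => complex.Im (f y)) x).

Definition cdot n (a b : 'rV[R[i]]_n) : R[i] :=
  \sum_i a ord0 i * (b ord0 i)^*.

Definition form_HD n (Omega : set 'rV[R]_n) (sigma : 'rV[R]_n -> R)
    (u v : 'rV[R]_n -> R[i]) : R[i] :=
  cintegral (lebesgue_rV R n) Omega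
    (fun x => (sigma x)%:C * cdot (grad u x) (grad v x)).

Definition form_L2 n (Omega : set 'rV[R]_n) (u v : 'rV[R]_n -> R[i]) : R[i] :=
  cintegral (lebesgue_rV R n) Omega (fun x => u x * (v x)^*).

Definition square_integrable n (Omega : set 'rV[R]_n)
    : set ('rV[R]_n -> R[i]) :=
  [set f : 'rV[R]_n -> R[i] | [/\ measurable_fun Omega (fun x => complex.Re (f x)),
               measurable_fun Omega (fun x => complex.Im (f x)) &
      (\int[lebesgue_rV R n]_(x in Omega)
        (complex.Re (f x) ^+ 2 + complex.Im (f x) ^+ 2)%:E < +oo)%E]].

Definition half_cylinder n (Omega : set 'rV[R]_n) : set (R * 'rV[R]_n)%type :=
  [set z | 0 < z.1 /\ Omega z.2].

Definition memory_kernel n (p : R) (m : R * 'rV[R]_n -> R) (s : R)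
    (x : 'rV[R]_n) : R := s `^ (p - 1) * m (s, x).

Definition form_M n (Omega : set 'rV[R]_n) (p : R) (m : R * 'rV[R]_n -> R)
    (eta1 eta2 : R * 'rV[R]_n -> R[i]) : R[i] :=
  cintegral lebesgue_measure `]0, +oo[%classic (fun s =>
    cintegral (lebesgue_rV R n) Omega (fun x =>
      (memory_kernel p m s x)%:C *
      cdot (grad (fun y => eta1 (s, y)) x) (grad (fun y => eta2 (s, y)) x))).

Definition seminorm (T : Type) (B : (T -> R[i]) -> (T -> R[i]) -> R[i])
    (u : T -> R[i]) : R := Num.sqrt (complex.Re (B u u)).

End forms.

Section spaces.
Context {R : realType} {T : Type}.
Variables (D : set (T -> R[i])) (B : (T -> R[i]) -> (T -> R[i]) -> R[i]).

(* A completion of D modulo the null space of the seminorm of the form B: a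
   complete space with a linear isometric map from D onto a dense subspace
   (the null space is the kernel of this map). It is unique up to a unique
   isometric isomorphism. The map is irrelevant outside D. *)
Record completion := Completion {
  completion_sort :> completeNormedModType R[i] ;
  to_completion : (T -> R[i]) -> completion_sort ;
  to_completion_linear : forall a u v, D u -> D v ->
    to_completion (fun x => a * u x + v x) =
    a *: to_completion u + to_completion v ;
  to_completion_norm : forall u, D u ->
    `|to_completion u| = (seminorm B u)%:C ;
  to_completion_dense : dense (to_completion @` D) }.

(* The quotient of D itself by the null space of this seminorm. *)
Record normed_quotient := NormedQuotient {
  quotient_sort :> normedModType R[i] ;
  to_quotient : (T -> R[i]) -> quotient_sort ;
  to_quotient_linear : forall a u v, D u -> D v ->
    to_quotient (fun x => a * u x + v x) =
    a *: to_quotient u + to_quotient v ;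
  to_quotient_norm : forall u, D u ->
    `|to_quotient u| = (seminorm B u)%:C ;
  to_quotient_surj : forall y, exists2 u, D u & to_quotient u = y }.

End spaces.
Arguments to_completion {R T D B} c u.
Arguments to_quotient {R T D B} n u.

Definition space_HD {R : realType} n (Omega : set 'rV[R]_n)
    (sigma : 'rV[R]_n -> R) :=
  completion (test_fun Omega) (form_HD Omega sigma).

Definition space_L2 {R : realType} n (Omega : set 'rV[R]_n) :=
  normed_quotient (square_integrable Omega) (form_L2 Omega).

Definition space_M {R : realType} n (Omega : set 'rV[R]_n) (p : R)
    (m : R * 'rV[R]_n -> R) :=
  completion (test_fun (half_cylinder Omega)) (form_M Omega p m).

(* The extension by continuity along j : D -> X of f : D -> Y, evaluated at x:
   the limit of f t as j t tends to x, t in D. *)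
Definition cont_ext (T : Type) (X : topologicalType) (Y : pnbhsType)
    (D : set T) (j : T -> X) (f : T -> Y) (x : X) : Y :=
  lim [set A : set Y | exists2 U, nbhs x U &
                         forall t, D t -> U (j t) -> A (f t)].

Section semigroups.
Context {R : realType} {X : normedModType R[i]}.
Implicit Types T : R -> X -> X.

(* Contractivity is with respect to N, which is to be a norm equivalent to that
   of X. *)
Record contraction_semigroup (N : X -> R) T : Prop := {
  csg_linear : forall t, 0 <= t -> linear (T t) ;
  csg0 : T 0 = id ;
  csgD : forall s t, 0 <= s -> 0 <= t -> T (s + t) = T s \o T t ;
  csg_cvg : forall x, T t x @[t --> 0^'+] --> x ;
  csg_contraction : forall t x, 0 <= t -> N (T t x) <= N x }.

Definition generator_dom T : set X :=
  [set x | cvg (h%:C^-1 *: (T h x - x) @[h --> 0^'+])].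

Definition generator T (x : X) : X :=
  lim (h%:C^-1 *: (T h x - x) @[h --> 0^'+]).

Definition generates_contraction_semigroup (N : X -> R) (D : set X)
    (L : X -> X) :=
  exists T, [/\ contraction_semigroup N T, generator_dom T = D &
                forall x, D x -> generator T x = L x].

End semigroups.

Section operators.
Context {R : realType} {n : nat}.
Context {Omega : set 'rV[R]_n} {sigma : 'rV[R]_n -> R}.
Context {p : R} {m : R * 'rV[R]_n -> R}.
Variables (HD : space_HD Omega sigma) (L2 : space_L2 Omega).
Variable M : space_M Omega p m.

Local Notation test := (test_fun Omega).
Local Notation testM := (test_fun (half_cylinder Omega)).

(* Elements of the dual of H_D are represented as (antilinear) functions on
   H_D. *)
Definition Delta_sigma (u phi : HD) : R[i]^o :=
  cont_ext (test `*` test)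
    (fun w => (to_completion HD w.1, to_completion HD w.2))
    (fun w => - form_HD Omega sigma w.1 w.2 : R[i]^o) (u, phi).

Definition Q_op (eta : M) (phi : HD) : R[i]^o :=
  cont_ext (testM `*` test)
    (fun w => (to_completion M w.1, to_completion HD w.2))
    (fun w => - form_M Omega p m w.1 (fun z => w.2 z.2) : R[i]^o) (eta, phi).

Definition right_shift (t : R) (eta : R * 'rV[R]_n -> R[i])
    (z : R * 'rV[R]_n) : R[i] :=
  if z.1 <= t then 0 else eta (z.1 - t, z.2).

Definition S_semigroup (t : R) : M -> M :=
  cont_ext testM (to_completion M)
    (fun eta => to_completion M (right_shift t eta)).

Definition A_dom : set M := generator_dom S_semigroup.
Definition A_op : M -> M := generator S_semigroup.

Definition cutoff_seq (chi : nat -> R -> R) :=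
  [/\ forall j, [/\ smooth (chi j), compact (tsupport (chi j)) &
                    tsupport (chi j) `<=` `]0, +oo[%classic],
      forall j s, 0 <= chi j s <= 1 &
      forall s, 0 < s -> chi ^~ s @ \oo --> (1 : R)].

(* All cutoff sequences lead to the same limit. *)
Definition J_test (v : 'rV[R]_n -> R[i]) : M :=
  get [set y : M | forall chi, cutoff_seq chi ->
    (fun j => to_completion M (fun z => (chi j z.1)%:C * v z.2)) @ \oo --> y].

Definition J_op : HD -> M := cont_ext test (to_completion HD) J_test.

(* The inclusion of H_D into L^2. *)
Definition HD_L2 : HD -> L2 := cont_ext test (to_completion HD) (to_quotient L2).

(* The functional F on H_D is represented by the element g of L^2. *)
Definition represents (g : L2) (F : HD -> R[i]^o) :=
  exists f, [/\ square_integrable Omega f, to_quotient L2 f = g &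
    forall phi, test phi -> F (to_completion HD phi) = form_L2 Omega f phi].

(* Inverses of the (injective) inclusions of H_D into L^2 and of L^2 into the
   dual of H_D, on their ranges. *)
Definition L2_to_HD (v : L2) : HD := get [set w | HD_L2 w = v].
Definition dual_to_L2 (F : HD -> R[i]^o) : L2 := get [set g | represents g F].

Definition space_H : normedModType R[i] := (HD * L2 * M)%type.

(* The norm of the orthogonal direct sum; the norm of the product type is the
   (equivalent) max norm. *)
Definition norm_H (x : space_H) : R :=
  Num.sqrt (complex.Re `|x.1.1| ^+ 2 + complex.Re `|x.1.2| ^+ 2 +
            complex.Re `|x.2| ^+ 2).

Definition L_dom : set space_H := [set x |
  let: (u, v, eta) := x in
  [/\ exists w, HD_L2 w = v,
      exists g, represents g (fun phi => Delta_sigma u phi + Q_op eta phi) &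
      A_dom eta]].

Definition L_op (x : space_H) : space_H :=
  let: (u, v, eta) := x in
  (L2_to_HD v,
   dual_to_L2 (fun phi => Delta_sigma u phi + Q_op eta phi),
   A_op eta + J_op (L2_to_HD v)).

End operators.
Arguments norm_H {R n Omega sigma p m} HD L2 M x.
Arguments L_dom {R n Omega sigma p m} HD L2 M x.
Arguments L_op {R n Omega sigma p m} HD L2 M x.

(* Main.v *)
From HB Require Import structures.
Require Import Defs.
From mathcomp Require Import all_boot all_order all_algebra.
From mathcomp Require Import complex.
From mathcomp Require Import all_classical all_reals all_analysis.
From mathcomp Require Import measurable_realfun ess_sup_inf.
From mathcomp Require Import ring lra.
Set Implicit Arguments. Unset Strict Implicit. Unset Printing Implicit Defensive.
Import Order.TTheory GRing.Theory Num.Theory numFieldNormedType.Exports.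
Local Open Scope classical_set_scope.
Local Open Scope complex_scope.
Local Open Scope ring_scope.

(** Why L generates a contraction semigroup.  For (u, v, eta) in the domain the
    real part of (L (u, v, eta), (u, v, eta)) is that of (A eta, eta): the terms
    (v, u) and (Delta_sigma u, v) cancel because - Delta_sigma represents the
    inner product of H_D, and the memory terms (Q eta, v) and (J v, eta) cancel
    because Q = - J^*.  What is left is nonpositive, since the right shift
    contracts M: translating time back replaces the kernel at s by the kernel at
    s + t, and the kernel is nonincreasing in s.  So L is dissipative, and by the
    Lumer-Phillips theorem [lumer_phillips] it remains to solve
    (1 - h L) x = y for every h > 0.  Eliminating u and eta leaves a coercive
    variational equation for v in H_D, solved by [lax_milgram]; coercivity of its
    memory term is the accretivity of the resolvent of A.  This Hilbert space
    argument is [wave_semigroup].  Only real parts of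
    inner products enter, so it is carried out with real inner products; complex
    linearity of the semigroup is recovered from its commutation with the
    imaginary unit.

    The abstract spaces are only known as completions of spaces of functions for
    hermitian forms, and the operators as extensions by continuity.
    Polarization ([polar]) turns the norms into inner products, and
    [generation_of_forms] deduces the generation theorem from properties of the
    three forms on functions.

    For H_D and L^2 these are the Poincare inequality ([poincare]), which makes
    the inclusion of H_D in L^2 bounded; Green's formula ([form_HD_green]), which
    makes it injective; the completeness of L^2 ([riesz_fischer]); and the
    density of the test functions in L^2 ([test_dense]): a function orthogonal to
    them has, after multiplication by a bump, zero integral over every orthant.

    For M, a test function vanishes near s = 0 and for large s, so the
    singularity of the kernel is harmless, and integration over Omega yields
    continuous functions of time with compact support.  The shift is contractive
    by the monotonicity of the kernel ([shift_contraction]) and its orbits at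
    test functions are differentiable by the mean value theorem
    ([shift_quotient]), which gives the strong continuity and a dense domain of
    A.  A history that is constant in time has the integrable energy density
    s |-> \int_Omega m(s, x) |grad v|^2 dx, bounded in terms of the essential
    supremum of the kernel ([energy_mass]); dominated convergence then provides
    the limit J v of the truncated histories, for every sequence of cutoffs, and
    the boundedness of J. *)

(** * Real Hilbert spaces *)

(** Real inner products, also for complex spaces: only the real part of a
    complex inner product enters the notions of contraction and dissipativity. *)
Record ipspace (R : realType) := IPSpace {
  ips_sort :> lmodType R;
  ip : ips_sort -> ips_sort -> R;
  ip_linear : forall a x y z, ip (a *: x + y) z = a * ip x z + ip y z;
  ipC : forall x y, ip x y = ip y x;
  ip_gt0 : forall x, x != 0 -> 0 < ip x x }.

Section InnerProduct.
Context {R : realType} {V : ipspace R}.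
Implicit Types (x y z : V) (a : R).

Definition nrm x : R := Num.sqrt (ip x x).

Lemma ip0l y : ip 0 y = 0.
Proof. by have := ip_linear (-1) 0 0 y; rewrite scaler0 addr0; lra. Qed.

Lemma ipDl x y z : ip (x + y) z = ip x z + ip y z.
Proof. by rewrite -[x in LHS]scale1r ip_linear mul1r. Qed.

Lemma ipZl a x z : ip (a *: x) z = a * ip x z.
Proof. by rewrite -[_ *: _]addr0 ip_linear ip0l addr0. Qed.

Lemma ipNl x z : ip (- x) z = - ip x z.
Proof. by rewrite -scaleN1r ipZl mulN1r. Qed.

Lemma ipBl x y z : ip (x - y) z = ip x z - ip y z.
Proof. by rewrite ipDl ipNl. Qed.

Lemma ip0r y : ip y 0 = 0.
Proof. by rewrite ipC ip0l. Qed.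

Lemma ipDr x y z : ip z (x + y) = ip z x + ip z y.
Proof. by rewrite !(ipC z) ipDl. Qed.

Lemma ipZr a x z : ip z (a *: x) = a * ip z x.
Proof. by rewrite !(ipC z) ipZl. Qed.

Lemma ipNr x z : ip z (- x) = - ip z x.
Proof. by rewrite !(ipC z) ipNl. Qed.

Lemma ipBr x y z : ip z (x - y) = ip z x - ip z y.
Proof. by rewrite ipDr ipNr. Qed.

Lemma ip_ge0 x : 0 <= ip x x.
Proof. by have [->|/ip_gt0/ltW//] := eqVneq x 0; rewrite ip0l. Qed.

Lemma ip_eq0 x : ip x x = 0 -> x = 0.
Proof. by apply: contra_eq => /ip_gt0; rewrite lt0r => /andP[]. Qed.

Lemma ip_ext x y : (forall z, ip x z = ip y z) -> x = y.
Proof.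
by move=> h; apply/eqP; rewrite -subr_eq0; apply/eqP/ip_eq0; rewrite ipBl h subrr.
Qed.

Lemma sqr_nrm x : nrm x ^+ 2 = ip x x.
Proof. by rewrite sqr_sqrtr// ip_ge0. Qed.

Lemma nrm_ge0 x : 0 <= nrm x.
Proof. exact: sqrtr_ge0. Qed.

Lemma nrm0 : nrm 0 = 0.
Proof. by rewrite /nrm ip0l sqrtr0. Qed.

Lemma nrm_eq0 x : nrm x = 0 -> x = 0.
Proof. by move=> x0; apply: ip_eq0; rewrite -sqr_nrm x0 expr0n. Qed.

Lemma nrmZ a x : nrm (a *: x) = `|a| * nrm x.
Proof.
by rewrite /nrm ipZl ipZr mulrA -expr2 sqrtrM ?sqr_ge0// sqrtr_sqr.
Qed.

Lemma nrmN x : nrm (- x) = nrm x.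
Proof. by rewrite /nrm ipNl ipNr opprK. Qed.

Lemma nrmBC x y : nrm (x - y) = nrm (y - x).
Proof. by rewrite -nrmN opprB. Qed.

Lemma ip_le x y : ip x y <= nrm x * nrm y.
Proof.
have [->|y0] := eqVneq y 0; first by rewrite ip0r nrm0 mulr0.
have [|xy0] := leP (ip x y) 0.
  by move/le_trans; apply; rewrite mulr_ge0 ?nrm_ge0.
rewrite -(@ler_pXn2r _ 2) ?nnegrE ?mulr_ge0 ?nrm_ge0 ?(ltW xy0)//.
rewrite exprMn !sqr_nrm; have yy := ip_gt0 y0.
have := ip_ge0 (ip y y *: x - ip x y *: y).
rewrite !(ipBl, ipBr, ipZl, ipZr) (ipC y x) => h.
have : 0 <= ip y y * (ip x x * ip y y - ip x y ^+ 2) by lra.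
by rewrite pmulr_rge0//; lra.
Qed.

Lemma ip_norm_le x y : `|ip x y| <= nrm x * nrm y.
Proof.
rewrite ler_norml ip_le andbT lerNl -ipNl.
by apply: le_trans (ip_le _ _) _; rewrite nrmN.
Qed.

Lemma nrmD x y : nrm (x + y) <= nrm x + nrm y.
Proof.
rewrite -(@ler_pXn2r _ 2) ?nnegrE ?addr_ge0 ?nrm_ge0//.
rewrite sqrrD !sqr_nrm ipDl !ipDr (ipC y x).
by have := ip_le x y; lra.
Qed.

Lemma nrmB x y z : nrm (x - z) <= nrm (x - y) + nrm (y - z).
Proof. by apply: le_trans (nrmD _ _); rewrite addrA subrK. Qed.

Lemma nrm_small x : (forall e, 0 < e -> nrm x <= e) -> x = 0.
Proof.
move=> xe; apply: nrm_eq0; apply/eqP; rewrite eq_le nrm_ge0 andbT.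
by apply/ler_addgt0Pr => e e0; rewrite add0r xe.
Qed.

Lemma eq_small x y : (forall e, 0 < e -> nrm (x - y) <= e) -> x = y.
Proof. by move=> /nrm_small/eqP; rewrite subr_eq0 => /eqP. Qed.

Definition hcvg (u : nat -> V) x :=
  forall e, 0 < e -> exists N, forall k, (N <= k)%N -> nrm (u k - x) <= e.

Definition hcauchy (u : nat -> V) :=
  forall e, 0 < e -> exists N, forall k l,
    (N <= k)%N -> (N <= l)%N -> nrm (u k - u l) <= e.

Lemma hcvg_cauchy u x : hcvg u x -> hcauchy u.
Proof.
move=> ux e e0; have [|N uN] := ux (e / 2); first by rewrite divr_gt0.
exists N => k l Nk Nl; apply: le_trans (nrmB _ x _) _.
by rewrite (nrmBC x); have := uN _ Nk; have := uN _ Nl; lra.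
Qed.

Lemma hcvg_le u x y c N : hcvg u x ->
  (forall k, (N <= k)%N -> nrm (u k - y) <= c) -> nrm (x - y) <= c.
Proof.
move=> ux uc; apply/ler_addgt0Pr => e /ux[M uM].
apply: le_trans (nrmB _ (u (maxn M N)) _) _; rewrite nrmBC addrC lerD//.
  by rewrite uc// leq_maxr.
by rewrite uM// leq_maxl.
Qed.

Lemma hcvg_unique u x y : hcvg u x -> hcvg u y -> x = y.
Proof.
move=> ux uy; apply: eq_small => e /uy[N uN].
by apply: hcvg_le ux _ => k /uN.
Qed.

Lemma hcvg_cst x : hcvg (fun=> x) x.
Proof. by move=> e e0; exists 0%N => k _; rewrite subrr nrm0 ltW. Qed.

Lemma hcvg_ip u x y e : hcvg u x -> 0 < e ->
  exists N, forall k, (N <= k)%N -> `|ip (u k) y - ip x y| <= e.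
Proof.
move=> ux e0; have y1 : 0 < nrm y + 1 by rewrite ltr_wpDl ?nrm_ge0.
have [|N uN] := ux (e / (nrm y + 1)); first by rewrite divr_gt0.
exists N => k /uN h; rewrite -ipBl; apply: le_trans (ip_norm_le _ _) _.
rewrite ler_pdivlMr // in h; apply: le_trans h.
by rewrite ler_wpM2l ?nrm_ge0// lerDl.
Qed.

Lemma hcvg_ip_eq u x y c : hcvg u x ->
  (forall e, 0 < e -> exists N, forall k, (N <= k)%N -> `|ip (u k) y - c| <= e) ->
  ip x y = c.
Proof.
move=> ux uc; apply/eqP; rewrite -subr_eq0 -normr_le0.
apply/ler_addgt0Pr => e e0; rewrite add0r.
have e2 : 0 < e / 2 by rewrite divr_gt0.
have [N1 h1] := hcvg_ip y ux e2; have [N2 h2] := uc _ e2.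
have := h1 _ (leq_maxl N1 N2); have := h2 _ (leq_maxr N1 N2).
set k := maxn _ _ => h3 h4.
rewrite (_ : ip x y - c = - (ip (u k) y - ip x y) + (ip (u k) y - c)); last by ring.
by apply: le_trans (ler_normD _ _) _; rewrite normrN; lra.
Qed.

Definition hcomplete := forall u, hcauchy u -> exists x, hcvg u x.

Definition subspace (D : set V) :=
  D 0 /\ forall a x y, D x -> D y -> D (a *: x + y).

End InnerProduct.
Arguments hcomplete {R} V.
Arguments hcvg_le {R V u x y c} N.

Section Projection.
Context {R : realType} {V : ipspace R}.
Hypothesis Vc : hcomplete V.
Implicit Types (x y z : V) (a : R) (D : set V).

Lemma inv_succ_small (e : R) : 0 < e ->
  exists N, forall k, (N <= k)%N -> k.+1%:R^-1 <= e.
Proof.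
move=> e0; exists (Num.bound e^-1) => k Nk.
rewrite -[leRHS]invrK lef_pV2 ?posrE ?invr_gt0//.
have := archi_boundP (ltW (_ : 0 < e^-1)).
rewrite invr_gt0 => /(_ e0)/ltW/le_trans; apply.
by rewrite ler_nat (leq_trans Nk).
Qed.

(** The quadratic functional |d|^2 - 2 f d is minimized over D: by the
    parallelogram identity a minimizing sequence is Cauchy, and the first
    variation at its limit y is the identity ip y d = f d. *)
Lemma riesz_subspace D (f : V -> R) (C : R) : subspace D ->
  (forall a x y, D x -> D y -> f (a *: x + y) = a * f x + f y) ->
  (forall x, D x -> `|f x| <= C * nrm x) ->
  exists y, (forall e, 0 < e -> exists2 d, D d & nrm (y - d) <= e) /\
            (forall d, D d -> ip y d = f d).
Proof.
move=> [D0 DL] fL fC.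
have f0 : f 0 = 0.
  by have := fL (-1) _ _ D0 D0; rewrite scaler0 addr0; lra.
pose q x := nrm x ^+ 2 - 2 * f x.
have qge x : D x -> - C ^+ 2 <= q x.
  move=> /fC; rewrite /q => h.
  have h1 : f x <= C * nrm x by apply: le_trans h; rewrite ler_norm.
  by have := sqr_ge0 (nrm x - C); nra.
have hi : has_inf (q @` D).
  split; first by exists (q 0), 0.
  by exists (- C ^+ 2) => _ [x Dx <-]; exact: qge.
set I := inf (q @` D).
have qI x : D x -> I <= q x by move=> Dx; apply: (ge_inf hi.2); exists x.
have hd k : exists d, D d /\ q d <= I + k.+1%:R^-1.
  have k0 : (0 : R) < k.+1%:R^-1 by rewrite invr_gt0.
  have [_ [d Dd <-] /ltW h] := inf_adherent k0 hi.
  by exists d.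
have [d dP] := choice hd.
have Dd k : D (d k) := (dP k).1.
have par k l : nrm (d k - d l) ^+ 2 <= 2 * k.+1%:R^-1 + 2 * l.+1%:R^-1.
  have Dm : D (2^-1 *: (1 *: d k + d l) + 0) by apply: (DL) => //; exact: DL.
  have := qI _ Dm; have := (dP k).2; have := (dP l).2.
  rewrite /q fL//; last by exact: DL.
  rewrite fL// f0 !sqr_nrm !(addr0, scale1r) mul1r.
  rewrite !(ipDl, ipDr, ipZl, ipZr, ipNl, ipNr) (ipC (d l) (d k)).
  set X := k.+1%:R^-1; set Y := l.+1%:R^-1; lra.
have dcau : hcauchy d.
  move=> e e0; have e2 : 0 < e ^+ 2 / 4 by rewrite divr_gt0 ?exprn_gt0.
  have [N hN] := inv_succ_small e2; exists N => k l /hN hk /hN hl.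
  rewrite -(@ler_pXn2r _ 2) ?nnegrE ?nrm_ge0 ?(ltW e0)//.
  apply: le_trans (par k l) _.
  by move: hk hl; set X := k.+1%:R^-1; set Y := l.+1%:R^-1; lra.
have [y dy] := Vc dcau; exists y; split.
  move=> e /dy[N /(_ N (leqnn _)) h]; exists (d N) => //.
  by rewrite nrmBC.
move=> x Dx; apply: hcvg_ip_eq dy _ => e e0.
have [x0|x0] := eqVneq (ip x x) 0.
  exists 0%N => k _; rewrite (ip_eq0 x0) ip0r f0 subrr normr0; exact: ltW.
have xx : 0 < ip x x by rewrite lt_def x0 ip_ge0.
have e2 : 0 < e ^+ 2 / ip x x by rewrite divr_gt0 ?exprn_gt0.
have [N hN] := inv_succ_small e2; exists N => k /hN hk.
rewrite ler_pdivlMr// in hk.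
have Dt : D ((- (ip (d k) x - f x) / ip x x) *: x + d k) by exact: DL.
have := qI _ Dt; have := (dP k).2; rewrite /q fL// !sqr_nrm.
rewrite !(ipDl, ipDr, ipZl, ipZr) (ipC x (d k)).
set X := k.+1%:R^-1 in hk *; set b := ip (d k) x - f x => h1 h2.
have h3 : b ^+ 2 <= X * ip x x.
  rewrite -ler_pdivrMr//.
  have -> : b ^+ 2 / ip x x = - (- b / ip x x * (- b / ip x x * ip x x) + 2 * (- b / ip x x) * b).
    by field; rewrite gt_eqF.
  by rewrite /b in h2 *; lra.
rewrite -(@ler_pXn2r _ 2) ?nnegrE ?(ltW e0)// real_normK ?num_real//.
exact: le_trans h3 hk.
Qed.

Lemma riesz (f : V -> R) (C : R) :
  (forall a x y, f (a *: x + y) = a * f x + f y) ->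
  (forall x, `|f x| <= C * nrm x) -> exists y, forall x, ip y x = f x.
Proof.
move=> fL fC.
have [y [_ yf]] := @riesz_subspace setT f C (conj I (fun _ _ _ _ _ => I))
  (fun a x y _ _ => fL a x y) (fun x _ => fC x).
by exists y => x; exact: yf.
Qed.

(** The vector y given by [riesz_subspace] for the functional ip x is the
    projection of x on the closure of D; as x - y is orthogonal to D, x = y. *)
Lemma dense_of_orth D : subspace D ->
  (forall y, (forall d, D d -> ip y d = 0) -> y = 0) ->
  forall x e, 0 < e -> exists2 d, D d & nrm (x - d) <= e.
Proof.
move=> DS D0 x; have [y [yD yx]] := @riesz_subspace D (ip x) (nrm x) DS
  (fun a u v _ _ => etrans (ipDr _ _ _) (congr1 (+%R^~ _) (ipZr a u x)))
  (fun v _ => ip_norm_le x v).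
suff -> : x = y by [].
apply/eqP; rewrite -subr_eq0; apply/eqP/D0 => d Dd.
by rewrite ipBl yx// subrr.
Qed.

(** Coercivity makes the operator T representing the form injective with
    closed range, and a vector orthogonal to the range is annihilated by the
    form on the diagonal; so T is onto. *)
Lemma lax_milgram (a : V -> V -> R) (C c : R) (f : V -> R) : 0 < c ->
  (forall k u v w, a (k *: u + v) w = k * a u w + a v w) ->
  (forall k u v w, a w (k *: u + v) = k * a w u + a w v) ->
  (forall u v, `|a u v| <= C * nrm u * nrm v) ->
  (forall u, c * nrm u ^+ 2 <= a u u) ->
  (exists y, forall v, f v = ip y v) ->
  exists u, forall v, a u v = f v.
Proof.
move=> c0 aL aR aC ac [y yf].
have hT u : exists w, forall v, ip w v = a u v.
  by apply: (@riesz (a u) (C * nrm u)) => [k v w|v]; [exact: aR|exact: aC].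
have [T TP] := choice hT.
have TB u v : T u - T v = T (u - v).
  by apply: ip_ext => z; rewrite ipBl !TP (addrC u) -scaleN1r aL; ring.
have a0 w : a 0 w = 0.
  by have := aL (-1) 0 0 w; rewrite scaler0 addr0; lra.
have coer u : c * nrm u <= nrm (T u).
  have [->|u0] := eqVneq u 0; first by rewrite nrm0 mulr0 nrm_ge0.
  have nu : 0 < nrm u.
    by rewrite lt_def nrm_ge0 andbT; apply: contra_neq u0 => /nrm_eq0.
  rewrite -(ler_pM2r nu) -mulrA -expr2; apply: le_trans (ac u) _.
  by rewrite -TP; exact: ip_le.
have rangeS : subspace [set w | exists u, w = T u].
  split; first by exists 0; apply: ip_ext => z; rewrite TP a0 ip0l.
  move=> b _ _ [u ->] [v ->]; exists (b *: u + v).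
  by apply: ip_ext => z; rewrite ip_linear !TP aL.
have rangeD w : (forall d, [set w | exists u, w = T u] d -> ip w d = 0) -> w = 0.
  move=> h; apply: nrm_eq0; apply/eqP.
  have : c * nrm w ^+ 2 <= 0.
    by apply: le_trans (ac w) _; rewrite -TP ipC h//; exists w.
  by rewrite pmulr_rle0// => h1; rewrite -sqrf_eq0 eq_le h1 sqr_ge0.
have hu (k : nat) : exists u, nrm (y - T u) <= k.+1%:R^-1.
  have k0 : (0 : R) < k.+1%:R^-1 by rewrite invr_gt0.
  by have [d [u ->] h] := dense_of_orth rangeS rangeD y k0; exists u.
have [u_ uP] := choice hu.
have Tu : hcvg (T \o u_) y.
  move=> e /inv_succ_small[N hN]; exists N => k Nk /=.
  by rewrite nrmBC (le_trans (uP k))// hN.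
have ucau : hcauchy u_.
  move=> e e0; have [|N hN] := hcvg_cauchy Tu (e := c * e); first exact: mulr_gt0.
  exists N => k l Nk Nl; have := hN _ _ Nk Nl; rewrite /= TB => h.
  by rewrite -(ler_pM2l c0); exact: le_trans (coer _) h.
have [u uu] := Vc ucau; exists u => v; rewrite yf -TP.
congr ip; apply: hcvg_unique Tu => e e0.
have C1 : 0 < `|C| + 1 by rewrite ltr_wpDl.
have [|N hN] := uu (e / (`|C| + 1)); first exact: divr_gt0.
exists N => k /hN; rewrite ler_pdivlMr// => h /=; rewrite TB.
set w := u_ k - u in h *.
have [->|Tw0] := eqVneq (nrm (T w)) 0; first exact: ltW.
have Tw : 0 < nrm (T w) by rewrite lt_def Tw0 nrm_ge0.
rewrite -(ler_pM2r Tw) -expr2 sqr_nrm TP.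
apply: le_trans (ler_norm _) _; apply: le_trans (aC _ _) _.
rewrite ler_pM2r//; apply: le_trans h; rewrite mulrC ler_wpM2l ?nrm_ge0//.
by rewrite (le_trans (ler_norm _))// lerDl.
Qed.

End Projection.

(** * Contraction semigroups and their generators *)

Ltac by_ip := apply: ip_ext => ?; rewrite !(ipDl, ipNl, ipZl, ip0l); ring.

Section ContractionSemigroup.
Context {R : realType} {V : ipspace R}.
Implicit Types (x y z w : V) (S : R -> V -> V).

Record csemigroup S : Prop := CSemigroup {
  cs_linear : forall t a x y, 0 <= t -> S t (a *: x + y) = a *: S t x + S t y ;
  cs0 : forall x, S 0 x = x ;
  csD : forall s t x, 0 <= s -> 0 <= t -> S (s + t) x = S s (S t x) ;
  cs_contr : forall t x, 0 <= t -> nrm (S t x) <= nrm x ;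
  cs_cont : forall x e, 0 < e ->
    exists2 d, 0 < d & forall h, 0 <= h < d -> nrm (S h x - x) <= e }.

(** The graph of the generator: z is the right derivative at 0 of the orbit
    of x. *)
Definition gen S x z := forall e, 0 < e ->
  exists2 d, 0 < d & forall h, 0 < h < d -> nrm (S h x - x - h *: z) <= e * h.

Lemma half_between (d : R) : 0 < d -> 0 < d / 2 < d.
Proof. by move=> d0; apply/andP; split; lra. Qed.

Lemma nrmD4 x y z w : nrm (x + y + z + w) <= nrm x + nrm y + nrm z + nrm w.
Proof. by do 2![apply: le_trans (nrmD _ _) _; rewrite lerD2r]; exact: nrmD. Qed.

Variables (S : R -> V -> V) (SP : csemigroup S).

Lemma csDE t x y : 0 <= t -> S t (x + y) = S t x + S t y.
Proof. by move=> t0; rewrite -[x]scale1r (cs_linear SP)// !scale1r. Qed.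

Lemma cs00 t : 0 <= t -> S t 0 = 0.
Proof.
move=> t0; have := csDE 0 0 t0; rewrite addr0 => h.
by apply: (addrI (S t 0)); rewrite -h addr0.
Qed.

Lemma csZE t a x : 0 <= t -> S t (a *: x) = a *: S t x.
Proof. by move=> t0; rewrite -[_ *: x]addr0 (cs_linear SP)// cs00// addr0. Qed.

Lemma csNE t x : 0 <= t -> S t (- x) = - S t x.
Proof. by move=> t0; rewrite -scaleN1r csZE// scaleN1r. Qed.

Lemma gen_linear a x y z w : gen S x z -> gen S y w ->
  gen S (a *: x + y) (a *: z + w).
Proof.
move=> xz yw e e0; have a1 : 0 < `|a| + 1 by rewrite ltr_wpDl.
have [|d1 d10 h1] := xz (e / 2 / (`|a| + 1)); first by rewrite !divr_gt0.
have [|d2 d20 h2] := yw (e / 2); first by rewrite divr_gt0.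
exists (Num.min d1 d2); first by rewrite lt_min d10.
move=> h /andP[h0]; rewrite lt_min => /andP[hd1 hd2].
have {}h1 := h1 h; rewrite h0 hd1 in h1; have {}h1 := h1 isT.
have {}h2 := h2 h; rewrite h0 hd2 in h2; have {}h2 := h2 isT.
rewrite (cs_linear SP) ?(ltW h0)//.
rewrite (_ : _ - _ = a *: (S h x - x - h *: z) + (S h y - y - h *: w)); last by by_ip.
apply: le_trans (nrmD _ _) _; rewrite nrmZ.
suff : `|a| * nrm (S h x - x - h *: z) <= e / 2 * h by lra.
apply: (@le_trans _ _ ((`|a| + 1) * nrm (S h x - x - h *: z))).
  by rewrite ler_wpM2r ?nrm_ge0// lerDl.
rewrite -ler_pdivlMl//; apply: le_trans h1 _.
by rewrite le_eqVlt; apply/orP; left; apply/eqP; ring.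
Qed.

Lemma gen_unique x z w : gen S x z -> gen S x w -> z = w.
Proof.
move=> xz xw; apply: eq_small => e e0.
have [|d1 d10 h1] := xz (e / 2); first by rewrite divr_gt0.
have [|d2 d20 h2] := xw (e / 2); first by rewrite divr_gt0.
set d := Num.min d1 d2; have d0 : 0 < d by rewrite lt_min d10.
have /andP[h0 hd] := half_between d0; set h := d / 2 in h0 hd.
move: hd; rewrite lt_min => /andP[hd1 hd2].
have {}h1 := h1 h; rewrite h0 hd1 in h1; have {}h1 := h1 isT.
have {}h2 := h2 h; rewrite h0 hd2 in h2; have {}h2 := h2 isT.
rewrite -(ler_pM2l h0) -[h in leLHS]gtr0_norm// -nrmZ.
rewrite (_ : h *: _ = (S h x - x - h *: w) - (S h x - x - h *: z)); last by by_ip.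
by apply: le_trans (nrmD _ _) _; rewrite nrmN; lra.
Qed.

(** Contractivity gives ip (S h x - x) x <= 0; divide by h. *)
Lemma gen_dissip x z : gen S x z -> ip z x <= 0.
Proof.
move=> xz; apply/ler_addgt0Pr => e e0; rewrite add0r.
have x1 : 0 < nrm x + 1 by rewrite ltr_wpDl ?nrm_ge0.
have [|d d0 hd] := xz (e / (nrm x + 1)); first by rewrite divr_gt0.
have hb := half_between d0; have {}hd := hd _ hb.
set h := d / 2 in hb hd; have /andP[h0 _] := hb; have h0' := ltW h0.
rewrite -(ler_pM2l h0).
have -> : h * ip z x = ip (S h x) x - ip x x - ip (S h x - x - h *: z) x.
  by rewrite !(ipBl, ipZl); ring.
have : ip (S h x) x <= ip x x.
  apply: le_trans (ip_le _ _) _; rewrite -sqr_nrm expr2 ler_wpM2r ?nrm_ge0//.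
  exact: (cs_contr SP).
have := ip_norm_le (S h x - x - h *: z) x.
have : nrm (S h x - x - h *: z) * nrm x <= h * e.
  apply: (@le_trans _ _ (nrm (S h x - x - h *: z) * (nrm x + 1))).
    by rewrite ler_wpM2l ?nrm_ge0// lerDl.
  rewrite -ler_pdivlMr//; apply: le_trans hd _.
  by rewrite le_eqVlt; apply/orP; left; apply/eqP; ring.
move=> h1 h2 h3; have := lerNnormlW (le_trans h2 h1); lra.
Qed.

Lemma gen_S x z t : 0 <= t -> gen S x z -> gen S (S t x) (S t z).
Proof.
move=> t0 xz e /xz[d d0 h1]; exists d => // h hd.
apply: le_trans (h1 h hd); have /andP[/ltW h0 _] := hd.
apply: le_trans (cs_contr SP _ t0).
by rewrite -(csD SP)// [h + t]addrC (csD SP)// !csDE// !csNE// csZE.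
Qed.

(** The orbit of x is compared with the straight line of direction w by
    cutting [0, h] into small steps; this plays the role of the formula
    S h x - x = \int_0^h S s z ds. *)
Lemma gen_increment x z w h b : gen S x z -> 0 < h ->
  (forall s, 0 <= s <= h -> nrm (S s w - w) <= b) ->
  nrm (S h x - x - h *: w) <= h * (nrm (z - w) + b).
Proof.
move=> xz h0 hb; apply/ler_addgt0Pr => e' e'0.
pose e := e' / h; have e0 : 0 < e by rewrite divr_gt0.
rewrite [X in _ <= X](_ : _ = h * (e + nrm (z - w) + b)); last first.
  by rewrite /e; field; rewrite gt_eqF.
have [d d0 hd] := xz e e0.
pose N := Num.bound (h / d); have N0 : (0 < N)%N.
  by rewrite -(ltr_nat R); apply: le_lt_trans (archi_boundP _); rewrite ?divr_ge0// ltW.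
have NR : (0 : R) < N%:R by rewrite ltr0n.
have Nd : h / N%:R < d.
  rewrite ltr_pdivrMr// mulrC -ltr_pdivrMr//.
  by apply: archi_boundP; rewrite divr_ge0// ltW.
set q := h / N%:R in Nd; have q0 : 0 < q by rewrite divr_gt0.
have hq : N%:R * q = h by rewrite /q mulrC divfK// gt_eqF.
have qd : 0 < q < d by rewrite q0.
have {hd}xq := hd q qd; have q0' := ltW q0.
suff step k : (k <= N)%N ->
    nrm (S (k%:R * q) x - x - (k%:R * q) *: w) <= k%:R * q * (e + nrm (z - w) + b).
  by have := step N (leqnn N); rewrite hq.
elim: k => [_|k IH kN].
  by rewrite !mul0r (cs0 SP) scale0r subrr subr0 nrm0.
have {}IH := IH (ltnW kN).
have kq0 : 0 <= k%:R * q by rewrite mulr_ge0.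
have kqh : k%:R * q <= h by rewrite -hq ler_pM2r// ler_nat ltnW.
have hk := hb (k%:R * q); rewrite kq0 kqh in hk; have {}hk := hk isT.
rewrite -natr1 mulrDl mul1r (csD SP)//.
rewrite (_ : _ - _ = S (k%:R * q) (S q x - x - q *: z) + q *: S (k%:R * q) (z - w)
   + q *: (S (k%:R * q) w - w) + (S (k%:R * q) x - x - (k%:R * q) *: w)); last first.
  by rewrite !(csDE, csNE, csZE)//; by_ip.
apply: le_trans (nrmD4 _ _ _ _) _; rewrite !nrmZ !gtr0_norm//.
have h1 := le_trans (cs_contr SP (S q x - x - q *: z) kq0) xq.
have h2 : q * nrm (S (k%:R * q) (z - w)) <= q * nrm (z - w).
  by rewrite ler_pM2l//; exact: (cs_contr SP).
have h3 : q * nrm (S (k%:R * q) w - w) <= q * b by rewrite ler_pM2l.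
by lra.
Qed.

(** By [gen_increment] the increments of the orbits of the approximations x'
    are controlled uniformly, and pass to the limit. *)
Lemma gen_closed x z : (forall e, 0 < e -> exists x' z',
  [/\ gen S x' z', nrm (x - x') <= e & nrm (z - z') <= e]) -> gen S x z.
Proof.
move=> xz e e0; have e2 : 0 < e / 2 by rewrite divr_gt0.
have [d d0 hd] := cs_cont SP z e2.
exists d => // h /andP[h0 hd']; have h0' := ltW h0.
have e'0 : 0 < h * (e / 2) / (2 + h) by apply: divr_gt0; [exact: mulr_gt0|lra].
have [x' [z' [g xx zz]]] := xz _ e'0; set e' := _ / (2 + h) in xx zz.
have ee : e' * (2 + h) = h * (e / 2) by rewrite /e' divfK// gt_eqF//; lra.
rewrite (_ : _ - _ - _ = S h (x - x') + (- (x - x')) + (S h x' - x' - h *: z) + 0); last first.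
  by rewrite csDE// csNE//; by_ip.
apply: le_trans (nrmD4 _ _ _ _) _; rewrite nrm0 nrmN.
have h1 := cs_contr SP (x - x') h0'.
have := @gen_increment x' z' z h (e / 2) g h0.
have h4 s : 0 <= s <= h -> nrm (S s z - z) <= e / 2.
  by move=> /andP[s0 sh]; apply: hd; rewrite s0 (le_lt_trans sh).
move=> /(_ h4) h2; have h3 : h * nrm (z' - z) <= h * e' by rewrite ler_pM2l// nrmBC.
by lra.
Qed.

Hypothesis Vc : hcomplete V.
Hypothesis domD : forall x e, 0 < e -> exists x' z, gen S x' z /\ nrm (x - x') <= e.

(** For y orthogonal to the range of l - A and x in the domain, the bounded
    sequence ip (S (k h) x) y grows at least like (1 + l h)^k up to an error
    of size e / l, hence it starts within e / l of 0. *)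
Lemma gen_range_orth l y : 0 < l ->
  (forall x z, gen S x z -> ip (l *: x - z) y = 0) -> y = 0.
Proof.
move=> l0 yo.
have xy0 x z : gen S x z -> ip x y = 0.
  move=> xz; apply/eqP; rewrite -normr_le0; apply/ler_addgt0Pr => e' e'0.
  rewrite add0r leNgt; apply/negP => lte.
  have y1 : 0 < nrm y + 1 by rewrite ltr_wpDl ?nrm_ge0.
  pose e := e' * l / (nrm y + 1).
  have e0 : 0 < e by rewrite divr_gt0 ?mulr_gt0.
  have [d d0 hd] := xz e e0; have hb := half_between d0.
  have {}hd := hd _ hb; set h := d / 2 in hb hd.
  have /andP[h0 _] := hb; have h0' := ltW h0.
  pose g k := ip (S (k%:R * h) x) y.
  have kh0 k : 0 <= k%:R * h by rewrite mulr_ge0.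
  have gS k : `|g k.+1 - (1 + l * h) * g k| <= l * h * e'.
    have := yo _ _ (gen_S (kh0 k) xz); rewrite ipBl ipZl => /subr0_eq hz.
    have -> : g k.+1 - (1 + l * h) * g k = ip (S (k%:R * h) (S h x - x - h *: z)) y.
      rewrite /g -natr1 mulrDl mul1r (csD SP)// !csDE// !csNE// csZE//.
      by rewrite !(ipDl, ipNl, ipZl) -hz; ring.
    apply: le_trans (ip_norm_le _ _) _.
    apply: (@le_trans _ _ (e * h * (nrm y + 1))).
      rewrite ler_pM ?nrm_ge0// ?lerDl//.
      by apply: le_trans hd; exact: (cs_contr SP).
    by rewrite /e le_eqVlt; apply/orP; left; apply/eqP; field; rewrite gt_eqF.
  have lh : 0 < l * h by rewrite mulr_gt0.
  have gk k : (1 + k%:R * (l * h)) * (`|g 0%N| - e') <= `|g k| - e'.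
    elim: k => [|k IH]; first by rewrite mul0r addr0 mul1r.
    have h1 : (1 + l * h) * `|g k| <= `|g k.+1| + l * h * e'.
      rewrite -[X in X * _]gtr0_norm -?normrM; last by rewrite addr_gt0.
      have := gS k; rewrite distrC; set a := (1 + l * h) * g k => h1.
      by rewrite -[a](subrK (g k.+1)); apply: le_trans (ler_normD _ _) _; lra.
    have ge : 0 <= `|g 0%N| - e'.
      by rewrite subr_ge0 /g mul0r (cs0 SP) ltW.
    have h2 : (1 + l * h) * ((1 + k%:R * (l * h)) * (`|g 0%N| - e')) <= (1 + l * h) * (`|g k| - e').
      by rewrite ler_pM2l// addr_gt0.
    have h3 : 0 <= k%:R * (l * h) * (l * h) * (`|g 0%N| - e').
      exact: mulr_ge0 (mulr_ge0 (mulr_ge0 (ler0n _ _) (ltW lh)) (ltW lh)) ge.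
    by rewrite -natr1; lra.
  have c0 : 0 < `|g 0%N| - e' by rewrite subr_gt0 /g mul0r (cs0 SP).
  set c := `|g 0%N| - e' in gk c0.
  pose B := nrm x * nrm y.
  have gB k : `|g k| <= B.
    apply: le_trans (ip_norm_le _ _) _; rewrite ler_wpM2r ?nrm_ge0//.
    exact: (cs_contr SP).
  have B0 : 0 <= B by rewrite mulr_ge0 ?nrm_ge0.
  pose k := Num.bound (B / (l * h * c)).
  have : B / (l * h * c) < k%:R.
    by apply: archi_boundP; exact: divr_ge0 B0 (ltW (mulr_gt0 lh c0)).
  rewrite ltr_pdivrMr; last exact: mulr_gt0.
  move=> h1; by have := gk k; have := gB k; lra.
apply: nrm_small => e e0.
have y1 : 0 < nrm y + 1 by rewrite ltr_wpDl ?nrm_ge0.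
have [x [z [xz yx]]] := domD y e0.
have [->|ny] := eqVneq (nrm y) 0; first exact: ltW.
have ny0 : 0 < nrm y by rewrite lt_def ny nrm_ge0.
rewrite -(ler_pM2r ny0) -expr2 sqr_nrm -[ip y y]subr0 -(xy0 _ _ xz) -ipBl.
by apply: le_trans (ip_le _ _) _; rewrite ler_pM2r.
Qed.

(** The range of l - A is dense, and it is closed because
    l |x| <= |(l - A) x| and A is closed. *)
Lemma gen_range l y : 0 < l -> exists x z, gen S x z /\ l *: x - z = y.
Proof.
move=> l0.
have g00 : gen S 0 0.
  have [x [z [xz _]]] := domD 0 ltr01.
  by have := gen_linear (-1) xz xz; rewrite !scaleN1r !addNr.
pose D := [set w | exists x z, gen S x z /\ l *: x - z = w].
have DS : subspace D.
  split; first by exists 0, 0; rewrite scaler0 subr0.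
  move=> a _ _ [x [z [xz <-]]] [x' [z' [xz' <-]]].
  exists (a *: x + x'), (a *: z + z'); split; first exact: gen_linear.
  by by_ip.
have Dd w : (forall d, D d -> ip w d = 0) -> w = 0.
  move=> h; apply: gen_range_orth l0 _ => x z xz.
  by rewrite ipC h//; exists x, z.
have hD (k : nat) : exists xz : V * V,
    gen S xz.1 xz.2 /\ nrm (y - (l *: xz.1 - xz.2)) <= k.+1%:R^-1.
  have k0 : (0 : R) < k.+1%:R^-1 by rewrite invr_gt0.
  by have [d [x [z [xz <-]]] h] := dense_of_orth Vc DS Dd y k0; exists (x, z).
have [u uP] := choice hD.
have yu : hcvg (fun k => l *: (u k).1 - (u k).2) y.
  move=> e /inv_succ_small[N hN]; exists N => k Nk.
  by rewrite nrmBC (le_trans (uP k).2)// hN.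
have coer k k' : l * nrm ((u k).1 - (u k').1) <=
    nrm ((l *: (u k).1 - (u k).2) - (l *: (u k').1 - (u k').2)).
  have := gen_linear (-1) (uP k').1 (uP k).1; rewrite !scaleN1r.
  rewrite addrC (addrC _ (u k).2) => g.
  set x := (u k).1 - (u k').1 in g *; set z := (u k).2 - _ in g.
  rewrite (_ : _ - _ - _ = l *: x - z); last by rewrite /x /z; by_ip.
  clearbody x z; have [->|nx] := eqVneq (nrm x) 0; first by rewrite mulr0 nrm_ge0.
  have nx0 : 0 < nrm x by rewrite lt_def nx nrm_ge0.
  rewrite -(ler_pM2r nx0) -mulrA -expr2 sqr_nrm; apply: le_trans (ip_le _ _).
  by rewrite ipBl ipZl; have := gen_dissip g; lra.
have uc : hcauchy (fun k => (u k).1).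
  move=> e e0; have [|N hN] := hcvg_cauchy yu (e := l * e); first exact: mulr_gt0.
  exists N => k k' Nk Nk'; rewrite -(ler_pM2l l0).
  exact: le_trans (coer k k') (hN _ _ Nk Nk').
have [x xu] := Vc uc; exists x, (l *: x - y); split; last by by_ip.
apply: gen_closed => e e0.
have e1 : 0 < Num.min e (e / 2 / l) by rewrite lt_min e0 !divr_gt0.
have [N1 h1] := xu _ e1; have [|N2 h2] := yu (e / 2); first by rewrite divr_gt0.
have := h1 _ (leq_maxl N1 N2); have := h2 _ (leq_maxr N1 N2).
set k := maxn _ _; rewrite le_min => h4 /andP[h5 h6].
exists (u k).1, (u k).2; split; [exact: (uP k).1|by rewrite nrmBC|].
rewrite (_ : _ - _ = - (l *: ((u k).1 - x)) + (l *: (u k).1 - (u k).2 - y)); last by by_ip.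
apply: le_trans (nrmD _ _) _; rewrite nrmN nrmZ gtr0_norm//.
by move: h6; rewrite ler_pdivlMr//; lra.
Qed.

End ContractionSemigroup.

(** * The Lumer-Phillips theorem *)

Section HilbertLimits.
Context {R : realType} {V : ipspace R}.
Implicit Types (x y z w : V).

Lemma hcvg_linear (u v : nat -> V) a x y : hcvg u x -> hcvg v y ->
  hcvg (fun k => a *: u k + v k) (a *: x + y).
Proof.
move=> ux vy e e0; have a1 : 0 < `|a| + 1 by rewrite ltr_wpDl.
have [|N1 h1] := ux (e / 2 / (`|a| + 1)); first by rewrite !divr_gt0.
have [|N2 h2] := vy (e / 2); first by rewrite divr_gt0.
exists (maxn N1 N2) => k; rewrite geq_max => /andP[/h1 {}h1 /h2 {}h2].
rewrite (_ : _ - _ = a *: (u k - x) + (v k - y)); last by by_ip.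
apply: le_trans (nrmD _ _) _; rewrite nrmZ.
rewrite ler_pdivlMr// in h1.
suff : `|a| * nrm (u k - x) <= nrm (u k - x) * (`|a| + 1) by lra.
by have := nrm_ge0 (u k - x); lra.
Qed.

Lemma hcvg_contr (u : nat -> V) (T : V -> V) x :
  (forall y z, nrm (T y - T z) <= nrm (y - z)) -> hcvg u x ->
  hcvg (fun k => T (u k)) (T x).
Proof.
move=> Tc ux e /ux[N h]; exists N => k /h; exact: le_trans.
Qed.

Lemma hcvg_squeeze (u v : nat -> V) x :
  (forall e, 0 < e -> exists N, forall k, (N <= k)%N -> nrm (u k - v k) <= e) ->
  hcvg u x -> hcvg v x.
Proof.
move=> uv ux e e0; have e2 : 0 < e / 2 by rewrite divr_gt0.
have [N1 h1] := uv _ e2; have [N2 h2] := ux _ e2.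
exists (maxn N1 N2) => k; rewrite geq_max => /andP[/h1 {}h1 /h2 {}h2].
by apply: le_trans (nrmB _ (u k) _) _; rewrite (nrmBC (v k)); lra.
Qed.

Lemma half_pow_small (c e : R) : 0 < e ->
  exists N, forall k, (N <= k)%N -> c / (2 ^ k)%:R <= e.
Proof.
move=> e0; have c1 : 0 < `|c| + 1 by rewrite ltr_wpDl.
have [|N h] := @inv_succ_small R (e / (`|c| + 1)); first exact: divr_gt0.
exists N => k /h; rewrite ler_pdivlMr// => {}h; apply: le_trans h.
have k0 : (0 : R) < k.+1%:R^-1 by rewrite invr_gt0.
have k2 : (0 : R) < (2 ^ k)%:R^-1 by rewrite invr_gt0 ltr0n expn_gt0.
apply: (@le_trans _ _ ((`|c| + 1) / (2 ^ k)%:R)).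
  by rewrite ler_pM2r//; have := ler_norm c; lra.
rewrite mulrC ler_pM2r// lef_pV2 ?posrE ?ltr0n ?expn_gt0// ler_nat.
exact: ltn_expl.
Qed.

End HilbertLimits.

Section Generation.
Context {R : realType} {V : ipspace R}.
Hypothesis Vc : hcomplete V.
Variable L : V -> V -> Prop.
Hypothesis L_linear : forall a x z y w, L x z -> L y w ->
  L (a *: x + y) (a *: z + w).
Hypothesis L_fun : forall x z w, L x z -> L x w -> z = w.
Hypothesis L_dissip : forall x z, L x z -> ip z x <= 0.
Hypothesis L_range : forall h y, 0 < h -> exists x z, L x z /\ x - h *: z = y.
Implicit Types (x y z w : V).

Lemma L00 : L 0 0.
Proof.
have [x [z [xz _]]] := L_range 0 ltr01.
by have := L_linear (-1) xz xz; rewrite !scaleN1r !addNr.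
Qed.

Lemma L_sub x z y w : L x z -> L y w -> L (x - y) (z - w).
Proof.
by move=> xz yw; have := L_linear (-1) yw xz; rewrite !scaleN1r !(addrC (- _)).
Qed.

Lemma L_scale a x z : L x z -> L (a *: x) (a *: z).
Proof. by move=> xz; have := L_linear a xz L00; rewrite !addr0. Qed.

Let dom : set V := [set x | exists z, L x z].

(** A vector y orthogonal to the domain is zero: for x with x - L x = y,
    dissipativity gives |x|^2 <= ip y x = 0. *)
Lemma dom_dense x e : 0 < e -> exists2 x', dom x' & nrm (x - x') <= e.
Proof.
apply: dense_of_orth => //.
  split; first by exists 0; exact: L00.
  by move=> a u v [z uz] [w vw]; exists (a *: z + w); exact: L_linear.
move=> y yo; have [u [z [uz uy]]] := L_range y ltr01.
have u0 : u = 0.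
  apply: ip_eq0; apply/eqP; rewrite eq_le ip_ge0 andbT.
  have := L_dissip uz; have := yo u (ex_intro _ z uz).
  by rewrite -uy ipBl scale1r; lra.
by move: uy uz; rewrite u0 => <- /L_fun/(_ L00)->; rewrite scaler0 subr0.
Qed.

Lemma resolvent_exists : exists J : R -> V -> V,
  (forall h y, 0 < h -> exists z, L (J h y) z /\ J h y - h *: z = y) /\
  (forall y, J 0 y = y).
Proof.
have hJ (hy : R * V) : exists x,
    (0 < hy.1 -> exists z, L x z /\ x - hy.1 *: z = hy.2) /\ (hy.1 = 0 -> x = hy.2).
  have [h0|h0] := ltP 0 hy.1.
    have [x [z xz]] := L_range hy.2 h0; exists x; split; first by exists z.
    by move=> e; move: h0; rewrite e ltxx.
  by exists hy.2; split.
have [J JP] := choice hJ; exists (fun h y => J (h, y)); split.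
  by move=> h y h0; exact: (JP (h, y)).1.
by move=> y; exact: (JP (0, y)).2.
Qed.

Variable J : R -> V -> V.
Hypothesis J_spec : forall h y, 0 < h -> exists z, L (J h y) z /\ J h y - h *: z = y.
Hypothesis J0 : forall y, J 0 y = y.

Lemma J_unique h x z y : 0 < h -> L x z -> x - h *: z = y -> x = J h y.
Proof.
move=> h0 xz xy; have [w [Jw wy]] := J_spec y h0.
have d := L_dissip (L_sub xz Jw).
have e : h *: (z - w) = x - J h y.
  apply: ip_ext => u; have : ip (x - h *: z) u = ip (J h y - h *: w) u by rewrite xy wy.
  by rewrite !(ipDl, ipNl, ipZl); lra.
apply/eqP; rewrite -subr_eq0; apply/eqP/ip_eq0/eqP; rewrite eq_le ip_ge0 andbT.
by rewrite -{1}e ipZl pmulr_rle0.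
Qed.

Lemma J_linear h a x y : 0 <= h -> J h (a *: x + y) = a *: J h x + J h y.
Proof.
rewrite le_eqVlt => /predU1P[<-|h0]; first by rewrite !J0.
have [z [xz ex]] := J_spec x h0; have [w [yw ey]] := J_spec y h0.
apply/esym/(J_unique h0 (L_linear a xz yw)).
by rewrite -[in RHS]ex -[in RHS]ey; by_ip.
Qed.

Lemma J_contr h y : 0 <= h -> nrm (J h y) <= nrm y.
Proof.
rewrite le_eqVlt => /predU1P[<-|h0]; first by rewrite J0.
have [z [xz ex]] := J_spec y h0; set x := J h y in xz ex *; clearbody x.
have [->|nx] := eqVneq (nrm x) 0; first exact: nrm_ge0.
have nx0 : 0 < nrm x by rewrite lt_def nx nrm_ge0.
rewrite -(ler_pM2r nx0) -expr2 sqr_nrm; apply: le_trans (ip_le _ _).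
rewrite -ex ipBl ipZl; have := L_dissip xz; nra.
Qed.

Lemma J_sub h x y : 0 <= h -> J h (x - y) = J h x - J h y.
Proof.
by move=> h0; rewrite addrC -scaleN1r J_linear// scaleN1r addrC.
Qed.

Lemma J_scale h a x : 0 <= h -> J h (a *: x) = a *: J h x.
Proof.
move=> h0; have J00 : J h 0 = 0 by have := J_sub 0 0 h0; rewrite !subrr.
by rewrite -[_ *: x]addr0 J_linear// J00 addr0.
Qed.

Lemma J_contrB h x y : 0 <= h -> nrm (J h x - J h y) <= nrm (x - y).
Proof. by move=> h0; rewrite -J_sub//; exact: J_contr. Qed.

Lemma J_L h x z : 0 <= h -> L x z -> L (J h x) (J h z).
Proof.
rewrite le_eqVlt => /predU1P[<-|h0]; first by rewrite !J0.
move=> xz; have [w [bw ew]] := J_spec x h0.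
have wE : w = h^-1 *: (J h x - x).
  by rewrite -[in X in _ - X]ew opprB addrC subrK scalerA mulVf ?gt_eqF// scale1r.
have Lw : L w (h^-1 *: (w - z)) by rewrite {1}wE; exact: L_scale (L_sub bw xz).
suff <- : w = J h z by [].
apply: (J_unique h0 Lw).
by rewrite scalerA mulfV ?gt_eqF// scale1r opprB addrC subrK.
Qed.

Lemma J_step h x z : 0 <= h -> L x z -> J h x - h *: J h z = x.
Proof.
rewrite le_eqVlt => /predU1P[<-|h0]; first by rewrite !J0 scale0r subr0.
move=> xz; have [w [bw ew]] := J_spec x h0.
by rewrite (L_fun (J_L (ltW h0) xz) bw).
Qed.

Lemma J_comm h k x : 0 <= h -> 0 <= k -> J h (J k x) = J k (J h x).
Proof.
move=> h0; rewrite le_eqVlt => /predU1P[<-|k0]; first by rewrite !J0.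
have [z [xz ex]] := J_spec x k0.
apply: (J_unique k0 (J_L h0 xz)).
by rewrite -J_scale// -J_sub// ex.
Qed.

(** (1 - h L)(1 - k L) = 1 - (h + k) L + h k L^2, read through the resolvents. *)
Lemma J_add h k x z w : 0 <= h -> 0 <= k -> L x z -> L z w ->
  nrm (J (h + k) x - J h (J k x)) <= h * k * nrm w.
Proof.
move=> h0 k0 xz zw; have [hk0|hk0] := leP (h + k) 0.
  have {}h0 : h = 0 by lra.
  have {}k0 : k = 0 by lra.
  by rewrite h0 k0 addr0 !J0 subrr nrm0 !mul0r.
have zJ : L (J h (J k x)) (J h (J k z)) by do 2!apply: J_L => //.
have E : J h (J k x) - (h + k) *: J h (J k z) = x - (h * k) *: J h (J k w).
  have e1 := J_step h0 (J_L k0 xz); have e2 := J_step h0 (J_L k0 zw).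
  have e3 := J_step k0 xz.
  apply: ip_ext => u.
  move: (congr1 (fun v => ip v u) e1) (congr1 (fun v => ip v u) e2).
  move: (congr1 (fun v => ip v u) e3); rewrite !(ipDl, ipNl, ipZl) => f3 f1 f2.
  have -> : ip x u = ip (J k x) u - k * ip (J k z) u by lra.
  by rewrite -f1 -f2; ring.
rewrite (J_unique hk0 zJ E) -J_sub ?(ltW hk0)//.
apply: le_trans (J_contr _ (ltW hk0)) _.
rewrite opprB addrCA subrr addr0 nrmZ ger0_norm ?mulr_ge0//.
rewrite ler_wpM2l ?mulr_ge0//.
by apply: le_trans (J_contr _ h0) (J_contr _ k0).
Qed.

(** Telescoping: P^n - Q^n is the sum of the n terms P^j (P - Q) Q^(n-1-j). *)
Lemma iter_diff (P Q : V -> V) n x :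
  (forall a b, P (a - b) = P a - P b) -> (forall a, nrm (P a) <= nrm a) ->
  (forall a b, Q (a - b) = Q a - Q b) -> (forall a, nrm (Q a) <= nrm a) ->
  (forall a, P (Q a) = Q (P a)) ->
  nrm (iter n P x - iter n Q x) <= n%:R * nrm (P x - Q x).
Proof.
move=> PB Pc QB Qc PQ; elim: n => [|n IH]; first by rewrite subrr nrm0 mul0r.
have PnQ a : iter n P (Q a) = Q (iter n P a).
  by elim: (n) => //= m ->; rewrite PQ.
have PnB a b : iter n P (a - b) = iter n P a - iter n P b.
  by elim: (n) => //= m ->; rewrite PB.
have Pnc a : nrm (iter n P a) <= nrm a.
  by elim: (n) => //= m; apply: le_trans (Pc _).
rewrite iterSr iterS; apply: le_trans (nrmB _ (iter n P (Q x)) _) _.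
rewrite PnQ -QB -PnQ -PnB -natr1 mulrDl mul1r addrC lerD//.
exact: le_trans (Qc _) IH.
Qed.

(** 2^k steps of the implicit Euler scheme on [0, t]. *)
Let pw t k x := iter (2 ^ k) (J (t / (2 ^ k)%:R)) x.

Let two_pow_gt0 k : (0 : R) < (2 ^ k)%:R.
Proof. by rewrite ltr0n expn_gt0. Qed.

Let tk0 (t : R) k : 0 <= t -> 0 <= t / (2 ^ k)%:R.
Proof. by move=> t0; rewrite divr_ge0// ltW. Qed.

Let iter_contrB t n x y : 0 <= t ->
  nrm (iter n (J t) x - iter n (J t) y) <= nrm (x - y).
Proof.
move=> t0; elim: n => //= n; apply: le_trans; exact: J_contrB.
Qed.

Let pw_contrB t k x y : 0 <= t -> nrm (pw t k x - pw t k y) <= nrm (x - y).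
Proof. by move=> t0; apply: iter_contrB; exact: tk0. Qed.

Let pw_linear t k a x y : 0 <= t -> pw t k (a *: x + y) = a *: pw t k x + pw t k y.
Proof.
move=> /(tk0 k); rewrite /pw; move: (t / _) => h h0.
by elim: (2 ^ k)%N => //= n ->; exact: J_linear.
Qed.

(** Summing the errors of successive halvings of the step of the implicit
    Euler scheme. *)
Let pw_step t k j x z w : 0 <= t -> L x z -> L z w ->
  nrm (pw t (k + j) x - pw t k x) <=
  t ^+ 2 * nrm w / 2 / (2 ^ k)%:R * (1 - (2 ^ j)%:R^-1).
Proof.
move=> t0 xz zw; elim: j => [|j IH].
  by rewrite addn0 subrr nrm0 expn0 invr1 subrr mulr0.
apply: le_trans (nrmB _ (pw t (k + j) x) _) _.
rewrite addnS; move: IH; set i := (k + j)%N => IH.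
set h := t / (2 ^ i.+1)%:R; have h0 : 0 <= h by exact: tk0.
have hi : t / (2 ^ i)%:R = h + h.
  by rewrite /h expnS natrM; field; rewrite gt_eqF ?two_pow_gt0.
have -> : pw t i.+1 x = iter (2 ^ i) (J h \o J h) x.
  rewrite /pw -/h; clearbody h; rewrite expnS; elim: (2 ^ i)%N => // n IHn.
  by rewrite mulnS /= -IHn.
have : nrm (iter (2 ^ i) (J h \o J h) x - pw t i x) <= (2 ^ i)%:R * (h * h * nrm w).
  rewrite nrmBC /pw hi; apply: le_trans (iter_diff _ _ _ _ _ _ _) _ => /=.
  - by move=> a b; rewrite J_sub// addr_ge0.
  - by move=> a; rewrite J_contr// addr_ge0.
  - by move=> a b; rewrite !J_sub.
  - by move=> a; apply: le_trans (J_contr _ h0) (J_contr _ h0).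
  - by move=> a; rewrite J_comm ?addr_ge0//; congr J; rewrite J_comm// addr_ge0.
  - by rewrite ler_wpM2l//; exact: J_add xz zw.
have -> : (2 ^ i)%:R * (h * h * nrm w) =
   t ^+ 2 * nrm w / 2 / (2 ^ k)%:R * ((2 ^ j)%:R^-1 - (2 ^ j.+1)%:R^-1).
  rewrite /h /i !expnS expnD !natrM; field.
  by rewrite !gt_eqF ?two_pow_gt0.
by lra.
Qed.

Let dom2 : set V := [set x | exists z w, L x z /\ L z w].

Let pw_step_le t k j x z w : 0 <= t -> L x z -> L z w ->
  nrm (pw t (k + j) x - pw t k x) <= t ^+ 2 * nrm w / 2 / (2 ^ k)%:R.
Proof.
move=> t0 xz zw; apply: le_trans (pw_step k j t0 xz zw) _.
rewrite ler_piMr ?gerBl ?invr_ge0 ?ler0n//.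
by rewrite !mulr_ge0 ?invr_ge0 ?sqr_ge0 ?nrm_ge0 ?ler0n.
Qed.

(** On the domain J h x - x = h J h (L x), which is O(h); the domain is dense
    and the resolvents are contractions. *)
Lemma J_cvg z e : 0 < e ->
  exists2 d, 0 < d & forall h, 0 <= h < d -> nrm (J h z - z) <= e.
Proof.
move=> e0; have e3 : 0 < e / 3 by rewrite divr_gt0.
have [x [w xw] zx] := dom_dense z e3.
have w1 : 0 < nrm w + 1 by rewrite ltr_wpDl ?nrm_ge0.
exists (e / 3 / (nrm w + 1)) => [|h /andP[h0]]; first by rewrite divr_gt0.
rewrite ltr_pdivlMr// => hw.
rewrite (_ : _ - _ = (J h z - J h x) + (J h x - x) + (x - z) + 0); last by by_ip.
apply: le_trans (nrmD4 _ _ _ _) _; rewrite nrm0 (nrmBC x).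
have h1 := J_contrB z x h0.
have h2 : nrm (J h x - x) <= h * nrm w.
  rewrite (_ : J h x - x = h *: J h w).
    by rewrite nrmZ ger0_norm// ler_wpM2l// J_contr.
  by rewrite -[in X in _ - X](J_step h0 xw) opprB addrC subrK.
by have := nrm_ge0 w; lra.
Qed.

(** The resolvents map the domain of L into that of L^2, and tend strongly to
    the identity. *)
Lemma dom2_dense x e : 0 < e -> exists2 x', dom2 x' & nrm (x - x') <= e.
Proof.
move=> e0; have e2 : 0 < e / 2 by rewrite divr_gt0.
have [x' [z xz] xx] := dom_dense x e2.
have [d d0 hd] := J_cvg x' e2; have /andP[h0 hd'] := half_between d0.
have := hd (d / 2); rewrite (ltW h0) hd' => /(_ isT) Jx.
have [w [zw _]] := J_spec z h0.
exists (J (d / 2) x').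
  by exists (J (d / 2) z), w; split=> //; exact: J_L (ltW h0) xz.
by apply: le_trans (nrmB _ x' _) _; rewrite (nrmBC x'); lra.
Qed.

Lemma pw_cvg t x : 0 <= t -> exists y, hcvg (pw t ^~ x) y.
Proof.
move=> t0; apply: Vc => e e0; have e3 : 0 < e / 6 by rewrite divr_gt0.
have [x' [z [w [xz zw]]] xx] := dom2_dense x e3.
have [N hN] := half_pow_small (t ^+ 2 * nrm w / 2) e3.
have key k : (N <= k)%N -> nrm (pw t k x - pw t N x) <= e / 2.
  move=> Nk.
  rewrite (_ : _ - _ = (pw t k x - pw t k x') + (pw t k x' - pw t N x') +
     (pw t N x' - pw t N x) + 0); last by by_ip.
  apply: le_trans (nrmD4 _ _ _ _) _; rewrite nrm0 (nrmBC (pw t N x')).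
  have h1 := pw_contrB k x x' t0; have h2 := pw_contrB N x x' t0.
  have := pw_step_le N (k - N) t0 xz zw; rewrite subnKC// => h3.
  by have := hN N (leqnn N); lra.
exists N => k l /key h1 /key h2; apply: le_trans (nrmB _ (pw t N x) _) _.
by rewrite (nrmBC _ (pw t l x)); lra.
Qed.

Lemma generated_exists : exists T : R -> V -> V,
  forall t x, 0 <= t -> hcvg (pw t ^~ x) (T t x).
Proof.
have h (tx : R * V) : exists y, 0 <= tx.1 -> hcvg (pw tx.1 ^~ tx.2) y.
  have [t0|t0] := leP 0 tx.1; last by exists 0.
  have [y hy] := pw_cvg tx.2 t0; exists y => _; exact: hy.
have [T TP] := choice h; exists (fun t x => T (t, x)) => t x; exact: (TP (t, x)).
Qed.

Variable T : R -> V -> V.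
Hypothesis T_cvg : forall t x, 0 <= t -> hcvg (pw t ^~ x) (T t x).

Lemma T_linear t a x y : 0 <= t -> T t (a *: x + y) = a *: T t x + T t y.
Proof.
move=> t0; apply: hcvg_unique (T_cvg _ t0) _.
under [X in hcvg X]funext do rewrite pw_linear//.
exact: hcvg_linear (T_cvg _ t0) (T_cvg _ t0).
Qed.

Let T_contrB t x y : 0 <= t -> nrm (T t x - T t y) <= nrm (x - y).
Proof.
move=> t0; have := hcvg_linear (-1) (T_cvg y t0) (T_cvg x t0).
rewrite scaleN1r addrC => h; rewrite -[T t x - T t y]subr0.
apply: (hcvg_le 0%N h) => k _; by rewrite subr0 scaleN1r addrC; exact: pw_contrB.
Qed.

Lemma T0 x : T 0 x = x.
Proof.
apply: hcvg_unique (T_cvg x (lexx 0)) _.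
have -> : pw 0 ^~ x = fun=> x; last exact: hcvg_cst.
apply/funext => k; rewrite /pw mul0r.
by elim: (2 ^ k)%N => //= n ->; rewrite J0.
Qed.

Lemma T_J t x z w : 0 <= t -> L x z -> L z w ->
  nrm (T t x - J t x) <= t ^+ 2 * nrm w / 2.
Proof.
move=> t0 xz zw; apply: (hcvg_le 0%N (T_cvg x t0)) => k _.
by have := pw_step_le 0 k t0 xz zw; rewrite add0n {2}/pw expn0 !divr1.
Qed.

(** The approximations satisfy the semigroup law up to the commutation error
    of [J_add], which after 2^k steps is of order 2^-k. *)
Lemma T_semigroup s t x : 0 <= s -> 0 <= t -> T (s + t) x = T s (T t x).
Proof.
move=> s0 t0; have st0 : 0 <= s + t by rewrite addr_ge0.
have key y : dom2 y -> T (s + t) y = T s (T t y).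
  move=> [z [w [yz zw]]]; apply: hcvg_unique (T_cvg _ st0) _.
  apply: hcvg_squeeze (T_cvg (T t y) s0) => e e0.
  have e2 : 0 < e / 2 by rewrite divr_gt0.
  have [N1 h1] := T_cvg y t0 e2.
  have [N2 h2] := half_pow_small (s * t * nrm w) e2.
  exists (maxn N1 N2) => k; rewrite geq_max => /andP[/h1 {}h1 /h2 {}h2].
  apply: le_trans (nrmB _ (pw s k (pw t k y)) _) _.
  have h3 := pw_contrB k (T t y) (pw t k y) s0; rewrite (nrmBC (T t y)) in h3.
  suff : nrm (pw s k (pw t k y) - pw (s + t) k y) <= s * t * nrm w / (2 ^ k)%:R.
    by lra.
  rewrite nrmBC /pw mulrDl; set a := s / _; set b := t / _.
  have a0 : 0 <= a by exact: tk0.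
  have b0 : 0 <= b by exact: tk0.
  have -> : iter (2 ^ k) (J a) (iter (2 ^ k) (J b) y) = iter (2 ^ k) (J a \o J b) y.
    clearbody a b; elim: (2 ^ k)%N => //= n <-; congr J.
    by move: (iter n (J b) y) => v; elim: n => //= m ->; rewrite J_comm.
  apply: le_trans (iter_diff _ _ _ _ _ _ _) _ => /=.
  - by move=> u v; rewrite J_sub// addr_ge0.
  - by move=> u; rewrite J_contr// addr_ge0.
  - by move=> u v; rewrite !J_sub.
  - by move=> u; apply: le_trans (J_contr _ a0) (J_contr _ b0).
  - by move=> u; rewrite J_comm ?addr_ge0//; congr J; rewrite J_comm// addr_ge0.
  - apply: (@le_trans _ _ ((2 ^ k)%:R * (a * b * nrm w))).
      by rewrite ler_wpM2l//; exact: J_add yz zw.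
    rewrite le_eqVlt; apply/orP; left; apply/eqP; rewrite /a /b.
    by field; rewrite gt_eqF ?two_pow_gt0.
apply: eq_small => e e0; have e2 : 0 < e / 2 by rewrite divr_gt0.
have [x' /key xk xx] := dom2_dense x e2.
apply: le_trans (nrmB _ (T (s + t) x') _) _; rewrite [in X in _ + X]xk.
have h1 := T_contrB x x' st0.
have h2 := le_trans (T_contrB (T t x') (T t x) s0) (T_contrB x' x t0).
by rewrite (nrmBC x') in h2; lra.
Qed.

Lemma T_cont x e : 0 < e ->
  exists2 d, 0 < d & forall h, 0 <= h < d -> nrm (T h x - x) <= e.
Proof.
move=> e0; have e4 : 0 < e / 4 by rewrite divr_gt0.
have [x' [z [w [xz zw]]] xx] := dom2_dense x e4.
have [d d0 hd] := J_cvg x' e4.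
have w1 : 0 < nrm w + 1 by rewrite ltr_wpDl ?nrm_ge0.
pose d' := Num.min 1 (e / 4 / (nrm w + 1)).
exists (Num.min d d') => [|h /andP[h0]]; first by rewrite !lt_min d0 ltr01 divr_gt0.
rewrite !lt_min ltr_pdivlMr// => /and3P[hd1 h1 hw].
rewrite (_ : _ - _ = (T h x - T h x') + (T h x' - J h x') + (J h x' - x') + (x' - x)); last by by_ip.
apply: le_trans (nrmD4 _ _ _ _) _; rewrite (nrmBC x').
have k1 := T_contrB x x' h0; have k2 := T_J h0 xz zw.
have := hd h; rewrite h0 hd1 => /(_ isT) k3.
suff : h ^+ 2 * nrm w / 2 <= e / 4 by lra.
have k4 : h * nrm w <= e / 4 by lra.
have k5 : h * (h * nrm w) <= h * nrm w.
  by rewrite ler_piMl// ?mulr_ge0 ?nrm_ge0// ltW.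
have k6 : 0 <= h * (h * nrm w) by rewrite !mulr_ge0 ?nrm_ge0.
by rewrite expr2; lra.
Qed.

Lemma T_csemigroup : csemigroup T.
Proof.
split.
- by move=> t a x y; exact: T_linear.
- exact: T0.
- by move=> s t x; exact: T_semigroup.
- move=> t x t0; have := T_contrB x 0 t0.
  have -> : T t 0 = 0.
    by have := T_linear (-1) 0 0 t0; rewrite scaler0 addr0 scaleN1r addNr.
  by rewrite !subr0.
- exact: T_cont.
Qed.

(** On the domain of L^2 the error T h x - J h x is O(h^2), which identifies
    the derivative; the closed generator of T then extends L, and a dissipative
    extension of L is L itself because 1 - L is onto. *)
Lemma T_gen x z : gen T x z <-> L x z.
Proof.
have key u v w : L u v -> L v w -> gen T u v.
  move=> uv vw e e0; have w1 : 0 < 2 * nrm w + 1 by have := nrm_ge0 w; lra.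
  exists (e / (2 * nrm w + 1)) => [|h /andP[h0]]; first exact: divr_gt0.
  rewrite ltr_pdivlMr// => hw; have h0' := ltW h0.
  have k1 := T_J h0' uv vw.
  have e1 : T h u - u - h *: v = (T h u - J h u) + h *: (h *: J h w).
    have j1 := J_step h0' uv; have j2 := J_step h0' vw.
    apply: ip_ext => q; move: (congr1 (fun y => ip y q) j1) (congr1 (fun y => ip y q) j2).
    by rewrite !(ipDl, ipNl, ipZl) => <- <-; ring.
  rewrite e1; apply: le_trans (nrmD _ _) _; rewrite !nrmZ gtr0_norm//.
  have k2 : h * (h * nrm (J h w)) <= h * (h * nrm w).
    by rewrite !ler_pM2l// J_contr.
  have k3 : h * (h * (2 * nrm w + 1)) <= h * e by rewrite ler_pM2l// ltW.
  have k4 : 0 <= h * (h * nrm w) by rewrite !mulr_ge0 ?nrm_ge0.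
  have k5 : 0 <= h * h by rewrite mulr_ge0.
  by rewrite expr2 in k1; lra.
have LT u v : L u v -> gen T u v.
  move=> uv; apply: (gen_closed T_csemigroup) => e e0.
  have [d1 d10 h1] := J_cvg u e0; have [d2 d20 h2] := J_cvg v e0.
  pose d := Num.min d1 d2; have d0 : 0 < d by rewrite lt_min d10.
  have /andP[h0 hd'] := half_between d0; set h := d / 2 in h0 hd'.
  move: hd'; rewrite lt_min => /andP[hd1 hd2].
  exists (J h u), (J h v).
  have := h1 h; rewrite (ltW h0) hd1 => /(_ isT) k1.
  have := h2 h; rewrite (ltW h0) hd2 => /(_ isT) k2.
  rewrite (nrmBC u) (nrmBC v); split=> //.
  have [w [vw _]] := J_spec v h0.
  exact: key (J_L (ltW h0) uv) vw.
split=> [xz|]; last exact: LT.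
have [x' [z' [xz' e]]] := L_range (x - z) ltr01; rewrite scale1r in e.
have := gen_linear T_csemigroup (-1) (LT _ _ xz') xz; rewrite !scaleN1r.
have -> : - z' + z = - x' + x.
  apply: ip_ext => u; move: (congr1 (fun v => ip v u) e).
  by rewrite !(ipDl, ipNl); lra.
move=> /(gen_dissip T_csemigroup) d.
have /eqP : - x' + x = 0.
  by apply/ip_eq0/eqP; rewrite eq_le d ip_ge0.
rewrite addrC subr_eq0 => /eqP xx; move: e; rewrite -xx => /addrI/oppr_inj zz.
by rewrite -zz xx.
Qed.

(** An operator that preserves the graph of L commutes with its resolvents.
    This is what makes the semigroup of a complex linear operator complex
    linear: I is multiplication by the imaginary unit. *)
Lemma T_commute (I : V -> V) : (forall a x y, I (a *: x + y) = a *: I x + I y) ->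
  (forall x, nrm (I x) <= nrm x) -> (forall x z, L x z -> L (I x) (I z)) ->
  forall t x, 0 <= t -> T t (I x) = I (T t x).
Proof.
move=> Ilin Ic IL t x t0.
have IB u v : I (u - v) = I u - I v by rewrite addrC -scaleN1r Ilin scaleN1r addrC.
have I0 : I 0 = 0 by have := IB 0 0; rewrite !subrr.
have IZ a u : I (a *: u) = a *: I u by rewrite -[_ *: u]addr0 Ilin I0 addr0.
have JI h u : 0 <= h -> J h (I u) = I (J h u).
  rewrite le_eqVlt => /predU1P[<-|h0]; first by rewrite !J0.
  have [v [uv e]] := J_spec u h0.
  by apply/esym/(J_unique h0 (IL _ _ uv)); rewrite -IZ -IB e.
apply: hcvg_unique (T_cvg _ t0) _.
have -> : pw t ^~ (I x) = fun k => I (pw t k x).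
  apply/funext => k; rewrite /pw; move: (t / _) (tk0 k t0) => h h0.
  by elim: (2 ^ k)%N => //= n ->; rewrite JI.
by apply: hcvg_contr (T_cvg x t0) => u v; rewrite -IB.
Qed.

End Generation.

(** The operator is given by its graph L.  The semigroup is the limit of the
    implicit Euler scheme T t x = lim_k (1 - (t / 2^k) L)^(-2^k) x. *)
Theorem lumer_phillips (R : realType) (V : ipspace R) (L : V -> V -> Prop) :
  hcomplete V ->
  (forall a x z y w, L x z -> L y w -> L (a *: x + y) (a *: z + w)) ->
  (forall x z w, L x z -> L x w -> z = w) ->
  (forall x z, L x z -> ip z x <= 0) ->
  (forall h y, 0 < h -> exists x z, L x z /\ x - h *: z = y) ->
  exists T : R -> V -> V, [/\ csemigroup T, forall x z, gen T x z <-> L x z &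
    forall I : V -> V, (forall a x y, I (a *: x + y) = a *: I x + I y) ->
      (forall x, nrm (I x) <= nrm x) -> (forall x z, L x z -> L (I x) (I z)) ->
      forall t x, 0 <= t -> T t (I x) = I (T t x)].
Proof.
move=> Vc Ll Lf Ld Lr; have [J [J1 J0]] := resolvent_exists Lr.
have [T TP] := generated_exists Vc Ll Lf Ld Lr J1 J0; exists T; split.
- exact: (T_csemigroup Vc Ll Lf Ld Lr J1 J0 TP).
- exact: (T_gen Vc Ll Lf Ld Lr J1 J0 TP).
- exact: (T_commute Ll Ld J1 J0 TP).
Qed.

(** * An abstract wave equation with memory *)

Section Product.
Context {R : realType} (H1 H2 H3 : ipspace R).

Definition ip3 (x y : (H1 * H2 * H3)%type) : R :=
  ip x.1.1 y.1.1 + ip x.1.2 y.1.2 + ip x.2 y.2.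

Let ip3_linear a x y z : ip3 (a *: x + y) z = a * ip3 x z + ip3 y z.
Proof. by rewrite /ip3 !ip_linear; ring. Qed.

Let ip3C x y : ip3 x y = ip3 y x.
Proof. by rewrite /ip3 !(ipC _ y.1.1) !(ipC _ y.1.2) !(ipC _ y.2). Qed.

Let ip3_gt0 x : x != 0 -> 0 < ip3 x x.
Proof.
move=> x0; rewrite lt_def /ip3 !addr_ge0 ?ip_ge0// andbT.
apply: contra_neq x0; have := ip_ge0 x.1.1; have := ip_ge0 x.1.2.
have := ip_ge0 x.2 => h3 h2 h1 h.
have e1 : x.1.1 = 0 by apply: ip_eq0; lra.
have e2 : x.1.2 = 0 by apply: ip_eq0; lra.
have e3 : x.2 = 0 by apply: ip_eq0; lra.
by case: x e1 e2 e3 {h h1 h2 h3} => -[x1 x2] x3 /= -> -> ->.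
Qed.

Definition prod3 := IPSpace ip3_linear ip3C ip3_gt0.

Lemma sqr_nrm3 (x : prod3) :
  nrm x ^+ 2 = nrm x.1.1 ^+ 2 + nrm x.1.2 ^+ 2 + nrm x.2 ^+ 2.
Proof. by rewrite !sqr_nrm. Qed.

Lemma nrm3_le (x : prod3) : nrm x <= nrm x.1.1 + nrm x.1.2 + nrm x.2.
Proof.
have [[a0 b0] c0] := (nrm_ge0 x.1.1, nrm_ge0 x.1.2, nrm_ge0 x.2).
have s0 : 0 <= nrm x.1.1 + nrm x.1.2 + nrm x.2 by rewrite !addr_ge0.
rewrite -(@ler_pXn2r _ 2) ?nnegrE ?nrm_ge0// sqr_nrm3.
have := mulr_ge0 a0 b0; have := mulr_ge0 a0 c0; have := mulr_ge0 b0 c0.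
rewrite !expr2; lra.
Qed.

Lemma nrm3_ge (x : prod3) :
  [/\ nrm x.1.1 <= nrm x, nrm x.1.2 <= nrm x & nrm x.2 <= nrm x].
Proof.
have := sqr_nrm3 x.
have [[a0 b0] c0] := (sqr_ge0 (nrm x.1.1), sqr_ge0 (nrm x.1.2), sqr_ge0 (nrm x.2)).
by move=> h; split; rewrite -(@ler_pXn2r _ 2) ?nnegrE ?nrm_ge0// h; lra.
Qed.

Lemma prod3_complete : hcomplete H1 -> hcomplete H2 -> hcomplete H3 ->
  hcomplete prod3.
Proof.
move=> c1 c2 c3 u uc.
have [|x1 x1P] := c1 (fun k => (u k).1.1).
  move=> e /uc[N h]; exists N => k l Nk Nl.
  by apply: le_trans (h k l Nk Nl); have [] := nrm3_ge (u k - u l).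
have [|x2 x2P] := c2 (fun k => (u k).1.2).
  move=> e /uc[N h]; exists N => k l Nk Nl.
  by apply: le_trans (h k l Nk Nl); have [] := nrm3_ge (u k - u l).
have [|x3 x3P] := c3 (fun k => (u k).2).
  move=> e /uc[N h]; exists N => k l Nk Nl.
  by apply: le_trans (h k l Nk Nl); have [] := nrm3_ge (u k - u l).
exists (x1, x2, x3) => e e0; have e3 : 0 < e / 3 by rewrite divr_gt0.
have [N1 h1] := x1P _ e3; have [N2 h2] := x2P _ e3; have [N3 h3] := x3P _ e3.
exists (maxn N1 (maxn N2 N3)) => k; rewrite !geq_max => /and3P[k1 k2 k3].
apply: le_trans (nrm3_le _) _ => /=.
by have := h1 k k1; have := h2 k k2; have := h3 k k3; lra.
Qed.

End Product.

(** An abstract wave equation with memory.  In the application H1, H2, H3 are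
    H_D, L^2, M, the map i is the inclusion of H_D into L^2, and S is the shift
    semigroup; the second component of [wave] is the weak form of
    g = Delta u + Q eta, with Q = - J^*. *)
Section Wave.
Context {R : realType} (H1 H2 H3 : ipspace R).
Hypotheses (c1 : hcomplete H1) (c2 : hcomplete H2) (c3 : hcomplete H3).
Variables (i : H1 -> H2) (J : H1 -> H3) (Ci CJ : R).
Hypothesis i_linear : forall a x y, i (a *: x + y) = a *: i x + i y.
Hypothesis i_bounded : forall x, nrm (i x) <= Ci * nrm x.
Hypothesis i_inj : forall x, i x = 0 -> x = 0.
Hypothesis i_dense : forall g, (forall x, ip g (i x) = 0) -> g = 0.
Hypothesis J_linear : forall a x y, J (a *: x + y) = a *: J x + J y.
Hypothesis J_bounded : forall x, nrm (J x) <= CJ * nrm x.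
Variable S : R -> H3 -> H3.
Hypothesis SP : csemigroup S.
Hypothesis genD : forall x e, 0 < e -> exists x' z, gen S x' z /\ nrm (x - x') <= e.

Definition wave (x y : prod3 H1 H2 H3) : Prop :=
  [/\ i y.1.1 = x.1.2,
      forall f, ip y.1.2 (i f) = - ip x.1.1 f - ip x.2 (J f) &
      gen S x.2 (y.2 - J y.1.1)].

Lemma wave_linear a x z y w : wave x z -> wave y w ->
  wave (a *: x + y) (a *: z + w).
Proof.
move=> [x1 x2 x3] [y1 y2 y3]; split => /=.
- by rewrite i_linear x1 y1.
- by move=> f; rewrite !ip_linear x2 y2; ring.
- have := gen_linear SP a x3 y3; congr (gen _ _ _).
  by rewrite J_linear; by_ip.
Qed.

Lemma wave_fun x z w : wave x z -> wave x w -> z = w.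
Proof.
move=> [x1 x2 x3] [y1 y2 y3].
have e1 : z.1.1 = w.1.1.
  apply/eqP; rewrite -subr_eq0; apply/eqP/i_inj.
  by rewrite addrC -scaleN1r i_linear x1 y1 scaleN1r addNr.
have e2 : z.1.2 = w.1.2.
  apply/eqP; rewrite -subr_eq0; apply/eqP/i_dense => f.
  by rewrite ipBl x2 y2 subrr.
have e3 : z.2 = w.2.
  by have := gen_unique x3 y3; rewrite e1 => /addIr.
by move: z w e1 e2 e3 {x1 x2 x3 y1 y2 y3} => [[? ?] ?] [[? ?] ?] /= -> -> ->.
Qed.

(** The terms (v, u) and (Delta u, v) cancel, and so do (Q eta, v) and
    (J v, eta) because Q = - J^*; only (A eta, eta) is left. *)
Lemma wave_dissip x z : wave x z -> ip z x <= 0.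
Proof.
move=> [x1 x2 x3]; have := gen_dissip SP x3.
have -> : ip z x = ip z.1.1 x.1.1 + ip z.1.2 x.1.2 + ip z.2 x.2 by [].
by rewrite -x1 x2 ipBl (ipC z.1.1) (ipC x.2 (J _)); lra.
Qed.

(** Eliminating u and eta leaves the variational equation
    l (i w, i f) + h (w, f) + (R J w, J f) = l (g, i f) - (u0, f) - (l R eta0, J f)
    for the velocity w, where R is the resolvent of the generator of S at
    l = 1 / h; it is coercive because R is accretive. *)
Lemma wave_range h y : 0 < h -> exists x z, wave x z /\ x - h *: z = y.
Proof.
move=> h0; pose l := h^-1; have l0 : 0 < l by rewrite invr_gt0.
have hl : h * l = 1 by rewrite mulfV// gt_eqF.
have [Rs RsP] := choice (fun q : H3 => gen_range SP c3 genD q l0).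
have R_un q x z : gen S x z -> l *: x - z = q -> Rs q = x.
  move=> xz e; have [w [gw ew]] := RsP q.
  have := gen_linear SP (-1) xz gw; rewrite !scaleN1r => /(gen_dissip SP).
  have -> : - z + w = l *: (- x + Rs q).
    apply: ip_ext => v; move: (congr1 (fun u => ip u v) e) (congr1 (fun u => ip u v) ew).
    by rewrite !(ipDl, ipNl, ipZl); lra.
  rewrite ipZl pmulr_rle0// => d.
  have /eqP : - x + Rs q = 0 by apply/ip_eq0/eqP; rewrite eq_le d ip_ge0.
  by rewrite addrC subr_eq0 => /eqP.
have R_lin a q q' : Rs (a *: q + q') = a *: Rs q + Rs q'.
  have [z [gz ez]] := RsP q; have [w [gw ew]] := RsP q'.
  apply: (R_un _ _ _ (gen_linear SP a gz gw)).
  by rewrite -[in RHS]ez -[in RHS]ew; by_ip.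
have R_acc q : l * nrm (Rs q) ^+ 2 <= ip (Rs q) q.
  have [z [gz ez]] := RsP q.
  have := gen_dissip SP gz; rewrite -[X in _ <= ip _ X]ez ipBr ipZr sqr_nrm.
  by rewrite (ipC z); lra.
have R_bd q : nrm (Rs q) <= h * nrm q.
  have [->|n0] := eqVneq (nrm (Rs q)) 0; first by rewrite mulr_ge0 ?nrm_ge0 ?ltW.
  have n1 : 0 < nrm (Rs q) by rewrite lt_def n0 nrm_ge0.
  rewrite -(ler_pM2l l0) [leRHS]mulrA (mulrC l h) hl mul1r.
  rewrite -(ler_pM2r n1) -mulrA -expr2; by apply: le_trans (R_acc q) _; rewrite mulrC; exact: ip_le.
pose a w f := l * ip (i w) (i f) + h * ip w f + ip (Rs (J w)) (J f).
pose F f := l * ip y.1.2 (i f) - ip y.1.1 f - ip (Rs (l *: y.2)) (J f).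
have [|||||w wP] := @lax_milgram R H1 c1 a (l * (Ci * Ci) + h + h * (CJ * CJ)) h F h0.
- move=> k u v w; rewrite /a i_linear J_linear R_lin !ip_linear; ring.
- move=> k u v w; rewrite /a i_linear J_linear !(ipC _ (_ + _)) !ip_linear.
  by rewrite !(ipC _ w) !(ipC _ (i w)) !(ipC _ (Rs _)); ring.
- move=> u v.
  have b1 : `|l * ip (i u) (i v)| <= l * (Ci * nrm u * (Ci * nrm v)).
    rewrite normrM gtr0_norm// ler_pM2l//; apply: le_trans (ip_norm_le _ _) _.
    by rewrite ler_pM ?nrm_ge0.
  have b2 : `|h * ip u v| <= h * (nrm u * nrm v).
    by rewrite normrM gtr0_norm// ler_pM2l//; exact: ip_norm_le.
  have b3 : `|ip (Rs (J u)) (J v)| <= h * (CJ * nrm u) * (CJ * nrm v).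
    apply: le_trans (ip_norm_le _ _) _; rewrite ler_pM ?nrm_ge0//.
    by apply: le_trans (R_bd _) _; rewrite ler_pM2l.
  apply: le_trans (ler_normD _ _) _; apply: le_trans (lerD (ler_normD _ _) (lexx _)) _.
  apply: le_trans (lerD (lerD b1 b2) b3) _.
  by rewrite le_eqVlt; apply/orP; left; apply/eqP; ring.
- move=> u; rewrite /a -!sqr_nrm.
  have r1 : 0 <= l * nrm (i u) ^+ 2 by rewrite mulr_ge0 ?sqr_ge0 ?ltW.
  have := R_acc (J u); have : 0 <= l * nrm (Rs (J u)) ^+ 2.
    by rewrite mulr_ge0 ?sqr_ge0 ?ltW.
  by lra.
- suff [q qF] : exists q, forall v, ip q v = F v by exists q.
  pose C := l * (nrm y.1.2 * Ci) + nrm y.1.1 + nrm (Rs (l *: y.2)) * CJ.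
  apply: (@riesz _ _ c1 F C).
    move=> k u v; rewrite /F i_linear J_linear !(ipC _ (_ + _)) !ip_linear.
    by rewrite !(ipC _ y.1.2) !(ipC _ y.1.1) !(ipC _ (Rs _)); ring.
  move=> v.
  have b1 : `|l * ip y.1.2 (i v)| <= l * (nrm y.1.2 * (Ci * nrm v)).
    rewrite normrM gtr0_norm// ler_pM2l//; apply: le_trans (ip_norm_le _ _) _.
    by rewrite ler_wpM2l ?nrm_ge0.
  have b2 : `|ip y.1.1 v| <= nrm y.1.1 * nrm v by exact: ip_norm_le.
  have b3 : `|ip (Rs (l *: y.2)) (J v)| <= nrm (Rs (l *: y.2)) * (CJ * nrm v).
    apply: le_trans (ip_norm_le _ _) _.
    by rewrite ler_wpM2l ?nrm_ge0.
  rewrite /F; apply: le_trans (ler_normB _ _) _.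
  apply: le_trans (lerD (ler_normB _ _) (lexx _)) _.
  apply: le_trans (lerD (lerD b1 b2) b3) _.
  by rewrite le_eqVlt; apply/orP; left; apply/eqP; rewrite /C; ring.
set eta := Rs (l *: y.2 + J w).
have [z [gz ez]] := RsP (l *: y.2 + J w); rewrite -/eta in gz ez.
exists (y.1.1 + h *: w, i w, eta), (w, l *: (i w - y.1.2), z + J w).
split.
  split => //=; last by rewrite addrK.
  move=> f; have := wP f; rewrite /a /F.
  rewrite /eta R_lin !(ipDl, ipZl, ipNl).
  have -> : Rs (l *: y.2) = l *: Rs y.2.
    have R0 : Rs 0 = 0 by have := R_lin (-1) 0 0; rewrite scaler0 addr0 scaleN1r addNr.
    by rewrite -[l *: y.2]addr0 R_lin R0 addr0.
  by rewrite ipZl; lra.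
clear wP gz; rewrite /eta {eta} in ez *; clear F; case: y ez => [[y1 y2] y3] /= ez.
set eta := Rs _ in ez *.
change ((y1 + h *: w - h *: w, i w - h *: (l *: (i w - y2)),
  eta - h *: (z + J w)) = (y1, y2, y3)); congr (_, _, _).
- by by_ip.
- by rewrite scalerA hl scale1r opprB addrC subrK.
- apply: ip_ext => v; move: (congr1 (fun u => ip u v) ez).
  rewrite !(ipDl, ipNl, ipZl) => e.
  have -> : ip z v + ip (J w) v = l * ip eta v - l * ip y3 v by lra.
  by rewrite mulrBr !mulrA hl; ring.
Qed.

Theorem wave_semigroup : exists T : R -> prod3 H1 H2 H3 -> prod3 H1 H2 H3,
  [/\ csemigroup T, forall x z, gen T x z <-> wave x z &
    forall I : prod3 H1 H2 H3 -> prod3 H1 H2 H3,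
      (forall a x y, I (a *: x + y) = a *: I x + I y) ->
      (forall x, nrm (I x) <= nrm x) -> (forall x z, wave x z -> wave (I x) (I z)) ->
      forall t x, 0 <= t -> T t (I x) = I (T t x)].
Proof.
apply: lumer_phillips wave_range => //.
- exact: prod3_complete.
- exact: wave_linear.
- exact: wave_fun.
- exact: wave_dissip.
Qed.

End Wave.

(** * Complex normed spaces and polarization *)

Section ComplexNorm.
Context {R : realType}.

(** The norm of a complex normed space takes complex values. *)
Definition cnorm (X : normedModType R[i]) (x : X) : R := complex.Re `|x|.
Arguments cnorm {X} x.

Section basics.
Context {X : normedModType R[i]}.
Implicit Types (x y z : X) (a : R) (c : R[i]).

Lemma cnormE x : `|x| = (cnorm x)%:C.
Proof. by rewrite /cnorm; apply/esym/RRe_real/ger0_real. Qed.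

Lemma cnorm_ge0 x : 0 <= cnorm x.
Proof. by rewrite -lecR -cnormE rmorph0. Qed.

Lemma cnormD x y : cnorm (x + y) <= cnorm x + cnorm y.
Proof. by rewrite -lecR rmorphD/= -!cnormE; exact: ler_normD. Qed.

Lemma cnormN x : cnorm (- x) = cnorm x.
Proof. by rewrite /cnorm normrN. Qed.

Lemma cnormBC x y : cnorm (x - y) = cnorm (y - x).
Proof. by rewrite -cnormN opprB. Qed.

Lemma cnorm0 : cnorm (0 : X) = 0.
Proof. by rewrite /cnorm normr0. Qed.

Lemma cnorm_eq0 x : cnorm x = 0 -> x = 0.
Proof. by move=> h; apply/normr0_eq0; rewrite cnormE h. Qed.

Lemma cnormZ c x : cnorm (c *: x) = complex.Re `|c| * cnorm x.
Proof.
rewrite {1}/cnorm normrZ cnormE.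
by rewrite -{1}(RRe_real (ger0_real (normr_ge0 c))) -rmorphM.
Qed.

Lemma cnormZr a x : cnorm (a%:C *: x) = `|a| * cnorm x.
Proof. by rewrite cnormZ normc_def /= expr0n addr0 sqrtr_sqr. Qed.

Lemma cnormZi x : cnorm ('i *: x) = cnorm x.
Proof. by rewrite cnormZ normc_def /= expr0n add0r expr1n sqrtr1 mul1r. Qed.

Lemma nbhs_cnorm x (A : set X) :
  nbhs x A <-> exists2 e : R, 0 < e & forall y, cnorm (y - x) < e -> A y.
Proof.
split=> [/nbhs_normP[e/= e0 h]|[e e0 h]].
  exists (complex.Re e); first by rewrite -ltcR RRe_real// gtr0_real.
  move=> y yx; apply: h => /=.
  rewrite /ball_/= distrC cnormE -(RRe_real (gtr0_real e0)) ltcR//.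
apply/nbhs_normP; exists e%:C; first by rewrite /= ltcR.
by move=> y /= yx; apply: h; rewrite -ltcR -cnormE distrC.
Qed.

Lemma cvg_cnorm {T : Type} (F : set_system T) {FF : Filter F} (f : T -> X) x :
  f @ F --> x <-> forall e : R, 0 < e -> \forall t \near F, cnorm (f t - x) < e.
Proof.
split=> [fx e e0|h].
  have /fx : nbhs x [set y | cnorm (y - x) < e] by apply/nbhs_cnorm; exists e.
  exact.
move=> A /nbhs_cnorm[e e0 eA]; near=> t; apply: eA; near: t.
exact: h.
Unshelve. all: by end_near. Qed.

End basics.

Lemma cnorm_complex (z : R[i]^o) : cnorm z = complex.Re `|(z : R[i])|.
Proof. by []. Qed.

Lemma cnorm_le_ReIm (z : R[i]^o) : cnorm z <= `|complex.Re z| + `|complex.Im z|.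
Proof.
rewrite cnorm_complex normc_def /=; set a := complex.Re z; set b := complex.Im z.
rewrite -(@ler_pXn2r _ 2) ?nnegrE ?addr_ge0 ?sqrtr_ge0// sqr_sqrtr; last first.
  by rewrite addr_ge0 ?sqr_ge0.
rewrite -(real_normK (num_real a)) -(real_normK (num_real b)).
by have := mulr_ge0 (normr_ge0 a) (normr_ge0 b); rewrite !expr2; lra.
Qed.

(** A complex vector space regarded as a real one. *)
Definition realify (X : normedModType R[i]) : Type := X.

HB.instance Definition _ (X : normedModType R[i]) := GRing.Zmodule.on (realify X).

Section realify_lmod.
Variable X : normedModType R[i].
Let scale (a : R) (x : realify X) : realify X := a%:C *: (x : X).
Let scaleA a b v : scale a (scale b v) = scale (a * b) v.
Proof. by rewrite /scale scalerA -rmorphM. Qed.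
Let scale1 : left_id 1 scale.
Proof. by move=> v; rewrite /scale scale1r. Qed.
Let scaleDr : right_distributive scale +%R.
Proof. by move=> a u v; rewrite /scale scalerDr. Qed.
Let scaleDl v : {morph scale^~ v : a b / a + b}.
Proof. by move=> a b; rewrite /scale rmorphD /= scalerDl. Qed.
HB.instance Definition _ := @GRing.Zmodule_isLmodule.Build R (realify X)
  scale scaleA scale1 scaleDr scaleDl.
End realify_lmod.

(** The polarization formula; it defines the real inner product of any space
    whose norm comes from a form. *)
Definition polar (X : normedModType R[i]) (x y : X) : R :=
  (cnorm (x + y) ^+ 2 - cnorm (x - y) ^+ 2) / 4.
Arguments polar {X} x y.

Definition polar_bilinear (X : normedModType R[i]) :=
  forall (a : R) (x y z : X), polar (a%:C *: x + y) z = a * polar x z + polar y z.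

Section hilbertify.
Variable X : normedModType R[i].
Hypothesis PX : polar_bilinear X.

Lemma polarxx (x : X) : polar x x = cnorm x ^+ 2.
Proof.
rewrite /polar subrr cnorm0 expr0n subr0 -mulr2n -scaler_nat.
rewrite (_ : 2%:R = (2 : R)%:C); last by rewrite rmorph_nat.
by rewrite cnormZr gtr0_norm// exprMn; field.
Qed.

Let polar_linear a (x y z : realify X) :
  @polar X (a *: x + y) z = a * @polar X x z + @polar X y z.
Proof. exact: PX. Qed.

Let polarC (x y : realify X) : @polar X x y = @polar X y x.
Proof. by rewrite /polar (addrC (x : X)) (cnormBC (x : X)). Qed.

Let polar_gt0 (x : realify X) : x != 0 -> 0 < @polar X x x.
Proof.
move=> x0; rewrite polarxx exprn_gt0// lt_def cnorm_ge0 andbT.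
by apply: contra_neq x0 => /cnorm_eq0.
Qed.

Definition hilbertify := IPSpace polar_linear polarC polar_gt0.

Lemma nrm_cnorm (x : hilbertify) : nrm x = @cnorm X x.
Proof. by rewrite /nrm /ip /= polarxx sqrtr_sqr ger0_norm// cnorm_ge0. Qed.

Lemma polar_i (x y : X) : polar ('i *: x) ('i *: y) = polar x y.
Proof. by rewrite /polar -scalerDr -scalerBr !cnormZi. Qed.

End hilbertify.

Lemma complete_hcomplete (X : completeNormedModType R[i]) (PX : polar_bilinear X) :
  hcomplete (hilbertify PX).
Proof.
move=> u uc.
have cu : cauchy (u @ \oo : set_system X).
  apply/cauchy_ballP => e e0; near_simpl.
  have e1 : 0 < complex.Re e by rewrite -ltcR RRe_real// gtr0_real.
  have [N h] := uc (complex.Re e / 2) (divr_gt0 e1 (ltr0n _ 2)).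
  exists ([set k | (N <= k)%N], [set k | (N <= k)%N]) => /=.
    by split; exists N.
  move=> [k l] [/= Nk Nl].
  rewrite -ball_normE /= -(RRe_real (gtr0_real e0)) cnormE ltcR.
  apply: le_lt_trans (_ : complex.Re e / 2 < _); last by lra.
  by have := h k l Nk Nl; rewrite nrm_cnorm.
have /cvg_ex[x ux] : cvg (u @ \oo : set_system X) by apply: cauchy_cvg.
exists x => e e0.
have /cvg_cnorm/(_ e e0)[N _ h] := ux.
by exists N => k /h /ltW; rewrite nrm_cnorm.
Unshelve. all: by end_near. Qed.

End ComplexNorm.
Arguments cnorm {R X} x.
Arguments polar {R X} x y.
Arguments complete_hcomplete {R X} PX [u].

(** * Completions of hermitian forms *)

Section PolarLimits.
Context {R : realType}.

Lemma cnorm_dist (X : normedModType R[i]) (x y : X) : `|cnorm x - cnorm y| <= cnorm (x - y).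
Proof.
rewrite ler_norml; apply/andP; split.
  have := cnormD (y - x) x; rewrite subrK (cnormBC y); lra.
by have := cnormD (x - y) y; rewrite subrK; lra.
Qed.

Lemma cvg_cnorm_comp (X : normedModType R[i]) {T : Type} (F : set_system T)
  {FF : Filter F} (f : T -> X) x : f @ F --> x -> cnorm (f t) @[t --> F] --> cnorm x.
Proof.
move=> /cvg_cnorm fx; apply/cvgrPdist_lt => e e0.
near=> t; rewrite distrC; apply: le_lt_trans (cnorm_dist _ _) _; near: t; exact: fx.
Unshelve. all: by end_near. Qed.

Lemma polar_cvg (X : normedModType R[i]) {T : Type} (F : set_system T)
  {FF : Filter F} (f g : T -> X) x y :
  f @ F --> x -> g @ F --> y -> polar (f t) (g t) @[t --> F] --> polar x y.
Proof.
move=> fx gy; rewrite /polar.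
have h1 : cnorm (f t + g t) @[t --> F] --> cnorm (x + y).
  by apply: cvg_cnorm_comp; exact: cvgD.
have h2 : cnorm (f t - g t) @[t --> F] --> cnorm (x - y).
  by apply: cvg_cnorm_comp; exact: cvgB.
by apply: cvgMr_tmp; apply: cvgB; exact: cvgM.
Qed.

Lemma complex_cvg {T : Type} (F : set_system T) {FF : Filter F} (f : T -> R[i]^o)
  (z : R[i]^o) :
  complex.Re (f t) @[t --> F] --> complex.Re z ->
  complex.Im (f t) @[t --> F] --> complex.Im z -> f @ F --> z.
Proof.
move=> /cvgrPdist_lt h1 /cvgrPdist_lt h2; apply/cvg_cnorm => e e0.
have e2 : 0 < e / 2 by rewrite divr_gt0.
near=> t; apply: le_lt_trans (cnorm_le_ReIm _) _.
rewrite !raddfB /= (splitr e) ltrD// distrC; near: t; [exact: h1|exact: h2].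
Unshelve. all: by end_near. Qed.

(** The complex inner product whose real part is the polarized one. *)
Definition hform (X : normedModType R[i]) (x y : X) : R[i]^o :=
  polar x y +i* polar x ('i *: y).
Arguments hform {X} x y.

Lemma hform_cvg (X : normedModType R[i]) {T : Type} (F : set_system T)
  {FF : Filter F} (f g : T -> X) x y :
  f @ F --> x -> g @ F --> y -> hform (f t) (g t) @[t --> F] --> hform x y.
Proof.
move=> fx gy; apply: complex_cvg => /=; apply: polar_cvg => //.
by apply/cvg_cnorm => e e0; move/cvg_cnorm: gy => /(_ e e0); apply: filterS => t;
  rewrite -scalerBr cnormZi.
Qed.

(** When f is the trace on D of a map that is continuous at x, the limit that
    defines [cont_ext] exists and is the value of this map. *)
Lemma cont_extE (T : Type) (X : topologicalType) (Y : normedModType R[i])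
    (D : set T) (j : T -> X) (f : T -> Y) (F : X -> Y) (x : X) :
  F @ x --> F x -> (forall t, D t -> f t = F (j t)) ->
  (forall U, nbhs x U -> exists2 t, D t & U (j t)) ->
  cont_ext D j f x = F x.
Proof.
move=> Fx fF jD; rewrite /cont_ext.
pose G : set_system Y :=
  [set A | exists2 U, nbhs x U & forall t, D t -> U (j t) -> A (f t)].
rewrite -[X in lim X]/G.
have GF : ProperFilter G.
  apply: Build_ProperFilter_ex.
    by move=> P [U /jD[t Dt Ut] h]; exists (f t); exact: h.
  split.
  - by exists setT => //; exact: filterT.
  - move=> P Q [U xU h] [U' xU' h']; exists (U `&` U'); first exact: filterI.
    by move=> t Dt [Ut U't]; split; [exact: h|exact: h'].
  - move=> P Q PQ [U xU h]; exists U => // t Dt Ut; exact/PQ/h.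
have GFx : G --> F x.
  by move=> A /Fx FA; exists (F @^-1` A) => // t Dt; rewrite /= fF.
have GlG : G --> lim G := cvgP _ GFx.
apply: (cvg_unique _ GlG GFx); exact: norm_hausdorff.
Qed.

End PolarLimits.
Arguments hform {R X} x y.

Section FormSpace.
Context {R : realType} {T : Type}.
Variables (D : set (T -> R[i])) (B : (T -> R[i]) -> (T -> R[i]) -> R[i]).

Record hermitian_form : Prop := HermitianForm {
  hf0 : D (fun=> 0) ;
  hfD : forall a u v, D u -> D v -> D (fun x => a * u x + v x) ;
  hf_linear : forall a u v w, D u -> D v -> D w ->
    B (fun x => a * u x + v x) w = a * B u w + B v w ;
  hf_sym : forall u v, D u -> D v -> B v u = (B u v)^* ;
  hf_ge0 : forall u, D u -> 0 <= complex.Re (B u u) }.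

Hypothesis BP : hermitian_form.
Variables (X : normedModType R[i]) (j : (T -> R[i]) -> X).
Hypothesis j_linear : forall a u v, D u -> D v ->
  j (fun x => a * u x + v x) = a *: j u + j v.
Hypothesis j_norm : forall u, D u -> `|j u| = (seminorm B u)%:C.
Hypothesis j_dense : dense (j @` D).

Lemma hf_linear_r a u v w : D u -> D v -> D w ->
  B w (fun x => a * u x + v x) = a^* * B w u + B w v.
Proof.
move=> Du Dv Dw; rewrite (hf_sym BP _ Dw); last exact: (hfD BP).
rewrite (hf_linear BP)// rmorphD rmorphM /=.
by rewrite -!(hf_sym BP).
Qed.

Lemma j0 : j (fun=> 0) = 0.
Proof.
have := j_linear (-1) (hf0 BP) (hf0 BP); rewrite scaleN1r addNr => e0.
by rewrite -[RHS]e0; congr j; apply/funext => x; rewrite mulr0 addr0.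
Qed.

Lemma cnorm_j u : D u -> cnorm (j u) ^+ 2 = complex.Re (B u u).
Proof. by move=> Du; rewrite /cnorm j_norm// sqr_sqrtr// (hf_ge0 BP). Qed.

Lemma polar_j u v : D u -> D v -> polar (j u) (j v) = complex.Re (B u v).
Proof.
move=> Du Dv; rewrite /polar.
have key (s : R[i]) : s^* = s -> s * s = 1 -> cnorm (s *: j u + j v) ^+ 2 =
    complex.Re (B u u) + complex.Re (B v v) + 2 * complex.Re (s * B u v).
  move=> s1 s2; rewrite -j_linear// cnorm_j; last exact: (hfD BP).
  have Ds := hfD BP s Du Dv.
  rewrite (hf_linear BP)// !hf_linear_r// (hf_sym BP Du Dv) s1.
  rewrite mulrDr mulrA s2 mul1r.
  have -> : s * (B u v)^* = (s * B u v)^* by rewrite rmorphM /= s1.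
  by move: (B u u) (s * B u v) (B v v) => [a b] [c d] [e f] /=; ring.
have h1 := key 1 (rmorph1 _) (mul1r 1); rewrite scale1r mul1r in h1.
have h2 := key (-1) _ _; rewrite rmorphN1 mulrNN mul1r in h2.
have {}h2 := h2 erefl erefl; rewrite scaleN1r in h2.
rewrite h1 cnormBC addrC [j v - j u]addrC h2.
by move: (B u u) (B u v) (B v v) => [a b] [c d] [e f] /=; field.
Qed.

Lemma hform_j u v : D u -> D v -> hform (j u) (j v) = B u v.
Proof.
move=> Du Dv; rewrite /hform polar_j//.
have -> : 'i *: j v = j (fun x => 'i * v x + (fun=> 0) x).
  by rewrite j_linear ?j0 ?addr0//; exact: (hf0 BP).
have D0 := hf0 BP; rewrite polar_j//; last exact: (hfD BP).
rewrite hf_linear_r//.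
have -> : B u (fun=> 0) = 0.
  have := hf_linear_r (-1) D0 D0 Du; rewrite rmorphN1 [X in _ = X + _]mulN1r addNr => e0.
  by rewrite -[RHS]e0; congr B; apply/funext => x; rewrite mulr0 addr0.
by rewrite addr0; case: (B u v) => a b /=; congr (_ +i* _); ring.
Qed.

Lemma j_near (x : X) (U : set X) : nbhs x U -> exists2 u, D u & U (j u).
Proof.
rewrite nbhsE => -[W [oW Wx] WU].
have [y [Wy [u Du uy]]] := j_dense (ex_intro _ x Wx) oW.
by exists u => //; apply: WU; rewrite uy.
Qed.

Lemma j_approx (x : X) (e : R) : 0 < e -> exists2 u, D u & cnorm (j u - x) < e.
Proof.
move=> e0; have : nbhs x [set y | cnorm (y - x) < e] by apply/nbhs_cnorm; exists e.
by move=> /j_near.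
Qed.

Lemma j_seq (x : X) : exists u : nat -> T -> R[i], (forall k, D (u k)) /\ j \o u @ \oo --> x.
Proof.
have h (k : nat) : exists u, D u /\ cnorm (j u - x) < k.+1%:R^-1.
  by have [|u Du ux] := @j_approx x k.+1%:R^-1; [rewrite invr_gt0|exists u].
have [u uP] := choice h; exists u; split; first by move=> k; exact: (uP k).1.
apply/cvg_cnorm => e /inv_succ_small[N hN].
by exists N => // k /= /hN; apply: lt_le_trans; exact: (uP k).2.
Qed.

(** The inner product is bilinear on the dense image of D, hence everywhere by
    continuity. *)
Lemma polar_bilinear_form : polar_bilinear X.
Proof.
move=> a x y z.
have [u [Du ux]] := j_seq x; have [v [Dv vy]] := j_seq y; have [w [Dw wz]] := j_seq z.
have axy : (fun k => a%:C *: j (u k) + j (v k)) @ \oo --> a%:C *: x + y.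
  by apply: cvgD => //; apply: cvgZr.
have lhs : polar (a%:C *: j (u k) + j (v k)) (j (w k)) @[k --> \oo] -->
    polar (a%:C *: x + y) z by exact: polar_cvg.
have rhs : a * polar (j (u k)) (j (w k)) + polar (j (v k)) (j (w k)) @[k --> \oo] -->
    a * polar x z + polar y z.
  by apply: cvgD; [apply: cvgMl_tmp|]; exact: polar_cvg.
apply: (cvg_unique _ lhs) => //.
apply: cvg_trans rhs; apply: near_eq_cvg; near=> k => /=.
rewrite -j_linear// !polar_j//; last exact: (hfD BP).
rewrite (hf_linear BP)//.
by move: (B (u k) (w k)) (B (v k) (w k)) => [b b'] [c c'] /=; ring.
Unshelve. all: by end_near. Qed.

End FormSpace.

(** * Extension by continuity *)

Section BoundedMaps.
Context {R : realType}.

Lemma cnorm_lip_continuous (X Y : normedModType R[i]) (F : X -> Y) (C : R) x :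
  (forall y z, cnorm (F y - F z) <= C * cnorm (y - z)) -> F @ x --> F x.
Proof.
move=> FC; apply/cvg_cnorm => e e0; have C1 : 0 < `|C| + 1 by rewrite ltr_wpDl.
have : nbhs x [set y | cnorm (y - x) < e / (`|C| + 1)].
  by apply/nbhs_cnorm; exists (e / (`|C| + 1)); first exact: divr_gt0.
apply: filterS => y /=; rewrite ltr_pdivlMr// => yx.
apply: le_lt_trans (FC _ _) (le_lt_trans _ yx); rewrite mulrC.
rewrite ler_wpM2l ?cnorm_ge0//; have := ler_norm C; lra.
Qed.

Lemma cvg_cnorm_seq (X : normedModType R[i]) (u : nat -> X) x :
  u @ \oo --> x <-> (forall e, 0 < e -> exists N, forall k, (N <= k)%N -> cnorm (u k - x) <= e).
Proof.
split=> [/cvg_cnorm ux e /ux[N _ h]|h].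
  by exists N => k /h /ltW.
apply/cvg_cnorm => e e0; have [|N hN] := h (e / 2); first by rewrite divr_gt0.
by exists N => // k /hN; lra.
Qed.

Variables (T : Type) (D : set (T -> R[i])) (X Y : normedModType R[i]).
Variables (j : (T -> R[i]) -> X) (f : (T -> R[i]) -> Y) (C : R).
Hypothesis PY : polar_bilinear Y.
Hypothesis Yc : hcomplete (hilbertify PY).
Hypothesis D_closed : forall a u v, D u -> D v -> D (fun x => a * u x + v x).
Hypothesis j_linear : forall a u v, D u -> D v ->
  j (fun x => a * u x + v x) = a *: j u + j v.
Hypothesis j_dense : dense (j @` D).
Hypothesis f_linear : forall a u v, D u -> D v ->
  f (fun x => a * u x + v x) = a *: f u + f v.
Hypothesis f_bounded : forall u, D u -> cnorm (f u) <= C * cnorm (j u).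

Let f_lip u v : D u -> D v -> cnorm (f u - f v) <= C * cnorm (j u - j v).
Proof.
move=> Du Dv; have := f_bounded (D_closed (-1) Dv Du).
by rewrite f_linear// j_linear// !scaleN1r !(addrC (- _)).
Qed.

(** Along sequences of D whose images tend to x the images under f form Cauchy
    sequences, and boundedness makes their limit depend on x only. *)
Lemma extend_map : exists F : X -> Y,
  [/\ forall a x y, F (a *: x + y) = a *: F x + F y,
      forall x, cnorm (F x) <= C * cnorm x,
      forall u, D u -> F (j u) = f u &
      forall x, cont_ext D j f x = F x].
Proof.
have C1 : 0 < `|C| + 1 by rewrite ltr_wpDl.
have f_lip1 u v e : D u -> D v -> cnorm (j u - j v) <= e / (`|C| + 1) ->
    cnorm (f u - f v) <= e.
  move=> Du Dv; rewrite ler_pdivlMr// => h; apply: le_trans (f_lip Du Dv) _.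
  apply: le_trans h; rewrite mulrC ler_wpM2l ?cnorm_ge0//.
  by have := ler_norm C; lra.
have hF (x : X) : exists y : Y, forall u : nat -> T -> R[i], (forall k, D (u k)) ->
    j \o u @ \oo --> x -> f \o u @ \oo --> y.
  have [u [Du /cvg_cnorm_seq ux]] := j_seq j_dense x.
  have [y uy] : exists y : Y, hcvg (f \o u : nat -> hilbertify PY) y.
    apply: Yc => e e0; have [|N hN] := ux (e / (`|C| + 1) / 2).
      by rewrite !divr_gt0.
    exists N => k l /hN hk /hN hl; rewrite nrm_cnorm /=; apply: f_lip1 => //.
    have := cnormD (j (u k) - x) (x - j (u l)); rewrite addrA subrK (cnormBC x).
    by move: hk hl => /=; lra.
  exists y => v Dv /cvg_cnorm_seq vx; apply/cvg_cnorm_seq => e e0.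
  have e2 : 0 < e / 2 by rewrite divr_gt0.
  have [N1 h1] := uy _ e2.
  have [|N2 h2] := ux (e / 2 / (`|C| + 1) / 2); first by rewrite !divr_gt0.
  have [|N3 h3] := vx (e / 2 / (`|C| + 1) / 2); first by rewrite !divr_gt0.
  exists (maxn N1 (maxn N2 N3)) => k; rewrite !geq_max.
  move=> /and3P[/h1 {}h1 /h2 {}h2 /h3 {}h3]; rewrite nrm_cnorm in h1.
  have h4 : cnorm (f (v k) - f (u k)) <= e / 2.
    apply: f_lip1 => //.
    have := cnormD (j (v k) - x) (x - j (u k)); rewrite addrA subrK (cnormBC x).
    by move: h2 h3 => /=; lra.
  have := cnormD (f (v k) - f (u k)) (f (u k) - y); rewrite addrA subrK.
  by move: h1 => /=; lra.
have [F FP] := choice hF.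
have FL a x y : F (a *: x + y) = a *: F x + F y.
  have [u [Du ux]] := j_seq j_dense x; have [v [Dv vy]] := j_seq j_dense y.
  have h1 : (fun k => f (fun t => a * u k t + v k t)) @ \oo --> F (a *: x + y).
    apply: (FP _ (fun k t => a * u k t + v k t)) => [k|]; first exact: D_closed.
    under [X in X @ _]eq_fun do rewrite /= j_linear//.
    by apply: cvgD => //; apply: cvgZr.
  have h2 : (fun k => f (fun t => a * u k t + v k t)) @ \oo --> a *: F x + F y.
    under [X in X @ _]eq_fun do rewrite /= f_linear//.
    by apply: cvgD; [apply: cvgZr; exact: FP|exact: FP].
  by apply: (cvg_unique _ h1 h2); exact: norm_hausdorff.
have Fb x : cnorm (F x) <= C * cnorm x.
  have [u [Du ux]] := j_seq j_dense x.
  have h1 : cnorm (f (u k)) @[k --> \oo] --> cnorm (F x).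
    by apply: cvg_cnorm_comp; exact: FP.
  have h2 : C * cnorm (j (u k)) @[k --> \oo] --> C * cnorm x.
    by apply: cvgMl_tmp; exact: cvg_cnorm_comp.
  apply: (ler_cvg_to h1 h2); apply: nearW => k; exact: f_bounded.
have Fj u : D u -> F (j u) = f u.
  move=> Du; have h1 : (fun k : nat => f u) @ \oo --> F (j u).
    by apply: (FP _ (fun=> u)) => //; exact: cvg_cst.
  have h2 : (fun k : nat => f u) @ \oo --> f u by exact: cvg_cst.
  by apply: (cvg_unique _ h1 h2); exact: norm_hausdorff.
exists F; split=> // x; apply: cont_extE.
- apply: (@cnorm_lip_continuous _ _ _ C) => y z.
  have -> : F y - F z = F (y - z).
    by rewrite addrC -scaleN1r -FL scaleN1r addrC.
  exact: Fb.
- by move=> u /Fj.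
- by move=> U; exact: j_near.
Qed.

End BoundedMaps.

Section Generators.
Context {R : realType} (X : normedModType R[i]).
Variables (nm : X -> R) (C : R).
Hypothesis nm_ge : forall x, cnorm x <= nm x.
Hypothesis nm_le : forall x, nm x <= C * cnorm x.

(** The generator is defined by limits for the norm of X, whereas contractivity
    refers to the equivalent norm nm. *)
Lemma cvg_generator (T : R -> X -> X) (x z : X) :
  (h%:C^-1 *: (T h x - x) @[h --> 0^'+] --> z) <->
  (forall e, 0 < e -> exists2 d, 0 < d & forall h, 0 < h < d ->
     nm (T h x - x - h%:C *: z) <= e * h).
Proof.
have C1 : 0 < `|C| + 1 by rewrite ltr_wpDl.
have key h : 0 < h ->
    cnorm (h%:C^-1 *: (T h x - x) - z) = h^-1 * cnorm (T h x - x - h%:C *: z).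
  move=> h0; rewrite -[in RHS](@gtr0_norm _ h^-1) ?invr_gt0// -cnormZr.
  rewrite [in RHS]scalerBr scalerA -rmorphM /= mulVf ?gt_eqF// scale1r.
  by rewrite fmorphV.
split=> [/cvg_cnorm hz e e0|hz].
  have [|d /= d0 hd] := hz (e / (`|C| + 1)); first exact: divr_gt0.
  exists d => // h /andP[h0 hd'].
  have : cnorm (h%:C^-1 *: (T h x - x) - z) < e / (`|C| + 1).
    by apply: hd => //=; rewrite sub0r normrN gtr0_norm.
  rewrite key// ltr_pdivlMr// -mulrA mulrC -ltr_pdivlMr ?invr_gt0// invrK.
  move=> /ltW; apply: le_trans; apply: le_trans (nm_le _) _.
  rewrite mulrC ler_wpM2l ?cnorm_ge0//; have := ler_norm C; lra.
apply/cvg_cnorm => e e0; have [|d d0 hd] := hz (e / 2); first by rewrite divr_gt0.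
exists d => // h /=; rewrite sub0r normrN => hd' h0.
rewrite gtr0_norm// in hd'; rewrite key// mulrC ltr_pdivrMr//.
apply: le_lt_trans (nm_ge _) _; have := hd h; rewrite h0 hd' => /(_ isT) h1.
by apply: le_lt_trans h1 _; rewrite ltr_pM2r//; lra.
Qed.

Lemma generator_domP (T : R -> X -> X) (x : X) :
  generator_dom T x <-> exists z, forall e, 0 < e -> exists2 d, 0 < d &
    forall h, 0 < h < d -> nm (T h x - x - h%:C *: z) <= e * h.
Proof.
split=> [/cvg_ex[z xz]|[z xz]].
  by exists z; apply/cvg_generator.
by apply/cvg_ex; exists z; apply/cvg_generator.
Qed.

Lemma generatorE (T : R -> X -> X) (x z : X) :
  (forall e, 0 < e -> exists2 d, 0 < d &
    forall h, 0 < h < d -> nm (T h x - x - h%:C *: z) <= e * h) ->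
  generator T x = z.
Proof. by move=> /cvg_generator xz; apply: cvg_lim xz; exact: norm_hausdorff. Qed.

End Generators.

(** * Reduction to properties of the three forms *)

Section DenseMaps.
Context {R : realType} (X Y : normedModType R[i]).

Lemma linear_cnorm_lip (F : X -> Y) (C : R) :
  (forall a x y, F (a *: x + y) = a *: F x + F y) ->
  (forall x, cnorm (F x) <= C * cnorm x) ->
  forall x y, cnorm (F x - F y) <= C * cnorm (x - y).
Proof.
move=> FL FC x y; have := FC (-1 *: y + x).
by rewrite FL !scaleN1r !(addrC (- _)).
Qed.

Lemma cvg_linear (F : X -> Y) (C : R) x :
  (forall a x y, F (a *: x + y) = a *: F x + F y) ->
  (forall x, cnorm (F x) <= C * cnorm x) -> F @ x --> F x.
Proof.
by move=> FL FC; apply: (@cnorm_lip_continuous _ _ _ _ C); exact: linear_cnorm_lip.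
Qed.

Lemma linear_map0 (F : X -> Y) : (forall a x y, F (a *: x + y) = a *: F x + F y) -> F 0 = 0.
Proof. by move=> FL; have := FL (-1) 0 0; rewrite scaler0 addr0 scaleN1r addNr. Qed.

Lemma linear_mapZ (F : X -> Y) a x :
  (forall a x y, F (a *: x + y) = a *: F x + F y) -> F (a *: x) = a *: F x.
Proof. by move=> FL; rewrite -[a *: x]addr0 FL linear_map0// addr0. Qed.

Lemma eq_on_dense (T : Type) (D : set T) (j : T -> X) (F G : X -> Y) :
  (forall x, F @ x --> F x) -> (forall x, G @ x --> G x) ->
  (forall (x : X) U, nbhs x U -> exists2 t, D t & U (j t)) ->
  (forall t, D t -> F (j t) = G (j t)) -> F =1 G.
Proof.
move=> Fc Gc jD FG x.
rewrite -(cont_extE (f := G \o j) (Gc x) (fun _ _ => erefl) (jD x)).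
by rewrite (cont_extE (f := G \o j) (Fc x) _ (jD x))// => t /FG.
Qed.

End DenseMaps.

Section Reduction.
Context {R : realType} {n : nat}.
Variables (Omega : set 'rV[R]_n) (sigma : 'rV[R]_n -> R).
Variables (p : R) (m : R * 'rV[R]_n -> R).
Variables (HD : space_HD Omega sigma) (L2 : space_L2 Omega) (M : space_M Omega p m).

Local Notation test := (test_fun Omega).
Local Notation testM := (test_fun (half_cylinder Omega)).
Local Notation formM := (form_M Omega p m).
Local Notation formH := (form_HD Omega sigma).
Local Notation formL := (form_L2 Omega).
Local Notation jH := (to_completion HD).
Local Notation qL := (to_quotient L2).
Local Notation jM := (to_completion M).
Local Notation tensor chi v := (fun z : R * 'rV[R]_n => (chi z.1)%:C * v z.2).
Local Notation sub u v := (fun z => -1 * v z + u z).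

Hypothesis formH_hermitian : hermitian_form test formH.
Hypothesis formL_hermitian : hermitian_form (square_integrable Omega) formL.
Hypothesis formM_hermitian : hermitian_form testM formM.
Hypothesis L2_complete : forall PL : polar_bilinear L2, hcomplete (hilbertify PL).
Hypothesis test_L2 : test `<=` square_integrable Omega.
Variable CP : R.
Hypothesis poincare_le : forall v, test v ->
  complex.Re (formL v v) <= CP ^+ 2 * complex.Re (formH v v).
Hypothesis CP0 : 0 <= CP.
Hypothesis formH_green : forall phi, test phi -> exists2 psi, square_integrable Omega psi &
  forall v, test v -> formH v phi = formL v psi.
Hypothesis test_total : forall f, square_integrable Omega f ->
  (forall phi, test phi -> formL f phi = 0) -> complex.Re (formL f f) = 0.
Hypothesis shift_test : forall t eta, 0 <= t -> testM eta -> testM (right_shift t eta).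
Hypothesis shift_le : forall t eta, 0 <= t -> testM eta ->
  complex.Re (formM (right_shift t eta) (right_shift t eta)) <=
  complex.Re (formM eta eta).
Hypothesis shift_cauchy : forall eta, testM eta -> exists K d, [/\ 0 <= K, 0 < d &
  forall h k, 0 < h < d -> 0 < k < d ->
  let w z := (h^-1)%:C * (right_shift h eta z - eta z)
           - (k^-1)%:C * (right_shift k eta z - eta z) in
  complex.Re (formM w w) <= (K * (h + k)) ^+ 2].
Variables (chi0 : nat -> R -> R) (CJ : R).
Hypothesis chi0_cutoff : cutoff_seq chi0.
Hypothesis tensor_test : forall chi v k, cutoff_seq chi -> test v -> testM (tensor (chi k) v).
Hypothesis tensor_cauchy : forall chi v e, cutoff_seq chi -> test v -> 0 < e ->
  exists N, forall k l, (N <= k)%N -> (N <= l)%N ->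
  let w := sub (tensor (chi k) v) (tensor (chi0 l) v) in
  complex.Re (formM w w) <= e.
Hypothesis tensor_le : forall v k, test v ->
  complex.Re (formM (tensor (chi0 k) v) (tensor (chi0 k) v)) <=
  CJ ^+ 2 * complex.Re (formH v v).
Hypothesis CJ0 : 0 <= CJ.
Hypothesis tensor_cvg : forall eta v, testM eta -> test v ->
  (fun k => formM eta (tensor (chi0 k) v) : R[i]^o) @ \oo -->
  (formM eta (fun z => v z.2) : R[i]^o).

Let linH := to_completion_linear HD.
Let linL := to_quotient_linear L2.
Let linM := to_completion_linear M.
Let denseH := @to_completion_dense _ _ _ _ HD.
Let denseM := @to_completion_dense _ _ _ _ M.

Let denseL : dense (qL @` square_integrable Omega).
Proof.
move=> U [y Uy] _; exists y; split=> //.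
by have [f sf <-] := @to_quotient_surj _ _ _ _ L2 y; exists f.
Qed.

Let PH : polar_bilinear HD :=
  polar_bilinear_form formH_hermitian linH (@to_completion_norm _ _ _ _ HD) denseH.
Let PL : polar_bilinear L2 :=
  polar_bilinear_form formL_hermitian linL (@to_quotient_norm _ _ _ _ L2) denseL.
Let PM : polar_bilinear M :=
  polar_bilinear_form formM_hermitian linM (@to_completion_norm _ _ _ _ M) denseM.

Let V1 := hilbertify PH.
Let V2 := hilbertify PL.
Let V3 := hilbertify PM.

Let hformH u v : test u -> test v -> hform (jH u) (jH v) = formH u v.
Proof. by move=> tu tv; rewrite (hform_j formH_hermitian linH (@to_completion_norm _ _ _ _ HD)). Qed.

Let hformL u v : square_integrable Omega u -> square_integrable Omega v ->
  hform (qL u) (qL v) = formL u v.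
Proof. by move=> tu tv; rewrite (hform_j formL_hermitian linL (@to_quotient_norm _ _ _ _ L2)). Qed.

Let hformM u v : testM u -> testM v -> hform (jM u) (jM v) = formM u v.
Proof. by move=> tu tv; rewrite (hform_j formM_hermitian linM (@to_completion_norm _ _ _ _ M)). Qed.

Let normH u : test u -> cnorm (jH u) ^+ 2 = complex.Re (formH u u).
Proof. by move=> tu; rewrite (cnorm_j formH_hermitian (@to_completion_norm _ _ _ _ HD)). Qed.

Let normL u : square_integrable Omega u -> cnorm (qL u) ^+ 2 = complex.Re (formL u u).
Proof. by move=> tu; rewrite (cnorm_j formL_hermitian (@to_quotient_norm _ _ _ _ L2)). Qed.

Let normM u : testM u -> cnorm (jM u) ^+ 2 = complex.Re (formM u u).
Proof. by move=> tu; rewrite (cnorm_j formM_hermitian (@to_completion_norm _ _ _ _ M)). Qed.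

Let le_sqr (a b c : R) : 0 <= b -> 0 <= c -> a ^+ 2 <= c ^+ 2 * b ^+ 2 -> a <= c * b.
Proof.
move=> b0 c0; have [a0|a0] := leP 0 a; last first.
  by move=> _; apply: le_trans (ltW a0) _; exact: mulr_ge0.
by rewrite -exprMn ler_pXn2r// nnegrE mulr_ge0.
Qed.

Let iota_spec : exists F : HD -> L2,
  [/\ forall a x y, F (a *: x + y) = a *: F x + F y,
      forall x, cnorm (F x) <= CP * cnorm x,
      forall u, test u -> F (jH u) = qL u & forall x, HD_L2 L2 x = F x].
Proof.
have fL a u v : test u -> test v -> qL (fun x => a * u x + v x) = a *: qL u + qL v.
  by move=> /test_L2 tu /test_L2 tv; exact: linL.
have fC u : test u -> cnorm (qL u) <= CP * cnorm (jH u).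
  move=> tu; apply: le_sqr; rewrite ?cnorm_ge0//.
  by rewrite normL ?normH//; [exact: poincare_le|exact: test_L2].
exact: (@extend_map _ _ test HD L2 jH qL CP PL (@L2_complete PL) (hfD formH_hermitian) linH denseH fL fC).
Qed.

(** Every cutoff sequence is asymptotic to chi0; so all of them have the same
    limit, which is the one that [J_test] selects. *)
Let J_test_spec v : test v -> forall chi, cutoff_seq chi ->
  (fun k => jM (tensor (chi k) v)) @ \oo --> J_test M v.
Proof.
move=> tv.
have dist chi k l : cutoff_seq chi ->
    let w := sub (tensor (chi k) v) (tensor (chi0 l) v) in
    cnorm (jM (tensor (chi k) v) - jM (tensor (chi0 l) v)) ^+ 2 = complex.Re (formM w w).
  move=> cc w; have t1 := tensor_test k cc tv; have t2 := tensor_test l chi0_cutoff tv.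
  rewrite -normM; last exact: (hfD formM_hermitian).
  by rewrite linM// scaleN1r addrC.
have [y yP] : exists y : M, (fun k => jM (tensor (chi0 k) v)) @ \oo --> y.
  have [|y yP] := complete_hcomplete PM (u := fun k => jM (tensor (chi0 k) v)).
    move=> e e0; have [N hN] := tensor_cauchy chi0_cutoff tv (exprn_gt0 2 e0).
    exists N => k l Nk Nl; rewrite nrm_cnorm.
    rewrite -(@ler_pXn2r _ 2) ?nnegrE ?cnorm_ge0 ?(ltW e0)//.
    by apply: le_trans (hN _ _ Nk Nl); rewrite le_eqVlt; apply/orP; left; apply/eqP; exact: dist.
  exists y; apply/cvg_cnorm_seq => e /yP[N hN]; exists N => k /hN.
  by rewrite nrm_cnorm.
have yall chi : cutoff_seq chi -> (fun k => jM (tensor (chi k) v)) @ \oo --> y.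
  move=> cc; apply/cvg_cnorm_seq => e e0; have e2 : 0 < e / 2 by rewrite divr_gt0.
  have [N1 h1] := tensor_cauchy cc tv (exprn_gt0 2 e2).
  have [N2 h2] := (cvg_cnorm_seq _ _).1 yP _ e2.
  exists (maxn N1 N2) => k; rewrite geq_max => /andP[k1 k2].
  have h3 : cnorm (jM (tensor (chi k) v) - jM (tensor (chi0 k) v)) <= e / 2.
    rewrite -(@ler_pXn2r _ 2) ?nnegrE ?cnorm_ge0 ?(ltW e2)//.
    by apply: le_trans (h1 _ _ k1 k1); rewrite le_eqVlt; apply/orP; left; apply/eqP; exact: dist.
  have := cnormD (jM (tensor (chi k) v) - jM (tensor (chi0 k) v)) (jM (tensor (chi0 k) v) - y).
  by rewrite addrA subrK; have := h2 k k2; lra.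
by rewrite /J_test; case: xgetP => [z _ //|/(_ y)]; last by move=> /(_ yall).
Qed.

Let J_spec : exists F : HD -> M,
  [/\ forall a x y, F (a *: x + y) = a *: F x + F y,
      forall x, cnorm (F x) <= CJ * cnorm x,
      forall u, test u -> F (jH u) = J_test M u & forall x, J_op M x = F x].
Proof.
apply: (@extend_map _ _ test HD M jH (J_test M) CJ PM (complete_hcomplete PM)) => //.
- exact: (hfD formH_hermitian).
- move=> a u v tu tv; have h1 := J_test_spec (hfD formH_hermitian a tu tv) chi0_cutoff.
  have h2 : (fun k => jM (tensor (chi0 k) (fun x => a * u x + v x))) @ \oo -->
      a *: J_test M u + J_test M v.
    have -> : (fun k => jM (tensor (chi0 k) (fun x => a * u x + v x))) =
        (fun k => a *: jM (tensor (chi0 k) u) + jM (tensor (chi0 k) v)).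
      apply/funext => k; rewrite -linM; [|exact: tensor_test|exact: tensor_test].
      by congr jM; apply/funext => z; rewrite mulrDr mulrCA.
    by apply: cvgD; [apply: cvgZr|]; exact: J_test_spec.
  by apply: (cvg_unique _ h1 h2); exact: norm_hausdorff.
- move=> u tu.
  have h1 : cnorm (jM (tensor (chi0 k) u)) @[k --> \oo] --> cnorm (J_test M u).
    by apply: cvg_cnorm_comp; exact: J_test_spec.
  have h2 : CJ * cnorm (jH u) @[k --> \oo] --> CJ * cnorm (jH u) by exact: cvg_cst.
  apply: (ler_cvg_to h1 h2); apply: nearW => k; apply: le_sqr; rewrite ?cnorm_ge0//.
  by rewrite normM ?normH//; [exact: tensor_le|exact: tensor_test].
Qed.

Let shift0 eta : testM eta -> right_shift 0 eta = eta.
Proof.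
move=> [_ _ sup]; apply/funext => z; rewrite /right_shift subr0.
case: ifPn => [z0|_]; last by case: z.
apply/esym/eqP/negP => ez; have : half_cylinder Omega z.
  by apply: sup; apply: subset_closure; exact/negP.
by move=> [/lt_geF]; rewrite z0.
Qed.

Let shiftD s t eta : 0 <= s -> 0 <= t -> testM eta ->
  right_shift (s + t) eta = right_shift s (right_shift t eta).
Proof.
move=> s0 t0 te; apply/funext => z; rewrite /right_shift /=.
have [zs|zs] := leP z.1 s; first by rewrite ifT// (le_trans zs)// lerDl.
rewrite lerBlDl; case: ifP => // _; congr (eta (_, _)); ring.
Qed.

Let S_spec t : 0 <= t -> exists F : M -> M,
  [/\ forall a x y, F (a *: x + y) = a *: F x + F y,
      forall x, cnorm (F x) <= 1 * cnorm x,
      forall u, testM u -> F (jM u) = jM (right_shift t u) &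
      forall x, S_semigroup (M:=M) t x = F x].
Proof.
move=> t0; apply: (@extend_map _ _ testM M M jM (fun eta => jM (right_shift t eta)) 1
  PM (complete_hcomplete PM)) => //.
- exact: (hfD formM_hermitian).
- move=> a u v tu tv; rewrite -linM; [|exact: shift_test|exact: shift_test].
  congr jM; apply/funext => z; rewrite /right_shift; case: ifP => // _.
  by rewrite mulr0 addr0.
- move=> u tu; apply: le_sqr; rewrite ?cnorm_ge0//.
  have ts := shift_test t0 tu; rewrite (normM tu) (normM ts) expr1n mul1r.
  exact: shift_le.
Qed.

Let S := S_semigroup (M:=M).

Let S_linear t a x y : 0 <= t -> S t (a *: x + y) = a *: S t x + S t y.
Proof. by move=> /S_spec[F [FL _ _ SF]]; rewrite /S !SF. Qed.

Let S_contr t x : 0 <= t -> cnorm (S t x) <= cnorm x.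
Proof. by move=> /S_spec[F [_ FC _ SF]]; rewrite /S !SF -[leRHS]mul1r. Qed.

Let S_j t u : 0 <= t -> testM u -> S t (jM u) = jM (right_shift t u).
Proof. by move=> /S_spec[F [_ _ Fj SF]] tu; rewrite /S !SF Fj. Qed.

Let nearM (x : M) U : nbhs x U -> exists2 t, testM t & U (jM t).
Proof. exact: j_near. Qed.

Let nearH (x : HD) U : nbhs x U -> exists2 t, test t & U (jH t).
Proof. exact: j_near. Qed.

Let S_cvg t x : 0 <= t -> S t @ x --> S t x.
Proof.
move=> t0; apply: (@cvg_linear _ _ _ _ 1) => *; first exact: S_linear.
by rewrite mul1r; exact: S_contr.
Qed.

(** The difference quotients are Cauchy at a linear rate; so the orbits of test
    functions are differentiable at 0. *)
Let S_quotient eta : testM eta -> exists K d (z : M), [/\ 0 <= K, 0 < d &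
  forall h, 0 < h < d -> cnorm (S h (jM eta) - jM eta - h%:C *: z) <= K * h * h].
Proof.
move=> te; have [K [d [K0 d0 hK]]] := shift_cauchy te.
pose D h : M := (h^-1)%:C *: (S h (jM eta) - jM eta).
have hD h k : 0 < h < d -> 0 < k < d -> cnorm (D h - D k) <= K * (h + k).
  move=> hd kd; have := hK h k hd kd; set w := (fun z => _) => hw.
  have /andP[h0 _] := hd; have /andP[k0 _] := kd.
  have sh q : 0 <= q -> testM (fun z => -1 * eta z + right_shift q eta z).
    by move=> q0; apply: (hfD formM_hermitian) => //; exact: shift_test.
  have z0 := hf0 formM_hermitian.
  have DE q : 0 < q -> D q = jM (fun z => (q^-1)%:C * (-1 * eta z + right_shift q eta z) + 0).
    move=> q0; rewrite linM//; last by exact: sh (ltW q0).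
    rewrite linM//; last by apply: shift_test => //; exact: ltW.
    rewrite (j0 formM_hermitian linM) addr0 scaleN1r addrC /D S_j//; exact: ltW.
  have tD q : 0 < q -> testM (fun z => (q^-1)%:C * (-1 * eta z + right_shift q eta z) + 0).
    by move=> q0; apply: (hfD formM_hermitian) => //; exact: sh (ltW q0).
  have -> : D h - D k = jM w.
    rewrite !DE// addrC -scaleN1r -linM; [|exact: tD|exact: tD].
    by congr jM; apply/funext => z; rewrite /w; ring.
  have tw : testM w.
    have := hfD formM_hermitian (-1) (tD k k0) (tD h h0); congr (testM _).
    by apply/funext => z; rewrite /w; ring.
  rewrite -(@ler_pXn2r _ 2) ?nnegrE ?cnorm_ge0// ?normM//.
  by rewrite mulr_ge0// addr_ge0// ltW.
(* A sequence in ]0, d[ that tends to 0. *)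
pose q (k : nat) : R := d / 2 * k.+1%:R^-1.
have qd k : 0 < q k < d.
  rewrite mulr_gt0 ?divr_gt0//=; apply: (@le_lt_trans _ _ (d / 2)); last by lra.
  by rewrite ler_piMr ?divr_ge0 ?(ltW d0)// invf_le1 ?ltr0Sn// ler1n.
have small e : 0 < e -> exists N, forall k, (N <= k)%N -> K * q k <= e.
  move=> e0; have c0 : 0 < K * (d / 2) + 1.
    by rewrite ltr_wpDl ?ltr01// mulr_ge0// divr_ge0// (ltW d0).
  have [|N hN] := @inv_succ_small R (e / (K * (d / 2) + 1)); first exact: divr_gt0.
  exists N => k /hN; rewrite ler_pdivlMr// => h; apply: le_trans h.
  rewrite /q mulrA mulrC ler_wpM2l ?invr_ge0//; lra.
have [|z zP] := complete_hcomplete PM (u := fun k => D (q k)).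
  move=> e e0; have [|N hN] := small (e / 2); first by rewrite divr_gt0.
  exists N => k l /hN h1 /hN h2; rewrite nrm_cnorm.
  by apply: le_trans (hD _ _ (qd k) (qd l)) _; rewrite mulrDr; lra.
exists K, d, z; split=> // h hd; have /andP[h0 _] := hd.
have Dz : cnorm (D h - z) <= K * h.
  apply/ler_addgt0Pr => e e0; have e2 : 0 < e / 2 by rewrite divr_gt0.
  have [N1 h1] := zP _ e2; have [N2 h2] := small _ e2.
  have := h1 _ (leq_maxl N1 N2); have := h2 _ (leq_maxr N1 N2).
  set k := maxn _ _; rewrite nrm_cnorm => h3 h4.
  have := cnormD (D h - D (q k)) (D (q k) - z); rewrite addrA subrK.
  have := hD _ _ hd (qd k); rewrite mulrDr => h5 h6.
  by apply: le_trans h6 _; move: h4 => /=; lra.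
have -> : S h (jM eta) - jM eta - h%:C *: z = h%:C *: (D h - z).
  by rewrite scalerBr /D scalerA -rmorphM /= mulfV ?gt_eqF// scale1r.
by rewrite cnormZr gtr0_norm// mulrC ler_pM2r.
Qed.

Let Scs : csemigroup (S : R -> V3 -> V3).
Proof.
split.
- by move=> t a x y t0; exact: S_linear.
- apply: (@eq_on_dense _ M M _ testM jM (S 0) id).
  + by move=> x; exact: S_cvg.
  + by move=> x; apply: cvg_id.
  + exact: nearM.
  + by move=> t tt; rewrite S_j// shift0.
- move=> s t x s0 t0; move: x.
  have st0 : 0 <= s + t by rewrite addr_ge0.
  apply: (@eq_on_dense _ M M _ testM jM (S (s + t)) (S s \o S t)).
  + by move=> x; exact: S_cvg.
  + by move=> x; apply: (@cvg_comp _ _ _ (S t) (S s) _ (nbhs (S t x))); exact: S_cvg.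
  + exact: nearM.
  + by move=> u tu; rewrite /= !S_j//; [rewrite shiftD|exact: shift_test].
- by move=> t x t0; rewrite !nrm_cnorm; exact: S_contr.
- move=> x e e0; have e4 : 0 < e / 4 by rewrite divr_gt0.
  have [eta te ex] := j_approx denseM x e4.
  have [K [d [z [K0 d0 hK]]]] := S_quotient te.
  pose c := K + cnorm z + 1.
  have c0 : 0 < c by rewrite /c; have := cnorm_ge0 z; lra.
  pose d' := Num.min d (Num.min 1 (e / 4 / c)).
  have d'0 : 0 < d' by rewrite !lt_min d0 ltr01 !divr_gt0.
  exists d' => // h /andP[h0]; rewrite !lt_min => /and3P[hd h1 hc].
  rewrite nrm_cnorm.
  have h3 : cnorm (S h (jM eta) - jM eta) <= e / 4.
    move: h0; rewrite le_eqVlt => /predU1P[<-|h0].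
      by rewrite S_j// shift0// subrr cnorm0 ltW.
    have := hK h; rewrite h0 hd => /(_ isT) h2.
    have := cnormD (S h (jM eta) - jM eta - h%:C *: z) (h%:C *: z).
    rewrite subrK cnormZr gtr0_norm// => h3; apply: le_trans h3 _.
    have : K * h * h <= K * h by rewrite ler_piMr ?mulr_ge0// ltW.
    move: hc; rewrite ltr_pdivlMr// /c; lra.
  have h4 := S_contr (x - jM eta) h0.
  have SB u v : S h (u - v) = S h u - S h v.
    by rewrite addrC -scaleN1r S_linear// scaleN1r addrC.
  rewrite SB in h4; rewrite (cnormBC x) in h4.
  have h5 := cnormD (S h x - S h (jM eta)) (S h (jM eta) - jM eta).
  rewrite addrA subrK in h5.
  have h6 := cnormD (S h x - jM eta) (jM eta - x); rewrite addrA subrK in h6.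
  by apply: le_trans h6 _; lra.
Qed.

Let genD (x : V3) e : 0 < e ->
  exists x' z, gen (S : R -> V3 -> V3) x' z /\ nrm (x - x' : V3) <= e.
Proof.
move=> e0; have [eta te ex] := j_approx denseM x e0.
have [K [d [z [K0 d0 hK]]]] := S_quotient te.
exists (jM eta), z; split; last by rewrite nrmBC nrm_cnorm ltW.
move=> r r0; have K1 : 0 < K + 1 by lra.
exists (Num.min d (r / (K + 1))); first by rewrite lt_min d0 divr_gt0.
move=> h /andP[h0]; rewrite lt_min ltr_pdivlMr// => /andP[hd hr].
rewrite nrm_cnorm; have := hK h; rewrite h0 hd => /(_ isT) h1.
by apply: le_trans h1 _; rewrite ler_pM2r//; lra.
Qed.

Section Generation.
Variables (iota : HD -> L2) (J : HD -> M).
Hypothesis iotaL : forall a x y, iota (a *: x + y) = a *: iota x + iota y.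
Hypothesis iotaC : forall x, cnorm (iota x) <= CP * cnorm x.
Hypothesis iotaj : forall u, test u -> iota (jH u) = qL u.
Hypothesis iotaE : forall x, HD_L2 L2 x = iota x.
Hypothesis JL : forall a x y, J (a *: x + y) = a *: J x + J y.
Hypothesis JC : forall x, cnorm (J x) <= CJ * cnorm x.
Hypothesis Jj : forall u, test u -> J (jH u) = J_test M u.
Hypothesis JE : forall x, J_op M x = J x.

Let hform_re (X : normedModType R[i]) (x y : X) : complex.Re (hform x y) = polar x y.
Proof. by []. Qed.

Let iota_cvg x : iota @ x --> iota x.
Proof. exact: cvg_linear iotaL iotaC. Qed.

Let Jmap_cvg x : J @ x --> J x.
Proof. exact: cvg_linear JL JC. Qed.

(** By Green's formula the product of x with a test function in H_D is an L^2
    product with iota x; if this is 0 then x is orthogonal to a dense set. *)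
Let iota_inj x : iota x = 0 -> x = 0.
Proof.
move=> x0; have h : forall y, hform x y = 0.
  apply: (@eq_on_dense _ HD (R[i]^o : normedModType R[i]) _ test jH (hform x) (fun=> 0)).
  - by move=> y; apply: hform_cvg; [exact: cvg_cst|exact: cvg_id].
  - by move=> y; exact: cvg_cst.
  - exact: nearH.
  move=> phi tphi; have [psi spsi hpsi] := formH_green tphi.
  have e : forall z, hform z (jH phi) = hform (iota z) (qL psi).
    apply: (@eq_on_dense _ HD (R[i]^o : normedModType R[i]) _ test jH
      (fun z => hform z (jH phi)) (fun z => hform (iota z) (qL psi))).
    - by move=> y; apply: hform_cvg; [exact: cvg_id|exact: cvg_cst].
    - by move=> y; apply: hform_cvg; [exact: iota_cvg|exact: cvg_cst].
    - exact: nearH.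
    by move=> v tv; rewrite hformH// iotaj// hformL// ?hpsi//; exact: test_L2.
  rewrite e x0; apply/eqP; rewrite eq_complex /hform /= /polar !add0r !cnormN.
  by rewrite !subrr !mul0r !eqxx.
apply: cnorm_eq0; apply/eqP; rewrite -sqrf_eq0; apply/eqP.
by rewrite -polarxx -hform_re h.
Qed.

Let Delta_sigmaE (u phi : HD) : Delta_sigma u phi = - hform u phi.
Proof.
rewrite /Delta_sigma.
apply: (@cont_extE _ _ _ (R[i]^o : normedModType R[i]) _ _ _
  (fun w : HD * HD => - hform w.1 w.2)).
- by apply: cvgN; apply: hform_cvg; [exact: cvg_fst|exact: cvg_snd].
- by move=> [v w] [/= tv tw]; rewrite hformH.
- move=> U [[U1 U2] /= [n1 n2] sU].
  have [v tv Uv] := nearH n1; have [w tw Uw] := nearH n2.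
  by exists (v, w) => //; exact: sU.
Qed.

Let hformMJ eta phi : testM eta -> test phi ->
  hform (jM eta) (J (jH phi)) = formM eta (fun z => phi z.2).
Proof.
move=> te tp; rewrite Jj//.
have h1 : (fun k => hform (jM eta) (jM (tensor (chi0 k) phi))) @ \oo -->
    hform (jM eta) (J_test M phi).
  by apply: hform_cvg; [exact: cvg_cst|exact: J_test_spec].
have h2 : (fun k => hform (jM eta) (jM (tensor (chi0 k) phi))) @ \oo -->
    (formM eta (fun z => phi z.2) : R[i]^o).
  have -> : (fun k => hform (jM eta) (jM (tensor (chi0 k) phi))) =
      (fun k => formM eta (tensor (chi0 k) phi) : R[i]^o).
    by apply/funext => k; rewrite hformM//; exact: tensor_test.
  exact: tensor_cvg.
by apply: (cvg_unique _ h1 h2); exact: norm_hausdorff.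
Qed.

Let Q_opE (eta : M) (phi : HD) : Q_op eta phi = - hform eta (J phi).
Proof.
rewrite /Q_op.
apply: (@cont_extE _ _ _ (R[i]^o : normedModType R[i]) _ _ _
  (fun w : M * HD => - hform w.1 (J w.2))).
- apply: cvgN; apply: hform_cvg; first exact: cvg_fst.
  by apply: (@cvg_comp _ _ _ snd J _ (nbhs phi)); [exact: cvg_snd|exact: Jmap_cvg].
- by move=> [v w] [/= tv tw]; rewrite hformMJ.
- move=> U [[U1 U2] /= [n1 n2] sU].
  have [v tv Uv] := nearM n1; have [w tw Uw] := nearH n2.
  by exists (v, w) => //; exact: sU.
Qed.

(** Being a representative in the sense of complex antilinear functionals is
    the same as being one for the real parts: replace phi by i phi. *)
Let representsP (g : L2) (u : HD) (eta : M) :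
  represents g (fun phi => Delta_sigma u phi + Q_op eta phi) <->
  forall phi, polar g (iota phi) = - polar u phi - polar eta (J phi).
Proof.
have hE phi : Delta_sigma u phi + Q_op eta phi = - hform u phi - hform eta (J phi).
  by rewrite Delta_sigmaE Q_opE.
split=> [[f [sf fg hf]]|h].
  have e : forall phi, hform g (iota phi) = - hform u phi - hform eta (J phi).
    apply: (@eq_on_dense _ HD (R[i]^o : normedModType R[i]) _ test jH
      (fun phi => hform g (iota phi)) (fun phi => - hform u phi - hform eta (J phi))).
    - by move=> y; apply: hform_cvg; [exact: cvg_cst|exact: iota_cvg].
    - move=> y; apply: cvgB.
        by apply: cvgN; apply: hform_cvg; [exact: cvg_cst|exact: cvg_id].
      by apply: hform_cvg; [exact: cvg_cst|exact: Jmap_cvg].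
    - exact: nearH.
    by move=> v tv; rewrite -hE hf// -fg iotaj// hformL//; exact: test_L2.
  by move=> phi; have := congr1 (@complex.Re R) (e phi).
have [f sf fg] := @to_quotient_surj _ _ _ _ L2 g.
exists f; split=> // phi tphi; rewrite hE -hformL//; last exact: test_L2.
rewrite fg -(iotaj tphi).
have -> : hform g (iota (jH phi)) = polar g (iota (jH phi)) +i*
    polar g (iota ('i *: jH phi)).
  by rewrite /hform (linear_mapZ _ _ iotaL).
rewrite !h /hform -(linear_mapZ _ _ JL).
by apply/eqP; rewrite eq_complex /= !eqxx.
Qed.

Let iota_dense (g : L2) : (forall phi, polar g (iota phi) = 0) -> g = 0.
Proof.
have [f sf <-] := @to_quotient_surj _ _ _ _ L2 g => h.
apply: cnorm_eq0; apply/eqP; rewrite -sqrf_eq0 normL//; apply/eqP.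
apply: test_total => // phi tphi; rewrite -hformL//; last exact: test_L2.
rewrite -(iotaj tphi); have e1 := h (jH phi); have e2 := h ('i *: jH phi).
rewrite (linear_mapZ _ _ iotaL) in e2.
by rewrite /hform e1 e2.
Qed.

Let V := prod3 V1 V2 V3.
Let H : normedModType R[i] := space_H HD L2 M.
Let wv : H -> H -> Prop := @wave R V1 V2 V3 iota J S.

Let waveP (x y : H) : wv x y <->
  [/\ iota y.1.1 = x.1.2,
      forall f, polar y.1.2 (iota f) = - polar x.1.1 f - polar x.2 (J f) &
      gen (S : R -> V3 -> V3) x.2 (y.2 - J y.1.1)].
Proof. by []. Qed.

Let genP (x z : M) : gen (S : R -> V3 -> V3) x z <->
  (forall e, 0 < e -> exists2 d, 0 < d & forall h, 0 < h < d ->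
     cnorm (S h x - x - h%:C *: z) <= e * h).
Proof.
split=> g e /g[d d0 hd]; exists d => // h /hd; first by rewrite nrm_cnorm.
by rewrite nrm_cnorm.
Qed.

Let cnorm_le1 (X : normedModType R[i]) (x : X) : cnorm x <= 1 * cnorm x.
Proof. by rewrite mul1r. Qed.

Let L_domP (x : H) : L_dom HD L2 M x <-> exists z, wv x z.
Proof.
case: x => -[u v] eta; split.
  move=> [[w wv_] [g hg] /(generator_domP (fun=> lexx _) (@cnorm_le1 M))[z hz]].
  exists (w, g, z + J w); apply/waveP; split => /=.
  - by rewrite -iotaE.
  - exact/representsP.
  - by apply/genP; rewrite addrK.
move=> [[[w g] z] /waveP[/= h1 h2 /genP h3]]; split.
- by exists w; rewrite iotaE.
- by exists g; apply/representsP.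
- by apply/(generator_domP (fun=> lexx _) (@cnorm_le1 M)); exists (z - J w).
Qed.

Let L_opE (x z : H) : wv x z -> L_op HD L2 M x = z.
Proof.
case: x => -[u v] eta; case: z => -[w g] z /waveP[/= h1 h2 /genP h3].
have wE : L2_to_HD HD v = w.
  rewrite /L2_to_HD; case: xgetP => [w' _ /= |/(_ w) nw]; last by case: nw; rewrite /= iotaE.
  rewrite iotaE -h1 => e; apply/eqP; rewrite -subr_eq0; apply/eqP/iota_inj.
  by rewrite addrC -scaleN1r iotaL e scaleN1r addNr.
rewrite /L_op wE JE; congr (_, _, _).
  rewrite /dual_to_L2; case: xgetP => [g' _ /= /representsP h4|/(_ g) ng]; last first.
    by case: ng; apply/representsP.
  apply/eqP; rewrite -subr_eq0; apply/eqP/iota_dense => phi.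
  have := PL (-1) g g' (iota phi); rewrite (_ : (-1)%:C = -1); last by rewrite rmorphN1.
  by rewrite scaleN1r addrC => ->; rewrite h4 h2; ring.
rewrite /A_op (generatorE (fun=> lexx _) (@cnorm_le1 M) h3).
by rewrite subrK.
Qed.

Let nrmH (x : V) : nrm x = norm_H HD L2 M x.
Proof.
by rewrite -[LHS]ger0_norm ?nrm_ge0// -sqrtr_sqr sqr_nrm3 !nrm_cnorm.
Qed.

Let cnormH (x : H) : [/\ cnorm x <= norm_H HD L2 M x & norm_H HD L2 M x <= 3 * cnorm x].
Proof.
have [h1 h2 h3] := nrm3_ge (x : V); have h4 := nrm3_le (x : V).
rewrite !nrm_cnorm nrmH in h1 h2 h3 h4.
have nE : `|x| = Num.max (Num.max `|x.1.1| `|x.1.2|) `|x.2| by [].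
have cE : cnorm x = Num.max (Num.max (cnorm x.1.1) (cnorm x.1.2)) (cnorm x.2).
  have cmax (a b : R) : Num.max a%:C b%:C = (Num.max a b)%:C.
    by rewrite !maxEle lecR; case: ifP.
  by rewrite /cnorm nE !cnormE !cmax.
rewrite cE; split; first by rewrite !ge_max h1 h2.
apply: le_trans h4 _; set a := cnorm _; set b := cnorm _; set c := cnorm _.
have : a <= Num.max (Num.max a b) c by rewrite !le_max lexx.
have : b <= Num.max (Num.max a b) c by rewrite !le_max lexx orbT.
have : c <= Num.max (Num.max a b) c by rewrite !le_max lexx orbT.
lra.
Qed.

(** The real theory yields a real linear semigroup; it is complex linear
    because multiplication by i preserves the graph. *)
Lemma wave_generates :
  generates_contraction_semigroup (norm_H HD L2 M) (L_dom HD L2 M) (L_op HD L2 M).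
Proof.
have iotab (x : V1) : nrm (iota x : V2) <= CP * nrm x by rewrite !nrm_cnorm.
have Jb (x : V1) : nrm (J x : V3) <= CJ * nrm x by rewrite !nrm_cnorm.
have [T [Tcs Tgen TI]] := @wave_semigroup R V1 V2 V3
  (complete_hcomplete PH) (@L2_complete PL) (complete_hcomplete PM) iota J CP CJ
  (fun a x y => iotaL a%:C x y) iotab iota_inj iota_dense
  (fun a x y => JL a%:C x y) Jb S Scs genD.
have i0 (x : H) : 'i *: x = ('i *: x.1.1, 'i *: x.1.2, 'i *: x.2) by [].
have polari (X : normedModType R[i]) (x y : X) : polar ('i *: x) y = polar x (- ('i *: y)).
  rewrite -[RHS]polar_i scalerN scalerA; congr polar.
  by rewrite -expr2 sqr_i scaleN1r opprK.
have wi x z : wv x z -> wv ('i *: x) ('i *: z).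
  move=> /waveP[h1 h2 h3]; apply/waveP; split.
  - by rewrite !i0 /= (linear_mapZ _ _ iotaL) h1.
  - move=> f; rewrite !i0 /= !polari.
    have -> : - ('i *: iota f) = iota (- 'i *: f).
      by rewrite (linear_mapZ _ _ iotaL) scaleNr.
    have -> : - ('i *: J f) = J (- 'i *: f).
      by rewrite (linear_mapZ _ _ JL) scaleNr.
    by rewrite h2 scaleNr.
  - rewrite !i0 /= (linear_mapZ _ _ JL) -scalerBr; apply/genP => e e0.
    have /genP/(_ e e0)[d d0 hd] := h3; exists d => // h /[dup] hh /hd.
    move: hh => /andP[/ltW h0 _]; rewrite -cnormZi; congr (_ <= _); congr cnorm.
    have -> : S h ('i *: x.2) = 'i *: S h x.2.
      by apply: linear_mapZ => *; exact: S_linear.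
    by rewrite !scalerBr !scalerA (mulrC h%:C).
have Ti t (x : H) : 0 <= t -> T t ('i *: x : H) = 'i *: (T t x : H).
  move=> t0; apply: (TI (fun x : V => 'i *: (x : H))) => //.
  - move=> a u v; change ('i *: (a%:C *: (u : H) + (v : H)) = a%:C *: ('i *: (u : H)) + 'i *: (v : H)).
    by rewrite scalerDr !scalerA mulrC.
  - move=> u; rewrite !nrmH /norm_H i0 /=.
    by rewrite -!/(cnorm _) !cnormZi.
have genTP (x z : H) : gen T x z <->
    forall e, 0 < e -> exists2 d, 0 < d & forall h, 0 < h < d ->
     norm_H HD L2 M (T h x - x - h%:C *: z) <= e * h.
  split=> g e /g[d d0 hd]; exists d => // h /hd; first by rewrite nrmH.
  by rewrite nrmH.
have nge (x : H) : cnorm x <= norm_H HD L2 M x by have [] := cnormH x.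
have nle (x : H) : norm_H HD L2 M x <= 3 * cnorm x by have [] := cnormH x.
exists T; split.
- split.
  + move=> t t0 c x y; case: c => a b.
    have -> : (a +i* b) *: x = a%:C *: x + b%:C *: ('i *: x).
      rewrite scalerA -scalerDl; congr (_ *: _); apply/eqP.
      by rewrite eq_complex /=; apply/andP; split; apply/eqP; ring.
    have -> : (a +i* b) *: T t x = a%:C *: (T t x : H) + b%:C *: ('i *: (T t x : H)).
      rewrite scalerA -scalerDl; congr (_ *: _); apply/eqP.
      by rewrite eq_complex /=; apply/andP; split; apply/eqP; ring.
    rewrite -!addrA; have l1 := cs_linear Tcs a x (b%:C *: ('i *: x) + y) t0.
    have l2 := cs_linear Tcs b ('i *: x : H) y t0.
    by apply: etrans l1 _; congr (_ + _); apply: etrans l2 _; rewrite Ti.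
  + by apply/funext => x; exact: (cs0 Tcs x).
  + by move=> s t s0 t0; apply/funext => x; exact: (csD Tcs x s0 t0).
  + move=> x; apply/cvg_cnorm => e e0.
    have [|d d0 hd] := cs_cont Tcs x (e := e / 2); first by rewrite divr_gt0.
    exists d => // h /=; rewrite sub0r normrN => hd' h0; rewrite gtr0_norm// in hd'.
    have := hd h; rewrite (ltW h0) hd' => /(_ isT) h1.
    apply: le_lt_trans (nge _) _; rewrite -nrmH; apply: le_lt_trans h1 _; lra.
  + by move=> t x t0; rewrite -!nrmH; exact: (cs_contr Tcs x t0).
- apply/seteqP; split => x.
    by move=> /(generator_domP nge nle)[z hz]; apply/L_domP; exists z; apply/Tgen/genTP.
  by move=> /L_domP[z /Tgen/genTP hz]; apply/(generator_domP nge nle); exists z.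
- move=> x /L_domP[z wz]; rewrite (L_opE wz).
  by apply: (generatorE nge nle); apply/genTP/Tgen.
Qed.

End Generation.

(** Once the forms have the properties assumed in this section, the rest is
    Hilbert space theory. *)
Theorem generation_of_forms :
  generates_contraction_semigroup (norm_H HD L2 M) (L_dom HD L2 M) (L_op HD L2 M).
Proof.
have [iota [h1 h2 h3 h4]] := iota_spec; have [J [k1 k2 k3 k4]] := J_spec.
exact: (wave_generates h1 h2 h3 h4 k1 k2 k3 k4).
Qed.

End Reduction.

(** * Smooth functions and their supports *)

Section SmoothAlgebra.
Context {R : realType}.
Implicit Types (W : normedModType R).

Lemma dcW W k (f : W -> R) : differentiable_class k.+1 f -> differentiable_class k f.
Proof.
elim: k f => [|k IH] f; first by case.
by move=> [cf df]; split=> // v; have [h1 h2] := df v; split=> //; exact: IH.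
Qed.

Lemma dc_cst W k (c : R) : differentiable_class k (fun _ : W => c).
Proof.
elim: k c => [|k IH] c /=; first by move=> x; exact: cvg_cst.
split=> [x|v]; first exact: cvg_cst.
split; first by move=> x; exact: derivable_cst.
have -> : (fun x : W => 'D_v (fun _ : W => c) x) = fun=> 0.
  by apply/funext => x; exact: derive_cst.
exact: IH.
Qed.

Lemma dcD W k (f g : W -> R) : differentiable_class k f -> differentiable_class k g ->
  differentiable_class k (fun x => f x + g x).
Proof.
elim: k f g => [|k IH] f g; first by move=> cf cg x; apply: cvgD; [exact: cf|exact: cg].
move=> [cf df] [cg dg]; split=> [x|v]; first by apply: cvgD; [exact: cf|exact: cg].
have [f1 f2] := df v; have [g1 g2] := dg v.
split=> [x|]; first exact: derivableD.
have -> : (fun x => 'D_v (fun y => f y + g y) x) = fun x => 'D_v f x + 'D_v g x.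
  by apply/funext => x; exact: deriveD.
exact: IH.
Qed.

Lemma dcM W k (f g : W -> R) : differentiable_class k f -> differentiable_class k g ->
  differentiable_class k (fun x => f x * g x).
Proof.
elim: k f g => [|k IH] f g; first by move=> cf cg x; apply: cvgM; [exact: cf|exact: cg].
move=> hf hg; have hf' := dcW hf; have hg' := dcW hg; case: hf hg => cf df [cg dg].
split=> [x|v]; first by apply: cvgM; [exact: cf|exact: cg].
have [f1 f2] := df v; have [g1 g2] := dg v.
split=> [x|]; first exact: derivableM.
have -> : (fun x => 'D_v (fun y => f y * g y) x) =
    fun x => f x * 'D_v g x + g x * 'D_v f x.
  by apply/funext => x; rewrite [LHS]deriveM.
by apply: dcD; exact: IH.
Qed.

Lemma dcZ W k (c : R) (f : W -> R) : differentiable_class k f ->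
  differentiable_class k (fun x => c * f x).
Proof. by apply: dcM; exact: dc_cst. Qed.

(** Along each line the difference quotients of f \o l are those of f. *)
Lemma derive_affine W W' (f : W -> R) (l L : W' -> W) :
  (forall x v (h : R), l (h *: v + x) = h *: L v + l x) -> forall x v,
  (derivable f (l x) (L v) -> derivable (f \o l) x v) /\
  'D_v (f \o l) x = 'D_(L v) f (l x).
Proof.
move=> lL x v.
have e : (fun h => h^-1 *: (((f \o l) \o shift x) (h *: v) - (f \o l) x)) =
         (fun h => h^-1 *: ((f \o shift (l x)) (h *: L v) - f (l x))).
  by apply/funext => h /=; rewrite lL.
by split; [rewrite /derivable e|rewrite /derive e].
Qed.

Lemma dc_affine W W' k (f : W -> R) (l L : W' -> W) : continuous l ->
  (forall x v (h : R), l (h *: v + x) = h *: L v + l x) ->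
  differentiable_class k f -> differentiable_class k (f \o l).
Proof.
move=> cl lL; elim: k f => [|k IH] f.
  by move=> cf x; apply: continuous_comp; [exact: cl|exact: cf].
move=> [cf df]; split=> [x|v].
  by apply: continuous_comp; [exact: cl|exact: cf].
have [f1 f2] := df (L v); split=> [x|].
  by apply: (derive_affine f lL x v).1; exact: f1.
have -> : (fun x => 'D_v (f \o l) x) = (fun x => 'D_(L v) f x) \o l.
  by apply/funext => x; rewrite /= (derive_affine f lL x v).2.
exact: IH.
Qed.

Lemma dc_linear W k (f : W -> R) : continuous f ->
  (forall x v (h : R), f (h *: v + x) = h * f v + f x) -> differentiable_class k f.
Proof.
move=> cf fL.
have e x v : (fun h => h^-1 *: ((f \o shift x) (h *: v) - f x)) @ 0^' --> f v.
  have c0 : (fun _ : R => f v) @ 0^' --> f v by exact: cvg_cst.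
  apply: cvg_trans c0; apply: near_eq_cvg.
  near=> h; rewrite /= fL addrK scalerA mulVf ?scale1r//.
  by near: h; exact: nbhs_dnbhs_neq.
case: k => // k; split=> // v; split=> [x|].
  by apply/cvg_ex; exists (f v); exact: e.
have -> : (fun x => 'D_v f x) = fun=> f v.
  by apply/funext => x; apply: cvg_lim => //; exact: e.
exact: dc_cst.
Unshelve. all: by end_near. Qed.

Lemma smooth_continuous W (f : W -> R) : smooth f -> continuous f.
Proof. by move=> /(_ 0%N). Qed.

Lemma smooth_derivable W (f : W -> R) x v : smooth f -> derivable f x v.
Proof. by move=> /(_ 1%N)[_ /(_ v)[]]. Qed.

Lemma smooth_derive W (f : W -> R) v : smooth f -> smooth (fun x => 'D_v f x).
Proof. by move=> sf k; have [_ /(_ v)[]] := sf k.+1. Qed.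

Lemma smooth_cst W (c : R) : smooth (fun _ : W => c).
Proof. by move=> k; exact: dc_cst. Qed.

Lemma smoothD W (f g : W -> R) : smooth f -> smooth g -> smooth (fun x => f x + g x).
Proof. by move=> sf sg k; apply: dcD. Qed.

Lemma smoothM W (f g : W -> R) : smooth f -> smooth g -> smooth (fun x => f x * g x).
Proof. by move=> sf sg k; apply: dcM. Qed.

Lemma smoothZ W (c : R) (f : W -> R) : smooth f -> smooth (fun x => c * f x).
Proof. by move=> sf k; apply: dcZ. Qed.

Lemma smoothN W (f : W -> R) : smooth f -> smooth (fun x => - f x).
Proof.
by move=> sf; rewrite (_ : (fun x => _) = fun x => -1 * f x); [exact: smoothZ|
  apply/funext => x; rewrite mulN1r].
Qed.

Lemma smoothB W (f g : W -> R) : smooth f -> smooth g -> smooth (fun x => f x - g x).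
Proof. by move=> sf sg; apply: smoothD => //; exact: smoothN. Qed.

Lemma smooth_sum W (I : Type) (s : seq I) (f : I -> W -> R) :
  (forall i, smooth (f i)) -> smooth (fun x => \sum_(i <- s) f i x).
Proof.
move=> sf; elim: s => [|i s IH].
  by under eq_fun do rewrite big_nil; exact: smooth_cst.
by under eq_fun do rewrite big_cons; exact: smoothD.
Qed.

Lemma smooth_prod W (I : Type) (s : seq I) (f : I -> W -> R) :
  (forall i, smooth (f i)) -> smooth (fun x => \prod_(i <- s) f i x).
Proof.
move=> sf; elim: s => [|i s IH].
  by under eq_fun do rewrite big_nil; exact: smooth_cst.
by under eq_fun do rewrite big_cons; exact: smoothM.
Qed.

Lemma smooth_affine W W' (f : W -> R) (l L : W' -> W) : continuous l ->
  (forall x v (h : R), l (h *: v + x) = h *: L v + l x) -> smooth f -> smooth (f \o l).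
Proof. by move=> cl lL sf k; exact: dc_affine. Qed.

Lemma smooth_coord n (i : 'I_n) : smooth (fun x : 'rV[R]_n => x ord0 i).
Proof.
by move=> k; apply: dc_linear; [exact: coord_continuous|move=> x v h; rewrite !mxE].
Qed.

End SmoothAlgebra.

Section Supports.
Context {R : realType} {W : normedModType R}.

Lemma tsupport0 (V : zmodType) (f : W -> V) x : ~ tsupport f x -> f x = 0.
Proof.
move=> nx; apply/eqP/negP => /negP fx; apply: nx.
exact: subset_closure.
Qed.

Lemma tsupportS (V V' : zmodType) (f : W -> V) (g : W -> V') :
  (forall x, f x = 0 -> g x = 0) -> tsupport g `<=` tsupport f.
Proof.
by move=> h; apply: closureS => x /=; apply: contra_neq; exact: h.
Qed.

Lemma compact_tsupportS (V V' : zmodType) (f : W -> V) (g : W -> V') :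
  (forall x, f x = 0 -> g x = 0) -> compact (tsupport f) -> compact (tsupport g).
Proof.
move=> h cf; apply: subclosed_compact cf (tsupportS h).
exact: closed_closure.
Qed.

Lemma near_tsupport (V : zmodType) (f : W -> V) x : ~ tsupport f x ->
  \forall y \near x, f y = 0.
Proof.
move=> nx; have oC : open (~` tsupport f).
  by apply: closed_openC; exact: closed_closure.
by near=> y; apply: tsupport0; near: y; apply: open_nbhs_nbhs; split.
Unshelve. all: by end_near. Qed.

Lemma derive_tsupport0 (f : W -> R) x v : ~ tsupport f x -> 'D_v f x = 0.
Proof.
move=> nx; rewrite -(derive_cst (0 : R) x v); apply: near_eq_derive.
by have := near_tsupport nx; apply: filterS.
Qed.

Lemma tsupportD (V V' V'' : zmodType) (f : W -> V) (g : W -> V') (h : W -> V'') :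
  (forall x, f x = 0 -> g x = 0 -> h x = 0) ->
  tsupport h `<=` tsupport f `|` tsupport g.
Proof.
move=> fgh; rewrite /tsupport -closureU; apply: closureS => x /= hx.
have [f0|f0] := eqVneq (f x) 0; last by left.
by right; apply: contra_neq hx => g0; exact: fgh.
Qed.

Lemma compact_tsupportD (V V' V'' : zmodType) (f : W -> V) (g : W -> V') (h : W -> V'') :
  (forall x, f x = 0 -> g x = 0 -> h x = 0) -> compact (tsupport f) ->
  compact (tsupport g) -> compact (tsupport h).
Proof.
move=> fgh cf cg; apply: subclosed_compact (compactU cf cg) (tsupportD fgh).
exact: closed_closure.
Qed.

End Supports.

(** * A smooth step function *)

Section FlatFunction.
Context {R : realType}.

Lemma dc_derive1 (f : R -> R) (df : R -> R) (k : nat) :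
  (forall x : R, is_derive x (1 : R) f (df x)) -> differentiable_class k df ->
  differentiable_class k.+1 f.
Proof.
move=> fd cdf.
have dif x : differentiable f x.
  by apply/derivable1_diffP; have [] := fd x.
split=> [x|v].
  exact: differentiable_continuous.
split=> [x|].
  exact: diff_derivable.
have -> : (fun x => 'D_v f x) = fun x => v * df x; last exact: dcZ.
apply/funext => x; have [_ <-] := fd x.
by rewrite !deriveE// -[v in LHS]mulr1 linearZ.
Qed.

(** The functions t^-k exp (- 1 / t), extended by 0; they are closed under
    differentiation up to linear combinations. *)
Definition flat (k : nat) (t : R) : R :=
  if 0 < t then t^-1 ^+ k * expR (- t^-1) else 0.

Lemma flat_ge0 k t : 0 <= flat k t.
Proof.
rewrite /flat; case: ifPn => // t0.
by rewrite mulr_ge0 ?expR_ge0// exprn_ge0// invr_ge0 ltW.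
Qed.

Lemma expR_pow_bound (N : nat) (y : R) : 0 <= y ->
  y ^+ N.+1 * expR (- y) <= N.+1%:R ^+ N.+1.
Proof.
move=> y0; have N0 : (0 : R) < N.+1%:R by rewrite ltr0n.
have h : y <= N.+1%:R * expR (y / N.+1%:R).
  rewrite mulrC -ler_pdivrMr//.
  by apply: le_trans (expR_ge1Dx _); rewrite lerDr.
rewrite expRN ler_pdivrMr ?expR_gt0//.
have -> : expR y = expR (y / N.+1%:R) ^+ N.+1.
  by rewrite -expRM_natl mulrC divfK// gt_eqF.
by rewrite -exprMn lerXn2r// nnegrE ?mulr_ge0 ?expR_ge0 ?ltW.
Qed.

(** The quadratic bound at 0 that makes [flat] differentiable there. *)
Lemma flat_le k t : flat k t <= k.+2%:R ^+ k.+2 * t ^+ 2.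
Proof.
rewrite /flat; case: ifPn => t0; last by rewrite mulr_ge0 ?sqr_ge0 ?exprn_ge0.
have y0 : 0 <= t^-1 by rewrite invr_ge0 ltW.
have := expR_pow_bound k.+1 y0.
have -> : t^-1 ^+ k * expR (- t^-1) = t^-1 ^+ k.+2 * expR (- t^-1) * t ^+ 2.
  by rewrite -addn2 exprD; field; rewrite gt_eqF.
by rewrite ler_pM2r// exprn_gt0.
Qed.

Lemma is_derive_flat k (t : R) :
  is_derive t (1 : R) (flat k) (- k%:R * flat k.+1 t + flat k.+2 t).
Proof.
have [t0|t0|->] := ltgtP t 0.
- have e : \near t, cst 0 t = flat k t.
    near=> x; rewrite /flat ifF//; apply/negbTE; rewrite -leNgt ltW//.
    by near: x; exact: lt_nbhsl.
  rewrite /flat !(lt_gtF t0) mulr0 addr0.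
  exact: near_eq_is_derive e (is_derive_cst _ _ _).
- have e : \near t, t^-1 ^+ k * expR (- t^-1) = flat k t.
    near=> x; rewrite /flat ifT//.
    by near: x; exact: lt_nbhsr.
  apply: (near_eq_is_derive (f := fun x : R => x^-1 ^+ k * expR (- x^-1)) e).
  have d1 : is_derive t (1 : R) (fun x : R => x^-1) (- t ^- 2 *: 1).
    by apply: is_deriveV; rewrite gt_eqF.
  have d2 := is_derive1_comp (is_derive_expR _) (is_deriveN d1).
  have -> : (fun x : R => x^-1 ^+ k * expR (- x^-1)) =
      ((fun x : R => x^-1) ^+ k * (expR \o (- (fun x : R => x^-1)))).
    by apply/funext => x; rewrite !fctE.
  apply: (is_derive_eq (is_deriveM (is_deriveX k d1) d2)).
  rewrite /flat !t0 !fctE /GRing.scale /=; set E := expR _.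
  by case: k {e} => [|k]; rewrite /= ?exprS ?expr0; field; rewrite gt_eqF.
- have h0 : (fun h => h^-1 *: ((flat k \o shift 0) (h *: 1) - flat k 0)) @ (0 : R)^' --> (0 : R).
    apply/cvgrPdist_le => e e0; set C : R := k.+2%:R ^+ k.+2.
    have C0 : 0 <= C by rewrite exprn_ge0.
    have C1 : 0 < C + 1 by lra.
    have near_hl : \forall h \near (0 : R)^', `|h| <= e / (C + 1).
      apply: cvg_within; near=> x; rewrite -[x]subr0 distrC.
      near: x; apply: cvgr_dist_le; [exact: cvg_id|exact: divr_gt0].
    near=> h; have hn : h != 0 by near: h; exact: nbhs_dnbhs_neq.
    have hl : `|h| <= e / (C + 1) by near: h.
    rewrite ler_pdivlMr// in hl.
    rewrite /= addr0 /GRing.scale /= mulr1 {2}/flat ltxx subr0 sub0r normrN normrM.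
    rewrite normfV ler_pdivrMl ?normr_gt0// (ger0_norm (flat_ge0 _ _)).
    apply: le_trans (flat_le k h) _; rewrite -/C -real_normK ?num_real// expr2.
    rewrite mulrA mulrC ler_wpM2l//; have := normr_ge0 h; lra.
  have z : - k%:R * flat k.+1 0 + flat k.+2 0 = 0.
    by rewrite /flat ltxx mulr0 addr0.
  rewrite z; apply: DeriveDef; first by apply/cvg_ex; exists 0.
  exact: cvg_lim h0.
Unshelve. all: by end_near. Qed.

Lemma smooth_flat k : smooth (flat k).
Proof.
move=> N; elim: N k => [|N IH] k.
  move=> t; apply: differentiable_continuous; apply/derivable1_diffP.
  by have [] := is_derive_flat k t.
apply: (dc_derive1 (fun x => is_derive_flat k x)).
by apply: dcD => //; apply: dcZ.
Qed.

(** A smooth function that is positive exactly on the positive reals. *)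
Definition step (t : R) : R := flat 0 t.

Lemma smooth_step : smooth step.
Proof. exact: smooth_flat. Qed.

Lemma step_gt0 t : (0 < step t) = (0 < t).
Proof.
rewrite /step /flat; case: ifPn => [t0|_]; last by rewrite ltxx.
by rewrite expr0 mul1r expR_gt0.
Qed.

Lemma step_ge0 t : 0 <= step t. Proof. exact: flat_ge0. Qed.

Lemma step_eq0 t : t <= 0 -> step t = 0.
Proof. by move=> t0; rewrite /step /flat ifF// ltNge t0. Qed.

Lemma step_le1 t : step t <= 1.
Proof.
rewrite /step /flat; case: ifPn => // t0.
by rewrite expr0 mul1r expR_le1 oppr_le0 invr_ge0 ltW.
Qed.

Lemma step_ge t : 0 < t -> 1 - t^-1 <= step t.
Proof.
move=> t0; rewrite /step /flat t0 expr0 mul1r.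
exact: expR_ge1Dx.
Qed.

End FlatFunction.

(** * Topology and integration in R^n *)

Section RowTopology.
Context {R : realType}.

Lemma cvg_row n (T : Type) (F : set_system T) {FF : Filter F} (f : T -> 'rV[R]_n)
  (x : 'rV[R]_n) :
  (forall i, f t ord0 i @[t --> F] --> x ord0 i) -> f @ F --> x.
Proof.
move=> h A [P Px PA].
have : \forall t \near F, forall i : 'I_n, P ord0 i (f t ord0 i).
  apply: filter_forall => i; exact: (h i _ (Px ord0 i)).
by apply: filterS => t Pt; apply: PA => i j; rewrite (ord1 i).
Qed.

Lemma rV_ball_measurable n (x : 'rV[R]_n) (e : R) : measurable (ball x e).
Proof.
have [e0|e0] := ltP 0 e; last first.
  rewrite (_ : ball x e = set0) //; apply/seteqP; split=> // y [].
  by move=> /lt_le_trans/(_ e0); rewrite ltxx.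
rewrite (_ : ball x e = \bigcap_(i in [set: 'I_n]) (@rV_coord R n i @^-1` ball (x ord0 i) e)).
  apply: fin_bigcap_measurable => // i _.
  rewrite -[X in measurable X]setTI; apply: measurable_rV_coord => //.
  by apply: open_measurable; exact: ball_open.
apply/seteqP; split => [y [_ h] i _|y h]; first exact: h.
by split=> // i j; rewrite (ord1 i); exact: h.
Qed.

Lemma ratr_close (x e : R) : 0 < e -> exists q : rat, `|x - ratr q| < e.
Proof.
move=> e0; have [|q] := @rat_in_itvoo R (x - e) (x + e); first by lra.
by rewrite in_itv /= => /andP[h1 h2]; exists q; rewrite ltr_norml; lra.
Qed.

(** R^n is second countable; the balls of twice the radius, which still lie in
    A, leave room for compact supports. *)
Lemma open_rational_balls n (A : set 'rV[R]_n) : open A -> forall x, A x ->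
  exists (q : 'rV[rat]_n) (k : nat),
    ball (map_mx ratr q : 'rV[R]_n) (k.+1%:R^-1) x /\
    ball (map_mx ratr q : 'rV[R]_n) (k.+1%:R^-1 + k.+1%:R^-1) `<=` A.
Proof.
move=> oA x Ax; have /nbhs_ballP[e /= e0 eA] := open_nbhs_nbhs (conj oA Ax).
have e3 : 0 < e / 3 by rewrite divr_gt0.
have [k hk] := inv_succ_small e3; have {}hk := hk k (leqnn k).
have k0 : (0 : R) < k.+1%:R^-1 by rewrite invr_gt0.
have hq (i : 'I_n) : exists q : rat, `|x ord0 i - ratr q| < k.+1%:R^-1.
  exact: ratr_close.
have [q qP] := choice hq; exists (\row_i q i), k; split.
  by split=> // i j; rewrite (ord1 i) /ball /= !mxE distrC.
move=> y [_ hy]; apply: eA; split=> // i j; rewrite (ord1 i) /ball /=.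
have := hy ord0 j; rewrite /ball /= !mxE.
have := qP j; move: hk; set c := k.+1%:R^-1 => hk h1 h2.
rewrite -[x ord0 j](subrK (ratr (q j))) -addrA.
by apply: le_lt_trans (ler_normD _ _) _; lra.
Qed.

Lemma open_measurable_rV n (A : set 'rV[R]_n) : open A -> measurable A.
Proof.
move=> oA.
pose F (qk : 'rV[rat]_n * nat) : set 'rV[R]_n :=
  [set x | ball (map_mx ratr qk.1 : 'rV[R]_n) (qk.2.+1%:R^-1) x /\
    ball (map_mx ratr qk.1 : 'rV[R]_n) (qk.2.+1%:R^-1 + qk.2.+1%:R^-1) `<=` A].
rewrite (_ : A = \bigcup_qk F qk).
  apply: countable_bigcupT_measurable; first exact: countableP.
  move=> [q k]; rewrite /F /=.
  have [s|s] := pselect (ball (map_mx ratr q : 'rV[R]_n) (k.+1%:R^-1 + k.+1%:R^-1) `<=` A).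
    rewrite (_ : [set x | _] = ball (map_mx ratr q : 'rV[R]_n) (k.+1%:R^-1)).
      exact: rV_ball_measurable.
    by apply/seteqP; split=> [x []|].
  rewrite (_ : [set x | _] = set0) //.
  by apply/seteqP; split=> [x []|].
apply/seteqP; split => [x Ax|x [[q k] _ [/= h1 h2]]].
  by have [q [k h]] := open_rational_balls oA Ax; exists (q, k).
apply: h2; apply: le_ball h1; rewrite lerDl invr_ge0//.
Qed.

Lemma continuous_measurable_rV n (f : 'rV[R]_n -> R) : continuous f ->
  measurable_fun setT f.
Proof.
move=> /continuousP cf.
apply: (measurability _ (RGenOpens.measurableE R)) => _ [_ [a [b ->] <-]].
rewrite setTI; apply: open_measurable_rV; apply: cf.
exact: interval_open.
Qed.

End RowTopology.

Section CompactlySupported.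
Context {R : realType}.
Implicit Types (n : nat) (M : R).

Local Notation mu n := (lebesgue_rV R n).

Definition box n M : set 'rV[R]_n := [set x | forall i, `|x ord0 i| <= M].

(** A class of integrands for which integrability is automatic. *)
Definition Cc n (f : 'rV[R]_n -> R) :=
  continuous f /\ exists M, forall x, ~ box M x -> f x = 0.

Lemma boxS n M M' : M <= M' -> @box n M `<=` box M'.
Proof. by move=> MM x xM i; exact: le_trans (xM i) MM. Qed.

Lemma box_compact n M : compact (@box n M).
Proof.
rewrite (_ : box M = [set v | forall i, `[- M, M]%classic (v ord0 i)]).
  by apply: (@rV_compact _ _ (fun=> `[- M, M]%classic)) => i; exact: segment_compact.
by apply/seteqP; split=> x h i; have := h i; rewrite /= in_itv /= ler_norml.
Qed.

Lemma measurable_box n M : measurable (@box n M).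
Proof.
have cb : closed (@box n M).
  by apply: compact_closed; [exact: norm_hausdorff|exact: box_compact].
rewrite -[box M]setCK; apply: measurableC; apply: open_measurable_rV.
exact: closed_openC.
Qed.

Lemma bounded_box n (A : set 'rV[R]_n) : bounded_set A -> exists M, A `<=` box M.
Proof.
move=> /pinfty_ex_gt0[M M0 AM]; exists M => x /AM xM i.
apply: le_trans xM; rewrite /Num.norm /= mx_normrE.
by rewrite (le_bigmax _ (fun ij : 'I_1 * 'I_n => `|x ij.1 ij.2|) (ord0, i)).
Qed.

Lemma compact_box n (A : set 'rV[R]_n) : compact A -> exists M, A `<=` box M.
Proof. by move=> /compact_bounded; exact: bounded_box. Qed.

Lemma cons_box n M a (y : 'rV[R]_n) :
  box M (rV_cons (a, y)) <-> `|a| <= M /\ box M y.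
Proof.
split=> [h|[aM yM] i].
  split; first by have := h ord0; rewrite /rV_cons mxE unlift_none.
  by move=> i; have := h (lift ord0 i); rewrite /rV_cons mxE liftK.
by rewrite /rV_cons mxE; case: unliftP => [j _|_] /=; [exact: yM|exact: aM].
Qed.

Lemma preimage_cons_box n M :
  @rV_cons R n @^-1` box M = `[- M, M]%classic `*` box M.
Proof.
apply/seteqP; split=> -[a y] /=.
  by move=> /cons_box[h1 h2]; split=> //=; rewrite in_itv /= -ler_norml.
by move=> []; rewrite in_itv /= -ler_norml => h1 h2; apply/cons_box.
Qed.

Lemma box_finite n M : (mu n (box M) < +oo)%E.
Proof.
elim: n => [|n IH]; first by rewrite /= diracE; case: (_ \in _); rewrite ltry.
change (pushforward (@lebesgue_measure R \x mu n) (@rV_cons R n) (box M) < +oo)%E.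
rewrite /pushforward preimage_cons_box product_measure1E//; last exact: measurable_box.
have fin : (lebesgue_measure (`[(- M)%R, M]%classic : set R) < +oo)%E.
  by rewrite lebesgue_measure_itv /=; case: ifP => _; rewrite ltry.
by apply: lte_mul_pinfty => //; rewrite ge0_fin_numE.
Qed.

Lemma Cc_cst0 n : Cc (fun _ : 'rV[R]_n => 0).
Proof. by split; [exact: cst_continuous|exists 0]. Qed.

Lemma Cc_cont n (f : 'rV[R]_n -> R) : Cc f -> continuous f.
Proof. by case. Qed.

Lemma CcMl n (f g : 'rV[R]_n -> R) : continuous g -> Cc f -> Cc (fun x => g x * f x).
Proof.
move=> cg [cf [M h]]; split; first by move=> x; exact: (cvgM (cg x) (cf x)).
by exists M => x /h ->; rewrite mulr0.
Qed.

Lemma CcD n (f g : 'rV[R]_n -> R) : Cc f -> Cc g -> Cc (fun x => f x + g x).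
Proof.
move=> [cf [M h]] [cg [M' h']]; split.
  by move=> x; exact: (cvgD (cf x) (cg x)).
exists (Num.max M M') => x xM; rewrite h ?h' ?addr0//.
  by apply: contra_not xM; apply: boxS; rewrite le_max lexx orbT.
by apply: contra_not xM; apply: boxS; rewrite le_max lexx.
Qed.

Lemma CcZ n (c : R) (f : 'rV[R]_n -> R) : Cc f -> Cc (fun x => c * f x).
Proof. by apply: CcMl; exact: cst_continuous. Qed.

Lemma Cc_sum n (I : Type) (s : seq I) (f : I -> 'rV[R]_n -> R) :
  (forall i, Cc (f i)) -> Cc (fun x => \sum_(i <- s) f i x).
Proof.
move=> sf; elim: s => [|i s IH].
  by under eq_fun do rewrite big_nil; exact: Cc_cst0.
by under eq_fun do rewrite big_cons; exact: CcD.
Qed.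

Lemma Cc_bounded n (f : 'rV[R]_n -> R) : Cc f -> exists2 B, 0 <= B & forall x, `|f x| <= B.
Proof.
move=> [cf [M h]].
have cfb : compact (f @` box M).
  by apply: continuous_compact; [exact: continuous_subspaceT|exact: box_compact].
have /pinfty_ex_gt0[B B0 fB] := compact_bounded cfb.
exists B; first exact: ltW.
move=> x; have [xM|/h ->] := pselect (box M x); last by rewrite normr0 ltW.
by apply: fB; exists x.
Qed.

Lemma Cc_integrable n (f : 'rV[R]_n -> R) D : Cc f -> measurable D ->
  (mu n).-integrable D (EFin \o f).
Proof.
move=> cf mD; apply: (@integrableS _ _ _ _ setT) => //.
have [B B0 fB] := Cc_bounded cf; case: cf => cf [M h].
have fE : EFin \o f = (EFin \o f) \_ (box M).
  apply/funext => x; rewrite patchE; case: ifPn => //; rewrite notin_setE => /h.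
  by move=> /= ->.
rewrite fE; apply/(integrable_mkcond _ (measurable_box M)).
apply: measurable_bounded_integrable; [exact: measurable_box|exact: box_finite| |].
  by apply: measurable_funTS; exact: continuous_measurable_rV.
by exists B; split; [exact: num_real|move=> r Br x _; exact: le_trans (fB x) (ltW Br)].
Qed.

End CompactlySupported.

(** * Integrals of partial derivatives *)

Section IntegralOfDerivative.
Context {R : realType}.

Local Notation mu n := (lebesgue_rV R n).
Local Notation leb := (@lebesgue_measure R).
Local Notation e_ i := (delta_mx ord0 i).

Lemma rV_cons_linear n (a a' h : R) (y y' : 'rV[R]_n) :
  rV_cons (h * a + a', h *: y + y') = h *: rV_cons (a, y) + rV_cons (a', y').
Proof.
by apply/rowP => i; rewrite /rV_cons !mxE; case: unliftP => [j _|_]; rewrite ?mxE.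
Qed.

Lemma rV_cons0_delta n (j : 'I_n) :
  rV_cons (0, e_ j : 'rV[R]_n) = e_ (lift ord0 j) :> 'rV[R]_n.+1.
Proof.
apply/rowP => i; rewrite /rV_cons !mxE; case: unliftP => [k ->|->].
  by rewrite !mxE (inj_eq (@lift_inj _ ord0)).
by rewrite (negbTE (neq_lift _ _)) andbF.
Qed.

Lemma rV_cons1_delta n : rV_cons (1, 0 : 'rV[R]_n) = e_ ord0 :> 'rV[R]_n.+1.
Proof.
apply/rowP => i; rewrite /rV_cons !mxE; case: unliftP => [k ->|->].
  by rewrite !mxE [lift _ _ == _]eq_sym (negbTE (neq_lift _ _)) andbF.
by rewrite !eqxx.
Qed.

Lemma cons_continuous_r n (a : R) : continuous (fun y : 'rV[R]_n => rV_cons (a, y)).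
Proof.
move=> y; apply: (@cvg_row _ _ _ (nbhs y) _ (fun y => rV_cons (a, y))) => i; rewrite /rV_cons mxE.
case: (unliftP ord0 i) => [j ->|->].
  by under [X in X @ _]eq_fun do rewrite mxE liftK; exact: coord_continuous.
by under [X in X @ _]eq_fun do rewrite mxE unlift_none; exact: cvg_cst.
Qed.

Lemma cons_continuous_l n (y : 'rV[R]_n) : continuous (fun a : R => rV_cons (a, y)).
Proof.
move=> a; apply: (@cvg_row _ _ _ (nbhs a) _ (fun a => rV_cons (a, y))) => i; rewrite /rV_cons mxE.
case: (unliftP ord0 i) => [j ->|->].
  by under [X in X @ _]eq_fun do rewrite mxE liftK; exact: cvg_cst.
by under [X in X @ _]eq_fun do rewrite mxE unlift_none; exact: cvg_id.
Qed.

Lemma Cc_slice n (f : 'rV[R]_n.+1 -> R) a : Cc f -> Cc (fun y => f (rV_cons (a, y))).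
Proof.
move=> [cf [M h]]; split.
  by move=> y; apply: continuous_comp; [exact: cons_continuous_r|exact: cf].
by exists M => y yM; apply: h => /cons_box[].
Qed.

Lemma Cc_cons_integrable n (f : 'rV[R]_n.+1 -> R) : Cc f ->
  (leb \x mu n)%E.-integrable setT (EFin \o f \o @rV_cons R n).
Proof.
move=> cf; have [B B0 fB] := Cc_bounded cf; have cf' := Cc_cont cf.
case: cf => _ [M h].
have mb : measurable (@rV_cons R n @^-1` box M).
  rewrite -[X in measurable X]setTI.
  by apply: measurable_rV_cons => //; exact: measurable_box.
have -> : EFin \o f \o @rV_cons R n =
    (EFin \o f \o @rV_cons R n) \_ (@rV_cons R n @^-1` box M).
  apply/funext => x; rewrite patchE; case: ifPn => //; rewrite notin_setE => /h.
  by move=> /= ->.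
apply/(integrable_mkcond _ mb); apply: measurable_bounded_integrable => //.
- exact: (@box_finite R n.+1 M).
- apply: measurable_funTS; apply: measurableT_comp; last exact: measurable_rV_cons.
  exact: continuous_measurable_rV.
- by exists B; split; [exact: num_real|move=> r Br x _; exact: le_trans (fB _) (ltW Br)].
Qed.

Lemma integral_cons n (f : 'rV[R]_n.+1 -> R) : Cc f ->
  (\int[mu n.+1]_x (f x)%:E = \int[leb \x mu n]_p (f (rV_cons p))%:E)%E.
Proof.
move=> cf.
have h := @integral_pushforward _ _ _ _ R (@rV_cons R n) (@measurable_rV_cons R n)
  (leb \x mu n)%E setT (EFin \o f) _ _ measurableT.
rewrite preimage_setT in h; apply: h; last exact: Cc_cons_integrable.
by apply/measurable_EFinP; apply: continuous_measurable_rV; exact: Cc_cont.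
Qed.

Lemma Rintegral_cons12 n (f : 'rV[R]_n.+1 -> R) : Cc f ->
  \int[mu n.+1]_x f x = \int[leb]_a \int[mu n]_y f (rV_cons (a, y)).
Proof.
move=> cf; rewrite /Rintegral integral_cons//.
rewrite -(integral12_prod_meas1 (Cc_cons_integrable cf)); congr fine.
apply: eq_integral => a _; rewrite /fubini_F /= fineK//.
by apply: integrable_fin_num => //; exact: Cc_integrable (Cc_slice _ cf) _.
Qed.

Lemma itv_finite (M N : R) : (lebesgue_measure (`[M, N]%classic : set R) < +oo)%E.
Proof. by rewrite lebesgue_measure_itv /=; case: ifP => _; rewrite ?ltry. Qed.

Lemma slice_integrable n (f : 'rV[R]_n.+1 -> R) (y : 'rV[R]_n) : Cc f ->
  leb.-integrable setT (fun a => (f (rV_cons (a, y)))%:E).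
Proof.
move=> cf; have [B B0 fB] := Cc_bounded cf; case: cf => cf [M h].
have mi : measurable (`[- M, M]%classic : set (measurableTypeR R)).
  exact: measurable_itv.
have -> : (fun a => (f (rV_cons (a, y)))%:E) =
    (fun a => (f (rV_cons (a, y)))%:E) \_ (`[- M, M]%classic : set R).
  apply/funext => a; rewrite patchE; case: ifPn => //; rewrite notin_setE => na.
  rewrite h// => /cons_box[aM _]; apply: na.
  by rewrite /= in_itv /= -ler_norml.
apply/(@integrable_mkcond _ _ _ leb _ (fun a => (f (rV_cons (a, y)))%:E) mi); apply: measurable_bounded_integrable => //.
- exact: (itv_finite (- M) M).
- apply: measurable_funTS; apply: continuous_measurable_fun => a.
  by apply: continuous_comp; [exact: cons_continuous_l|exact: cf].
- by exists B; split; [exact: num_real|move=> r Br x _; exact: le_trans (fB _) (ltW Br)].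
Qed.

Lemma Rintegral_cons21 n (f : 'rV[R]_n.+1 -> R) : Cc f ->
  \int[mu n.+1]_x f x = \int[mu n]_y \int[leb]_a f (rV_cons (a, y)).
Proof.
move=> cf; rewrite /Rintegral integral_cons//.
rewrite -(integral21_prod_meas1 (Cc_cons_integrable cf)); congr fine.
apply: eq_integral => y _; rewrite /fubini_G /= fineK//.
by apply: integrable_fin_num => //; exact: slice_integrable.
Qed.

(** The fundamental theorem of calculus on an interval containing the support. *)
Lemma Rintegral_derive1_0 (g g' : R -> R) (M : R) :
  (forall a : R, is_derive a (1 : R) g (g' a)) -> continuous g' ->
  (forall a, M < `|a| -> g a = 0) -> \int[leb]_a g' a = 0.
Proof.
move=> gd cg' g0; pose N := `|M| + 1.
have N0 : 0 < N by rewrite ltr_wpDl.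
have MN a : N <= `|a| -> M < `|a|.
  by apply: lt_le_trans; rewrite (le_lt_trans (ler_norm _))// ltrDl.
have g'0 a : N < `|a| -> g' a = 0.
  move=> aN; have d0 : is_derive a (1 : R) g 0.
    apply: (near_eq_is_derive (f := cst 0)).
    have : \forall x \near a, N < `|x|.
      have : `|x| @[x --> a] --> `|a| by apply: cvg_norm; exact: cvg_id.
      by move/cvgrPdist_lt => /(_ (`|a| - N)); rewrite subr_gt0 => /(_ aN);
        apply: filterS => x; rewrite ltr_norml => /andP[_]; lra.
    by apply: filterS => x /ltW/MN/g0.
  by rewrite -(@derive_val _ _ _ _ _ _ _ (gd a)) (@derive_val _ _ _ _ _ _ _ d0).
have cont : continuous g.
  move=> a; apply: differentiable_continuous; apply/derivable1_diffP.
  by have [] := gd a.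
rewrite (_ : g' = g' \_ (`[- N, N]%classic : set R)); last first.
  apply/funext => a; rewrite patchE; case: ifPn => //; rewrite notin_setE => na.
  apply: g'0; rewrite ltNge; apply/negP => aN; apply: na.
  by rewrite /= in_itv /= -ler_norml.
rewrite -Rintegral_mkcond /Rintegral (@continuous_FTC2 _ g' g (- N) N).
- rewrite !g0 ?subee//.
    by apply: MN; rewrite normrN ger0_norm ?(ltW N0).
  by apply: MN; rewrite ger0_norm ?(ltW N0).
- lra.
- by apply: continuous_subspaceT.
- split.
  + by move=> a _; have [] := gd a.
  + by apply: cvg_at_right_filter; exact: cont.
  + by apply: cvg_at_left_filter; exact: cont.
- by move=> a _; rewrite derive1E (@derive_val _ _ _ _ _ _ _ (gd a)).
Qed.

(** Fubini's theorem reduces this to the one-dimensional statement. *)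
Lemma Rintegral_partial0 n (i : 'I_n) (f : 'rV[R]_n -> R) :
  Cc f -> Cc (fun x => 'D_(e_ i) f x) -> (forall x, derivable f x (e_ i)) ->
  \int[mu n]_x 'D_(e_ i) f x = 0.
Proof.
elim: n i f => [[]//|n IH] i f cf cD df.
have lL a : forall x v h, rV_cons (a, h *: v + x) = h *: rV_cons (0, v) + rV_cons (a, x) :> 'rV[R]_n.+1.
  by move=> x v h; rewrite -rV_cons_linear mulr0 add0r.
have lL' (y : 'rV[R]_n) : forall x v h : R, rV_cons (h *: v + x, y) = h *: rV_cons (v, 0) + rV_cons (x, y).
  by move=> x v h; rewrite -rV_cons_linear scaler0 add0r.
case: (unliftP ord0 i) => [j ij|i0].
  rewrite Rintegral_cons12// (_ : (fun a => _) = fun=> 0).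
    by rewrite /Rintegral integral0.
  apply/funext => a; rewrite -[RHS](IH j (fun y => f (rV_cons (a, y)))).
  - apply: eq_Rintegral => y _.
    have [_] := derive_affine f (lL a) y (e_ j).
    by rewrite rV_cons0_delta -ij => ->.
  - exact: Cc_slice.
  - rewrite (_ : (fun y => _) = fun y => 'D_(e_ i) f (rV_cons (a, y))).
      exact: (Cc_slice a cD).
    apply/funext => y; have [_] := derive_affine f (lL a) y (e_ j).
    by rewrite rV_cons0_delta -ij.
  - move=> y; have [+ _] := derive_affine f (lL a) y (e_ j).
    by rewrite rV_cons0_delta -ij; apply; exact: df.
rewrite Rintegral_cons21// (_ : (fun y => _) = fun=> 0).
  by rewrite /Rintegral integral0.
apply/funext => y; have [_ [M h]] := cf.
apply: (@Rintegral_derive1_0 (fun a => f (rV_cons (a, y))) _ M).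
- move=> a; have [h1 h2] := derive_affine f (lL' y) a (1 : R).
  rewrite rV_cons1_delta -i0 in h1 h2.
  by apply: DeriveDef => //; apply: h1; exact: df.
- move=> a; apply: (@continuous_comp _ _ _ (fun a : R => rV_cons (a, y))
    (fun x => 'D_(e_ i) f x)); first exact: cons_continuous_l.
  exact: (Cc_cont cD).
- by move=> a aM; apply: h => /cons_box[]; rewrite leNgt aM.
Qed.

End IntegralOfDerivative.

(** * Test functions and the form of H_D *)

Section ComplexIntegral.
Context {R : realType} {d : measure_display} {T : measurableType d}.
Variables (mu : {measure set T -> \bar R}) (D : set T).
Hypothesis mD : measurable D.

Definition rintegrable (f : T -> R) := mu.-integrable D (EFin \o f).

Definition cintegrable (f : T -> R[i]) :=
  rintegrable (fun x => complex.Re (f x)) /\ rintegrable (fun x => complex.Im (f x)).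

Lemma eq_rintegrable (f g : T -> R) : (forall x, D x -> f x = g x) ->
  rintegrable f -> rintegrable g.
Proof.
by move=> fg; apply: eq_integrable => // x; rewrite inE => /fg /= ->.
Qed.

Lemma rintegrableD (f g : T -> R) : rintegrable f -> rintegrable g ->
  rintegrable (fun x => f x + g x).
Proof. by move=> fi gi; exact: (integrableD mD fi gi). Qed.

Lemma rintegrableZ (c : R) (f : T -> R) : rintegrable f -> rintegrable (fun x => c * f x).
Proof. by move=> fi; exact: (integrableZl mD c fi). Qed.

Lemma eq_cintegral (f g : T -> R[i]) : (forall x, D x -> f x = g x) ->
  cintegral mu D f = cintegral mu D g.
Proof.
by move=> fg; rewrite /cintegral; congr (_ +i* _); apply: eq_Rintegral => x;
  rewrite inE => /fg ->.
Qed.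

Lemma eq_cintegrable (f g : T -> R[i]) : (forall x, D x -> f x = g x) ->
  cintegrable f -> cintegrable g.
Proof.
by move=> fg [h1 h2]; split; [apply: eq_rintegrable h1|apply: eq_rintegrable h2];
  move=> x /fg ->.
Qed.

Lemma cintegral_linear a (f g : T -> R[i]) : cintegrable f -> cintegrable g ->
  cintegral mu D (fun x => a * f x + g x) = a * cintegral mu D f + cintegral mu D g.
Proof.
case: a => a b [f1 f2] [g1 g2]; rewrite /cintegral.
set F1 := \int[mu]_(x in D) complex.Re (f x); set F2 := \int[mu]_(x in D) complex.Im (f x).
set G1 := \int[mu]_(x in D) complex.Re (g x); set G2 := \int[mu]_(x in D) complex.Im (g x).
apply/eqP; rewrite eq_complex /=; apply/andP; split; apply/eqP.
  transitivity (\int[mu]_(x in D) (a * complex.Re (f x) + - b * complex.Im (f x) + complex.Re (g x))).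
    by apply: eq_Rintegral => x _; case: (f x) (g x) => [? ?] [? ?] /=; ring.
  rewrite RintegralD//; last exact: rintegrableD (rintegrableZ a f1) (rintegrableZ (- b) f2).
  rewrite RintegralD//; [|exact: rintegrableZ|exact: rintegrableZ].
  by rewrite !RintegralZl// -/F1 -/F2 -/G1; ring.
transitivity (\int[mu]_(x in D) (a * complex.Im (f x) + b * complex.Re (f x) + complex.Im (g x))).
  by apply: eq_Rintegral => x _; case: (f x) (g x) => [? ?] [? ?] /=; ring.
rewrite RintegralD//; last exact: rintegrableD (rintegrableZ a f2) (rintegrableZ b f1).
rewrite RintegralD//; [|exact: rintegrableZ|exact: rintegrableZ].
by rewrite !RintegralZl// -/F1 -/F2 -/G2; ring.
Qed.

Lemma cintegral_conj (f : T -> R[i]) : cintegrable f ->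
  cintegral mu D (fun x => (f x)^*) = (cintegral mu D f)^*.
Proof.
move=> [f1 f2]; rewrite /cintegral; apply/eqP; rewrite eq_complex /=.
apply/andP; split; apply/eqP.
  by apply: eq_Rintegral => x _; case: (f x).
rewrite -mulN1r -RintegralZl//.
by apply: eq_Rintegral => x _; case: (f x) => ? ? /=; rewrite mulN1r.
Qed.

End ComplexIntegral.

Section TestFunctions.
Context {R : realType}.

Lemma csmooth_linear (W : normedModType R) a (u v : W -> R[i]) :
  csmooth u -> csmooth v -> csmooth (fun x => a * u x + v x).
Proof.
case: a => a b [u1 u2] [v1 v2]; split.
  have -> : (fun x => complex.Re ((a +i* b) * u x + v x)) =
      fun x => (a * complex.Re (u x) + - b * complex.Im (u x)) + complex.Re (v x).
    by apply/funext => x; case: (u x) (v x) => [? ?] [? ?] /=; ring.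
  by do 2?apply: smoothD => //; exact: smoothZ.
have -> : (fun x => complex.Im ((a +i* b) * u x + v x)) =
    fun x => (a * complex.Im (u x) + b * complex.Re (u x)) + complex.Im (v x).
  by apply/funext => x; case: (u x) (v x) => [? ?] [? ?] /=; ring.
by do 2?apply: smoothD => //; exact: smoothZ.
Qed.

Lemma test_fun0 (W : normedModType R) (U : set W) : test_fun U (fun=> 0).
Proof.
have t0 : tsupport (fun _ : W => 0 : R[i]) = set0.
  rewrite /tsupport (_ : [set x | _] = set0) ?closure0//.
  by apply/seteqP; split=> // x /=; rewrite eqxx.
split; [by split; exact: smooth_cst|rewrite t0; exact: compact0|by rewrite t0].
Qed.

Lemma test_fun_linear (W : normedModType R) (U : set W) a (u v : W -> R[i]) :
  test_fun U u -> test_fun U v -> test_fun U (fun x => a * u x + v x).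
Proof.
move=> [su cu tu] [sv cv tv].
have uv0 x : u x = 0 -> v x = 0 -> a * u x + v x = 0.
  by move=> -> ->; rewrite mulr0 addr0.
split; [exact: csmooth_linear|exact: compact_tsupportD uv0 cu cv|].
by move=> x /(tsupportD uv0)[/tu|/tv].
Qed.

Local Notation e_ i := (delta_mx ord0 i).

Definition bounded_support n (V : zmodType) (u : 'rV[R]_n -> V) :=
  exists M, forall x, ~ box M x -> u x = 0.

Lemma box_openC n M : open (~` @box R n M).
Proof.
apply: closed_openC; apply: compact_closed; last exact: box_compact.
exact: norm_hausdorff.
Qed.

Lemma derive_outside_box n (f : 'rV[R]_n -> R) M x v :
  (forall x, ~ box M x -> f x = 0) -> ~ box M x -> 'D_v f x = 0.
Proof.
move=> f0 xM; rewrite -(derive_cst (0 : R) x v); apply: near_eq_derive.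
have : \forall y \near x, (~` box M) y.
  by apply: open_nbhs_nbhs; split; [exact: box_openC|].
by apply: filterS => y /f0.
Qed.

Lemma Cc_smooth n (f : 'rV[R]_n -> R) : smooth f -> bounded_support f -> Cc f.
Proof. by move=> sf bf; split => //; exact: smooth_continuous. Qed.

Lemma Cc_derive n (f : 'rV[R]_n -> R) v : smooth f -> bounded_support f ->
  Cc (fun x => 'D_v f x).
Proof.
move=> sf [M f0]; split; first exact/smooth_continuous/smooth_derive.
by exists M => x; exact: derive_outside_box.
Qed.

Lemma test_bounded_support n (U : set 'rV[R]_n) (V : zmodType) (u : 'rV[R]_n -> V) :
  compact (tsupport u) -> bounded_support u.
Proof.
move=> /compact_box[M h]; exists M => x xM; apply: tsupport0.
by apply: contra_not xM; exact: h.
Qed.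

Lemma cdot_Re n (a b : 'rV[R[i]]_n) : complex.Re (cdot a b) =
  \sum_i (complex.Re (a ord0 i) * complex.Re (b ord0 i) +
          complex.Im (a ord0 i) * complex.Im (b ord0 i)).
Proof.
rewrite /cdot raddf_sum; apply: eq_bigr => i _.
by case: (a ord0 i) (b ord0 i) => [? ?] [? ?] /=; ring.
Qed.

Lemma cdot_Im n (a b : 'rV[R[i]]_n) : complex.Im (cdot a b) =
  \sum_i (complex.Im (a ord0 i) * complex.Re (b ord0 i) -
          complex.Re (a ord0 i) * complex.Im (b ord0 i)).
Proof.
rewrite /cdot raddf_sum; apply: eq_bigr => i _.
by case: (a ord0 i) (b ord0 i) => [? ?] [? ?] /=; ring.
Qed.

Lemma cdot_linear n c (a b e : 'rV[R[i]]_n) : cdot (c *: a + b) e = c * cdot a e + cdot b e.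
Proof.
rewrite /cdot mulr_sumr -big_split; apply: eq_bigr => i _.
by rewrite !mxE mulrDl mulrA.
Qed.

Lemma cdot_conj n (a b : 'rV[R[i]]_n) : (cdot a b)^* = cdot b a.
Proof.
rewrite /cdot rmorph_sum; apply: eq_bigr => i _.
by rewrite rmorphM /= conjCK mulrC.
Qed.

Lemma cdot_ge0 n (a : 'rV[R[i]]_n) : 0 <= complex.Re (cdot a a).
Proof.
by rewrite cdot_Re sumr_ge0// => i _; rewrite addr_ge0// -expr2 sqr_ge0.
Qed.

Lemma derive_lin3 (W : normedModType R) (f g h : W -> R) (a b : R) x v :
  smooth f -> smooth g -> smooth h ->
  'D_v (fun y => a * f y + b * g y + h y) x = a * 'D_v f x + b * 'D_v g x + 'D_v h x.
Proof.
move=> sf sg sh.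
have df := @smooth_derivable _ _ f x v sf.
have dg := @smooth_derivable _ _ g x v sg.
have dh := @smooth_derivable _ _ h x v sh.
have daf : derivable (fun y => a * f y) x v by exact: (@derivableZ _ _ _ _ a _ _ df).
have dbg : derivable (fun y => b * g y) x v by exact: (@derivableZ _ _ _ _ b _ _ dg).
transitivity ('D_v (fun y => a * f y + b * g y) x + 'D_v h x).
  by apply: deriveD => //; exact: derivableD.
congr (_ + _); transitivity ('D_v (fun y => a * f y) x + 'D_v (fun y => b * g y) x).
  exact: deriveD.
by congr (_ + _); [exact: (deriveZ a df)|exact: (deriveZ b dg)].
Qed.

Lemma grad_linear n a (u v : 'rV[R]_n -> R[i]) x : csmooth u -> csmooth v ->
  grad (fun y => a * u y + v y) x = a *: grad u x + grad v x.
Proof.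
case: a => a b [u1 u2] [v1 v2]; apply/rowP => i; rewrite !mxE.
have -> : (fun y => complex.Re ((a +i* b) * u y + v y)) =
    fun y => a * complex.Re (u y) + (- b) * complex.Im (u y) + complex.Re (v y).
  by apply/funext => y; case: (u y) (v y) => [? ?] [? ?] /=; ring.
have -> : (fun y => complex.Im ((a +i* b) * u y + v y)) =
    fun y => a * complex.Im (u y) + b * complex.Re (u y) + complex.Im (v y).
  by apply/funext => y; case: (u y) (v y) => [? ?] [? ?] /=; ring.
rewrite !derive_lin3//; apply/eqP; rewrite eq_complex /=.
by apply/andP; split; apply/eqP; ring.
Qed.

(** The integrand of the forms of H_D and, for a fixed time, of M. *)
Definition wgrad n (g : 'rV[R]_n -> R) (u v : 'rV[R]_n -> R[i]) (x : 'rV[R]_n) : R[i] :=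
  (g x)%:C * cdot (grad u x) (grad v x).

Lemma wgrad_linear n (g : 'rV[R]_n -> R) a u v w x : csmooth u -> csmooth v ->
  wgrad g (fun y => a * u y + v y) w x = a * wgrad g u w x + wgrad g v w x.
Proof. by move=> su sv; rewrite /wgrad grad_linear// cdot_linear; ring. Qed.

Lemma wgrad_conj n (g : 'rV[R]_n -> R) u v x : (wgrad g u v x)^* = wgrad g v u x.
Proof.
rewrite /wgrad rmorphM /= cdot_conj; congr (_ * _).
by apply/eqP; rewrite eq_complex /= ?oppr0 !eqxx.
Qed.

Lemma wgrad_Re n (g : 'rV[R]_n -> R) u v x :
  complex.Re (wgrad g u v x) = g x * complex.Re (cdot (grad u x) (grad v x)).
Proof. by rewrite /wgrad; case: (cdot _ _) => ? ? /=; ring. Qed.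

Lemma wgrad_Im n (g : 'rV[R]_n -> R) u v x :
  complex.Im (wgrad g u v x) = g x * complex.Im (cdot (grad u x) (grad v x)).
Proof. by rewrite /wgrad; case: (cdot _ _) => ? ? /=; ring. Qed.

Lemma bounded_support_ReIm n (u : 'rV[R]_n -> R[i]) : bounded_support u ->
  bounded_support (fun x => complex.Re (u x)) /\ bounded_support (fun x => complex.Im (u x)).
Proof. by move=> [M h]; split; exists M => x /h ->. Qed.

Lemma Cc_wgrad n (g : 'rV[R]_n -> R) (u v : 'rV[R]_n -> R[i]) :
  continuous g -> csmooth u -> csmooth v -> bounded_support u ->
  Cc (fun x => complex.Re (wgrad g u v x)) /\ Cc (fun x => complex.Im (wgrad g u v x)).
Proof.
move=> cg [u1 u2] [v1 v2] /bounded_support_ReIm[b1 b2].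
have c1 i := Cc_derive (e_ i) u1 b1; have c2 i := Cc_derive (e_ i) u2 b2.
have d1 i : continuous (fun x => 'D_(e_ i) (fun y => complex.Re (v y)) x).
  exact/smooth_continuous/smooth_derive.
have d2 i : continuous (fun x => 'D_(e_ i) (fun y => complex.Im (v y)) x).
  exact/smooth_continuous/smooth_derive.
split.
  under eq_fun do rewrite wgrad_Re cdot_Re; apply: CcMl => //; apply: Cc_sum => i.
  under eq_fun do rewrite !mxE /= mulrC [X in _ + X]mulrC.
  by apply: CcD; apply: CcMl.
under eq_fun do rewrite wgrad_Im cdot_Im; apply: CcMl => //; apply: Cc_sum => i.
have := CcD (CcMl (d1 i) (c2 i)) (CcZ (-1) (CcMl (d2 i) (c1 i))).
congr Cc; apply/funext => x; rewrite !mxE /=; ring.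
Qed.

Lemma Cc_wgrad_cintegrable n (g : 'rV[R]_n -> R) (u v : 'rV[R]_n -> R[i]) D :
  measurable D -> continuous g -> csmooth u -> csmooth v -> bounded_support u ->
  cintegrable (lebesgue_rV R n) D (wgrad g u v).
Proof.
move=> mD cg su sv bu; have [h1 h2] := Cc_wgrad cg su sv bu.
by split; exact: Cc_integrable.
Qed.

End TestFunctions.

Section FormHD.
Context {R : realType} {n : nat}.
Variables (Omega : set 'rV[R]_n) (sigma g : 'rV[R]_n -> R).
Hypothesis mO : measurable Omega.
Hypothesis sg : smooth g.
Hypothesis sigmaE : forall x, Omega x -> sigma x = g x.
Hypothesis sigma0 : forall x, Omega x -> 0 <= sigma x.

Lemma form_HDE u v : form_HD Omega sigma u v =
  cintegral (lebesgue_rV R n) Omega (wgrad g u v).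
Proof. by apply: eq_cintegral => x Ox; rewrite /wgrad sigmaE. Qed.

Lemma hermitian_form_HD : hermitian_form (test_fun Omega) (form_HD Omega sigma).
Proof.
have cg := smooth_continuous sg.
have ci u v : test_fun Omega u -> test_fun Omega v ->
    cintegrable (lebesgue_rV R n) Omega (wgrad g u v).
  move=> [su cu _] [sv _ _]; apply: Cc_wgrad_cintegrable => //.
  exact: (test_bounded_support Omega).
split.
- exact: test_fun0.
- exact: test_fun_linear.
- move=> a u v w tu tv tw; rewrite !form_HDE -cintegral_linear//; [|exact: ci|exact: ci].
  by apply: eq_cintegral => x _; rewrite wgrad_linear//; [case: tu|case: tv].
- move=> u v tu tv; rewrite !form_HDE -cintegral_conj//; last exact: ci.
  by apply: eq_cintegral => x _; rewrite wgrad_conj.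
- move=> u tu; rewrite form_HDE /cintegral /=; apply: Rintegral_ge0 => x Ox.
  by rewrite wgrad_Re mulr_ge0 ?cdot_ge0// -sigmaE// sigma0.
Qed.

End FormHD.

(** * The Poincare inequality and Green's formula *)

Section IntegrationByParts.
Context {R : realType}.

Local Notation mu n := (lebesgue_rV R n).
Local Notation e_ i := (delta_mx ord0 i).
Local Notation "\Int f" := (\int[lebesgue_rV R _]_x f x) (at level 0, f at level 0).

Lemma smooth_derivableM (W : normedModType R) (f g : W -> R) x v : smooth f -> smooth g ->
  'D_v (fun y => f y * g y) x = f x * 'D_v g x + g x * 'D_v f x.
Proof.
move=> sf sg; have := @deriveM _ _ f g x v (@smooth_derivable _ _ f x v sf) (@smooth_derivable _ _ g x v sg).
by move=> <-.
Qed.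

Lemma bounded_supportM n (f g : 'rV[R]_n -> R) : bounded_support f ->
  bounded_support (fun x => f x * g x).
Proof. by move=> [M h]; exists M => x /h ->; rewrite mul0r. Qed.

Lemma Cc_int n (f : 'rV[R]_n -> R) : Cc f -> rintegrable (mu n) setT f.
Proof. by move=> cf; exact: Cc_integrable. Qed.

Lemma by_parts n i (f g : 'rV[R]_n -> R) : smooth f -> bounded_support f -> smooth g ->
  \Int (fun x => 'D_(e_ i) f x * g x) = - \Int (fun x => f x * 'D_(e_ i) g x).
Proof.
move=> sf bf sg; have sfg := smoothM sf sg; have bfg := @bounded_supportM _ f g bf.
have := Rintegral_partial0 (Cc_smooth sfg bfg) (Cc_derive (e_ i) sfg bfg)
  (fun x => @smooth_derivable _ _ _ x (e_ i) sfg).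
under eq_Rintegral do rewrite smooth_derivableM//.
have c1 : Cc (fun x => f x * 'D_(e_ i) g x).
  have := CcMl (smooth_continuous (smooth_derive (e_ i) sg)) (Cc_smooth sf bf).
  by congr Cc; apply/funext => x; rewrite mulrC.
have c2 : Cc (fun x => g x * 'D_(e_ i) f x).
  exact: CcMl (smooth_continuous sg) (Cc_derive (e_ i) sf bf).
rewrite RintegralD//; [|exact: Cc_int|exact: Cc_int].
under [X in _ + X = _ -> _]eq_Rintegral do rewrite mulrC.
by lra.
Qed.

(** The Poincare inequality, from the vanishing of the integral of the
    derivative of x_0 f^2. *)
Lemma poincare n M (f : 'rV[R]_n.+1 -> R) : smooth f -> (forall x, ~ box M x -> f x = 0) ->
  \Int (fun x => f x ^+ 2) <= 4 * M ^+ 2 * \Int (fun x => ('D_(e_ ord0) f x) ^+ 2).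
Proof.
move=> sf fM; have bf : bounded_support f by exists M.
have cf := Cc_smooth sf bf; have cD := Cc_derive (e_ ord0) sf bf.
have c2 (h : 'rV[R]_n.+1 -> R) : Cc h -> Cc (fun x => h x ^+ 2).
  by move=> ch; exact: (CcMl (Cc_cont ch) ch).
have sx : smooth (fun x : 'rV[R]_n.+1 => x ord0 ord0) by exact: smooth_coord.
have Dx x : 'D_(e_ ord0) (fun x : 'rV[R]_n.+1 => x ord0 ord0) x = 1.
  have e : (fun h => h^-1 *: (((fun x : 'rV[R]_n.+1 => x ord0 ord0) \o shift x)
     (h *: e_ ord0) - x ord0 ord0)) @ 0^' --> (1 : R).
    have c0 : (fun _ : R => 1 : R) @ 0^' --> (1 : R) by exact: cvg_cst.
    apply: cvg_trans c0; apply: near_eq_cvg; near=> h.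
    rewrite /= !mxE !eqxx mulr1 addrK /GRing.scale /= mulVf//.
    by near: h; exact: nbhs_dnbhs_neq.
  by apply: cvg_lim e.
have sf2 : smooth (fun x => f x * f x) by exact: smoothM.
have bf2 := @bounded_supportM _ f f bf.
have := by_parts ord0 sf2 bf2 sx.
under eq_Rintegral do rewrite smooth_derivableM//.
under [X in _ = - X -> _]eq_Rintegral do rewrite Dx mulr1 -expr2.
move=> ibp.
have c3 : Cc (fun x => f x * 'D_(e_ ord0) f x * x ord0 ord0).
  have := CcMl (smooth_continuous sx) (CcMl (Cc_cont cf) cD).
  by congr Cc; apply/funext => x; ring.
(* Young's inequality, with |x_0| <= M on the support of f. *)
have key : \Int (fun x => -1 * (2 * (f x * 'D_(e_ ord0) f x * x ord0 ord0))) <=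
    \Int (fun x => 2^-1 * f x ^+ 2 + 2 * M ^+ 2 * ('D_(e_ ord0) f x) ^+ 2).
  apply: le_Rintegral => //.
  - exact: Cc_int (CcZ (-1) (CcZ 2 c3)).
  - exact: Cc_int (CcD (CcZ 2^-1 (c2 _ cf)) (CcZ (2 * M ^+ 2) (c2 _ cD))).
  move=> x _; have [xM|xM] := pselect (box M x); last first.
    by rewrite (fM _ xM) (derive_outside_box _ fM xM); lra.
  have x2 : x ord0 ord0 ^+ 2 <= M ^+ 2.
    by rewrite -[leLHS]real_normK ?num_real// lerXn2r ?nnegrE// (le_trans _ (xM ord0)).
  set D := 'D_(e_ ord0) f x; have := sqr_ge0 (f x + 2 * (D * x ord0 ord0)).
  have := ler_wpM2r (sqr_ge0 D) x2.
  by rewrite !expr2; lra.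
have fE : \Int (fun x => -1 * (2 * (f x * 'D_(e_ ord0) f x * x ord0 ord0))) = \Int (fun x => f x ^+ 2).
  rewrite RintegralZl ?mulN1r//; last exact: Cc_int (CcZ 2 c3).
  apply/eqP; rewrite -eqr_opp opprK -ibp; apply/eqP.
  by apply: eq_Rintegral => x _; ring.
rewrite fE in key.
rewrite RintegralD// in key; [|exact: Cc_int (CcZ 2^-1 (c2 _ cf))|exact: Cc_int (CcZ (2 * M ^+ 2) (c2 _ cD))].
rewrite (RintegralZl 2^-1)// in key; last exact: Cc_int (c2 _ cf).
rewrite (RintegralZl (2 * M ^+ 2))// in key; last exact: Cc_int (c2 _ cD).
lra.
Unshelve. all: by end_near. Qed.

Definition divgrad n (g b : 'rV[R]_n -> R) (x : 'rV[R]_n) : R :=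
  \sum_i 'D_(e_ i) (fun y => g y * 'D_(e_ i) b y) x.

Lemma smooth_divgrad n (g b : 'rV[R]_n -> R) : smooth g -> smooth b -> smooth (divgrad g b).
Proof.
move=> sg sb; apply: smooth_sum => i; apply: smooth_derive; apply: smoothM => //.
exact: smooth_derive.
Qed.

Lemma Rintegral_sum n (I : Type) (s : seq I) (f : I -> 'rV[R]_n -> R) :
  (forall i, Cc (f i)) ->
  \Int (fun x => \sum_(i <- s) f i x) = \sum_(i <- s) \Int (f i).
Proof.
move=> cf; elim: s => [|i s IH].
  by rewrite big_nil; under eq_Rintegral do rewrite big_nil; rewrite /Rintegral integral0.
rewrite big_cons -IH -RintegralD//; [|exact: Cc_int|exact: Cc_int (Cc_sum s cf)].
by apply: eq_Rintegral => x _; rewrite big_cons.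
Qed.

(** Green's formula; there is no boundary term because a has bounded support. *)
Lemma green n (g a b : 'rV[R]_n -> R) : smooth g -> smooth a -> bounded_support a ->
  smooth b ->
  \Int (fun x => g x * \sum_i 'D_(e_ i) a x * 'D_(e_ i) b x) =
  \Int (fun x => a x * - divgrad g b x).
Proof.
move=> sg sa ba sb.
have sgb i : smooth (fun y => g y * 'D_(e_ i) b y).
  by apply: smoothM => //; exact: smooth_derive.
have c1 i : Cc (fun x => 'D_(e_ i) a x * (g x * 'D_(e_ i) b x)).
  have := CcMl (smooth_continuous (sgb i)) (Cc_derive (e_ i) sa ba).
  by congr Cc; apply/funext => x; rewrite mulrC.
have c2 i : Cc (fun x => a x * 'D_(e_ i) (fun y => g y * 'D_(e_ i) b y) x).
  have := CcMl (smooth_continuous (smooth_derive (e_ i) (sgb i))) (Cc_smooth sa ba).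
  by congr Cc; apply/funext => x; rewrite mulrC.
transitivity (\Int (fun x => \sum_i 'D_(e_ i) a x * (g x * 'D_(e_ i) b x))).
  by apply: eq_Rintegral => x _; rewrite mulr_sumr; apply: eq_bigr => i _; ring.
rewrite Rintegral_sum//; transitivity (- \sum_i \Int (fun x => a x * 'D_(e_ i) (fun y => g y * 'D_(e_ i) b y) x)).
  by rewrite -sumrN; apply: eq_bigr => i _; exact: by_parts.
rewrite -Rintegral_sum// -mulN1r -RintegralZl//; last exact: Cc_int (Cc_sum _ c2).
by apply: eq_Rintegral => x _; rewrite mulN1r /divgrad mulrN mulr_sumr.
Qed.

End IntegrationByParts.

Section DirichletForm.
Context {R : realType} {n : nat}.
Variables (Omega : set 'rV[R]_n.+1) (sigma g : 'rV[R]_n.+1 -> R).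
Hypothesis mO : measurable Omega.
Hypothesis bO : bounded_set Omega.
Hypothesis sg : smooth g.
Hypothesis sigmaE : forall x, Omega x -> sigma x = g x.
Variable c : R.
Hypothesis c0 : 0 < c.
Hypothesis sigmac : forall x, Omega x -> c <= sigma x.

Local Notation mu := (lebesgue_rV R n.+1).
Local Notation test := (test_fun Omega).
Local Notation e_ i := (delta_mx ord0 i).

Lemma Rintegral_supp (f : 'rV[R]_n.+1 -> R) : (forall x, ~ Omega x -> f x = 0) ->
  \int[mu]_(x in Omega) f x = \int[mu]_x f x.
Proof.
move=> f0; rewrite Rintegral_mkcond; congr (Rintegral _ _ _).
apply/funext => x; rewrite patchE; case: ifPn => //; rewrite notin_setE => /f0.
by move=> ->.
Qed.

Lemma test_outside (u : 'rV[R]_n.+1 -> R[i]) x : test u -> ~ Omega x -> u x = 0.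
Proof. by move=> [_ _ su] Ox; apply: tsupport0; apply: contra_not Ox; exact: su. Qed.

Lemma tsupport_ReIm (u : 'rV[R]_n.+1 -> R[i]) :
  tsupport (fun x => complex.Re (u x)) `<=` tsupport u /\
  tsupport (fun x => complex.Im (u x)) `<=` tsupport u.
Proof. by split; apply: tsupportS => x ->. Qed.

Lemma test_derive_outside (u : 'rV[R]_n.+1 -> R[i]) x v : test u -> ~ Omega x ->
  'D_v (fun x => complex.Re (u x)) x = 0 /\ 'D_v (fun x => complex.Im (u x)) x = 0.
Proof.
move=> [_ _ su] Ox; have [h1 h2] := tsupport_ReIm u.
by split; apply: derive_tsupport0; apply: contra_not Ox; [move=> /h1/su|move=> /h2/su].
Qed.

Lemma grad_outside (u : 'rV[R]_n.+1 -> R[i]) x : test u -> ~ Omega x -> grad u x = 0.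
Proof.
move=> tu Ox; apply/rowP => i; rewrite !mxE.
by have [-> ->] := test_derive_outside (e_ i) tu Ox.
Qed.

Lemma test_bs (u : 'rV[R]_n.+1 -> R[i]) : test u -> bounded_support u.
Proof. by move=> [_ cu _]; exact: test_bounded_support cu. Qed.

Definition dirichlet (u : 'rV[R]_n.+1 -> R[i]) : R :=
  \int[mu]_(x in Omega) complex.Re (cdot (grad u x) (grad u x)).

Lemma dirichlet_integrable u : test u ->
  rintegrable mu Omega (fun x => complex.Re (cdot (grad u x) (grad u x))).
Proof.
move=> tu; have [su _ _] := tu.
have [h _] := Cc_wgrad (@cst_continuous _ _ (1 : R)) su su (test_bs tu).
apply: (@eq_rintegrable _ _ _ mu Omega mO (fun x => complex.Re (wgrad (fun=> 1) u u x))).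
  by move=> x _; rewrite wgrad_Re mul1r.
exact: Cc_integrable.
Qed.

Lemma dirichlet_le u : test u -> dirichlet u <= c^-1 * complex.Re (form_HD Omega sigma u u).
Proof.
move=> tu; have [su _ _] := tu.
have [h _] := Cc_wgrad (smooth_continuous sg) su su (test_bs tu).
rewrite (form_HDE sigmaE) /cintegral /= -RintegralZl//; last exact: Cc_integrable.
apply: le_Rintegral => //; first exact: dirichlet_integrable.
  by apply: rintegrableZ => //; exact: Cc_integrable.
move=> x Ox; rewrite wgrad_Re mulrA ler_peMl ?cdot_ge0//.
by rewrite ler_pdivlMl// mulr1 -sigmaE// sigmac.
Qed.

Lemma csmooth_square_integrable (u : 'rV[R]_n.+1 -> R[i]) : csmooth u ->
  bounded_support u -> square_integrable Omega u.
Proof.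
move=> [u1 u2] /bounded_support_ReIm[b1 b2].
have c1 := Cc_smooth u1 b1; have c2 := Cc_smooth u2 b2.
split.
- by apply: measurable_funTS; apply: continuous_measurable_rV; exact: Cc_cont.
- by apply: measurable_funTS; apply: continuous_measurable_rV; exact: Cc_cont.
have ci := Cc_integrable (CcD (CcMl (Cc_cont c1) c1) (CcMl (Cc_cont c2) c2)) mO.
have /integrableP[_] := ci; apply: le_lt_trans.
rewrite le_eqVlt; apply/orP; left; apply/eqP; apply: eq_integral => x _ /=.
by rewrite ger0_norm// addr_ge0// -expr2 sqr_ge0.
Qed.

Lemma test_square_integrable : test `<=` square_integrable Omega.
Proof.
by move=> u tu; apply: csmooth_square_integrable; [case: tu|exact: test_bs].
Qed.

Lemma form_L2_ReE (u v : 'rV[R]_n.+1 -> R[i]) : complex.Re (form_L2 Omega u v) =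
  \int[mu]_(x in Omega) (complex.Re (u x) * complex.Re (v x) + complex.Im (u x) * complex.Im (v x)).
Proof.
rewrite /form_L2 /cintegral /=; apply: eq_Rintegral => x _.
by case: (u x) (v x) => [? ?] [? ?] /=; ring.
Qed.

Lemma form_L2_ImE (u v : 'rV[R]_n.+1 -> R[i]) : complex.Im (form_L2 Omega u v) =
  \int[mu]_(x in Omega) (complex.Im (u x) * complex.Re (v x) - complex.Re (u x) * complex.Im (v x)).
Proof.
rewrite /form_L2 /cintegral /=; apply: eq_Rintegral => x _.
by case: (u x) (v x) => [? ?] [? ?] /=; ring.
Qed.

Lemma poincare_forms : exists2 C, 0 <= C & forall u, test u ->
  complex.Re (form_L2 Omega u u) <= C ^+ 2 * complex.Re (form_HD Omega sigma u u).
Proof.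
have [M OM] := bounded_box bO.
exists (Num.sqrt (4 * M ^+ 2 * c^-1)) => [|u tu]; first exact: sqrtr_ge0.
rewrite sqr_sqrtr; last by rewrite divr_ge0 ?(ltW c0)// mulr_ge0// sqr_ge0.
apply: le_trans (_ : 4 * M ^+ 2 * dirichlet u <= _); last first.
  apply: le_trans (ler_wpM2l _ (dirichlet_le tu)) _; first by rewrite mulr_ge0 ?sqr_ge0.
  by rewrite !mulrA.
have [[u1 u2] _ _] := tu; have [b1 b2] := bounded_support_ReIm (test_bs tu).
have c1 := Cc_smooth u1 b1; have c2 := Cc_smooth u2 b2.
have d1 := Cc_derive (e_ ord0) u1 b1; have d2 := Cc_derive (e_ ord0) u2 b2.
have uM x : ~ box M x -> u x = 0.
  by move=> xM; apply: test_outside tu _; apply: contra_not xM; exact: OM.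
rewrite form_L2_ReE Rintegral_supp; last first.
  by move=> x /(test_outside tu) ->; rewrite /= !mulr0 addr0.
rewrite RintegralD//; [|exact: Cc_int (CcMl (Cc_cont c1) c1)|exact: Cc_int (CcMl (Cc_cont c2) c2)].
have p1 := poincare u1 (fun x xM => congr1 (@complex.Re R) (uM x xM)).
have p2 := poincare u2 (fun x xM => congr1 (@complex.Im R) (uM x xM)).
apply: le_trans (lerD p1 p2) _; rewrite -mulrDr; apply: ler_wpM2l.
  by rewrite mulr_ge0 ?sqr_ge0.
rewrite -RintegralD//; [|exact: Cc_int (CcMl (Cc_cont d1) d1)|exact: Cc_int (CcMl (Cc_cont d2) d2)].
rewrite -Rintegral_supp; last first.
  by move=> x Ox; have [-> ->] := test_derive_outside (e_ ord0) tu Ox; rewrite expr0n addr0.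
apply: le_Rintegral => //.
- exact: Cc_integrable (CcD (CcMl (Cc_cont d1) d1) (CcMl (Cc_cont d2) d2)) mO.
- exact: dirichlet_integrable.
- move=> x Ox; rewrite cdot_Re (bigD1 ord0)//= !mxE /= -!expr2 lerDl sumr_ge0// => i _.
  by rewrite addr_ge0// -expr2 sqr_ge0.
Qed.

(** Pairing with phi in H_D is pairing with - div (sigma grad phi) in L^2. *)
Lemma form_HD_green phi : test phi -> exists2 psi, square_integrable Omega psi &
  forall v, test v -> form_HD Omega sigma v phi = form_L2 Omega v psi.
Proof.
move=> tphi; have [[p1 p2] cp sp] := tphi.
have [h1 h2] := tsupport_ReIm phi.
pose psi x : R[i] := - divgrad g (fun x => complex.Re (phi x)) x
                  +i* - divgrad g (fun x => complex.Im (phi x)) x.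
have [M hM] := test_bs tphi.
have sdg (b : 'rV[R]_n.+1 -> R) : smooth b -> smooth (fun x => - divgrad g b x).
  by move=> sb; apply: smoothN; exact: smooth_divgrad.
have dg0 (b : 'rV[R]_n.+1 -> R) x : (forall x, ~ box M x -> b x = 0) -> ~ box M x ->
    divgrad g b x = 0.
  move=> bM xM; rewrite /divgrad big1// => i _; apply: derive_outside_box xM => y yM.
  by rewrite (derive_outside_box _ bM yM) mulr0.
exists psi.
  apply: csmooth_square_integrable; first by split; exact: sdg.
  exists M => x xM; rewrite /psi !dg0 ?oppr0//.
  - by move=> y /hM ->.
  - by move=> y /hM ->.
move=> v tv; have [[v1 v2] cv sv] := tv; have [b1 b2] := bounded_support_ReIm (test_bs tv).
have cgr (a b : 'rV[R]_n.+1 -> R) : smooth a -> bounded_support a -> smooth b ->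
    Cc (fun x => g x * \sum_i 'D_(e_ i) a x * 'D_(e_ i) b x).
  move=> sa ba sb; apply: CcMl; first exact: smooth_continuous.
  apply: Cc_sum => i; under eq_fun do rewrite mulrC.
  by apply: CcMl; [exact/smooth_continuous/smooth_derive|exact: Cc_derive].
have cab (a b : 'rV[R]_n.+1 -> R) : smooth a -> bounded_support a -> smooth b ->
    Cc (fun x => a x * - divgrad g b x).
  move=> sa ba sb; under eq_fun do rewrite mulrC.
  by apply: CcMl; [exact/smooth_continuous/sdg|exact: Cc_smooth].
have l0 (a b c' d : R) : a = 0 -> b = 0 -> a * c' + b * d = 0.
  by move=> -> ->; rewrite !mul0r addr0.
have l1 (a b c' d : R) : a = 0 -> b = 0 -> a * c' - b * d = 0.
  by move=> -> ->; rewrite !mul0r subr0.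
rewrite (form_HDE sigmaE); apply/eqP; rewrite eq_complex; apply/andP; split; apply/eqP.
  rewrite form_L2_ReE /cintegral /=.
  rewrite Rintegral_supp; last first.
    by move=> x /(grad_outside tv) gv; rewrite /wgrad gv /cdot big1 ?mulr0// => i _; rewrite mxE mul0r.
  rewrite Rintegral_supp; last first.
    by move=> x Ox; apply: l0; rewrite (test_outside tv Ox).
  rewrite RintegralD//; [|exact: Cc_int (cab _ _ v1 b1 p1)|exact: Cc_int (cab _ _ v2 b2 p2)].
  apply/esym.
  apply: etrans (congr2 +%R (esym (green sg v1 b1 p1)) (esym (green sg v2 b2 p2))) _.
  rewrite -RintegralD//; [|exact: Cc_int (cgr _ _ v1 b1 p1)|exact: Cc_int (cgr _ _ v2 b2 p2)].
  apply/esym/eq_Rintegral => x _; rewrite wgrad_Re cdot_Re -mulrDr -big_split; congr (_ * _).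
  by apply: eq_bigr => i _; rewrite !mxE.
rewrite form_L2_ImE /cintegral /=.
rewrite Rintegral_supp; last first.
  by move=> x /(grad_outside tv) gv; rewrite /wgrad gv /cdot big1 ?mulr0// => i _; rewrite mxE mul0r.
rewrite Rintegral_supp; last first.
  by move=> x Ox; apply: l1; rewrite (test_outside tv Ox).
rewrite RintegralB//; [|exact: Cc_int (cab _ _ v2 b2 p1)|exact: Cc_int (cab _ _ v1 b1 p2)].
apply/esym.
apply: etrans (congr2 (fun a b => a - b) (esym (green sg v2 b2 p1)) (esym (green sg v1 b1 p2))) _.
rewrite -RintegralB//; [|exact: Cc_int (cgr _ _ v2 b2 p1)|exact: Cc_int (cgr _ _ v1 b1 p2)].
apply/esym/eq_Rintegral => x _; rewrite wgrad_Im cdot_Im -mulrBr -sumrB; congr (_ * _).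
by apply: eq_bigr => i _; rewrite !mxE.
Qed.

End DirichletForm.

(** * Completeness of L^2 *)

Section SquareIntegrable.
Context {R : realType} {d : measure_display} {T : measurableType d}.
Variables (mu : {measure set T -> \bar R}) (D : set T).
Hypothesis mD : measurable D.
Implicit Types f g : T -> R.

Definition L2f f := measurable_fun D f /\ (\int[mu]_(x in D) (f x ^+ 2)%:E < +oo)%E.

Lemma L2f_sq_integrable f : L2f f -> rintegrable mu D (fun x => f x ^+ 2).
Proof.
move=> [mf fi]; apply/integrableP; split.
  by apply/measurable_EFinP; exact: measurable_funX.
apply: le_lt_trans fi; rewrite le_eqVlt; apply/orP; left; apply/eqP.
by apply: eq_integral => x _ /=; rewrite ger0_norm// sqr_ge0.
Qed.

Lemma L2fP f : measurable_fun D f -> rintegrable mu D (fun x => f x ^+ 2) -> L2f f.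
Proof.
move=> mf /integrableP[_] fi; split=> //.
apply: le_lt_trans fi; rewrite le_eqVlt; apply/orP; left; apply/eqP.
by apply: eq_integral => x _ /=; rewrite ger0_norm// sqr_ge0.
Qed.

Lemma L2fM_integrable f g : L2f f -> L2f g -> rintegrable mu D (fun x => f x * g x).
Proof.
move=> Lf Lg; have h := rintegrableD mD (L2f_sq_integrable Lf) (L2f_sq_integrable Lg).
apply: (le_integrable mD _ _ h).
  by apply/measurable_EFinP; apply: measurable_funM; [case: Lf|case: Lg].
move=> x _ /=; rewrite lee_fin [leRHS]ger0_norm ?addr_ge0 ?sqr_ge0//.
rewrite ler_norml; have := sqr_ge0 (f x + g x); have := sqr_ge0 (f x - g x).
have := sqr_ge0 (f x); have := sqr_ge0 (g x); rewrite !expr2; lra.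
Qed.

Lemma L2fD f g : L2f f -> L2f g -> L2f (fun x => f x + g x).
Proof.
move=> Lf Lg; apply: L2fP; first by apply: measurable_funD; [case: Lf|case: Lg].
have := rintegrableD mD (rintegrableD mD (L2f_sq_integrable Lf) (L2f_sq_integrable Lg))
  (rintegrableZ mD 2 (L2fM_integrable Lf Lg)).
by apply: (eq_rintegrable mD) => x _; ring.
Qed.

Lemma L2fZ c f : L2f f -> L2f (fun x => c * f x).
Proof.
move=> Lf; apply: L2fP; first by apply: measurable_funM => //; case: Lf.
have := rintegrableZ mD (c ^+ 2) (L2f_sq_integrable Lf).
by apply: (eq_rintegrable mD) => x _; ring.
Qed.

Lemma L2fB f g : L2f f -> L2f g -> L2f (fun x => f x - g x).
Proof.
move=> Lf Lg; have := L2fD Lf (L2fZ (-1) Lg).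
by congr L2f; apply/funext => x; rewrite mulN1r.
Qed.

Lemma fatou_le (f_ : nat -> T -> R) f (B : \bar R) :
  (forall k, measurable_fun D (f_ k)) -> (forall k x, D x -> 0 <= f_ k x) ->
  (forall x, D x -> f_ ^~ x @ \oo --> f x) ->
  (forall k, (\int[mu]_(x in D) (f_ k x)%:E <= B)%E) ->
  (\int[mu]_(x in D) (f x)%:E <= B)%E.
Proof.
move=> mf f0 ff fB.
have h := @fatou _ T R mu D mD (fun k x => (f_ k x)%:E)
  (fun k => (iffRL (measurable_EFinP _ _)) (mf k)) (fun k x Dx => f0 k x Dx).
rewrite (_ : \int[mu]_(x in D) (f x)%:E =
    \int[mu]_(x in D) limn_einf (fun k => (f_ k x)%:E))%E; last first.
  apply: eq_integral => x; rewrite inE => Dx; apply/esym.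
  suff : (fun k => (f_ k x)%:E) @ \oo --> (f x)%:E by move=> /cvg_limn_einf_sup[].
  by apply: cvg_EFin; [exact: nearW|exact: ff].
apply: le_trans h _; rewrite limn_einf_lim; apply: lime_le; first exact: is_cvg_einfs.
apply: nearW => k; apply: le_trans (fB k).
by apply: ereal_inf_lbound; exists k => /=.
Qed.

Lemma sum_geometric_half k : \sum_(i < k) (2^-1 : R) ^+ i <= 2.
Proof.
suff -> : \sum_(i < k) (2^-1 : R) ^+ i = 2 - 2 * 2^-1 ^+ k.
  by rewrite gerBl mulr_ge0// exprn_ge0.
elim: k => [|k IH]; first by rewrite big_ord0 expr0; lra.
by rewrite big_ord_recr /= IH exprS; lra.
Qed.

(** Absolute convergence of the increments, weighted by powers of 2 to turn
    |t| into 1 / w + w t^2. *)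
Lemma cvg_of_weighted_increments (b : nat -> R) (B : R) :
  (forall k, \sum_(i < k) 2 ^+ i * (b i.+1 - b i) ^+ 2 <= B) -> cvgn b.
Proof.
move=> hB; pose u i := b i.+1 - b i.
have uB k : \sum_(i < k) `|u i| <= 2 + B.
  apply: le_trans (lerD (sum_geometric_half k) (hB k)); rewrite -big_split /=.
  apply: ler_sum => i _; rewrite -/(u i); set w : R := 2 ^+ i.
  have w0 : 0 < w by rewrite exprn_gt0.
  rewrite exprVn -/w -[u i ^+ 2]real_normK ?num_real//; set t := `|u i|.
  have wv : w * w^-1 = 1 by rewrite divff// gt_eqF.
  have := sqr_ge0 (w * t - 1); have t0 : 0 <= t by exact: normr_ge0.
  rewrite -(ler_pM2l w0) mulrDr wv expr2 => h; have := mulr_ge0 (ltW w0) t0.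
  rewrite expr2; lra.
have us : cvgn (series u).
  apply: normed_cvg; apply: nondecreasing_is_cvgn.
    apply: nondecreasing_series => i _ _; exact: normr_ge0.
  exists (2 + B) => _ [k _ <-]; apply: le_trans (uB k).
  have := seriesEord (fun i => `|u i|) => /(congr1 (@^~ k)) e.
  by rewrite le_eqVlt; apply/orP; left; apply/eqP; exact: e.
have -> : b = fun k => b 0 + series u k.
  by apply/funext => k; rewrite seriesEnat /u /= telescope_sumr// addrC subrK.
by apply: is_cvgD => //; exact: is_cvg_cst.
Qed.

(** A rapidly converging subsequence converges almost everywhere; Fatou's
    lemma makes its limit the limit in the mean of the whole sequence. *)
Lemma riesz_fischer (a : nat -> T -> R) : (forall k, L2f (a k)) ->
  (forall e : R, 0 < e -> exists N, forall k l, (N <= k)%N -> (N <= l)%N ->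
    (\int[mu]_(x in D) ((a k x - a l x) ^+ 2)%:E <= e%:E)%E) ->
  exists g, L2f g /\ forall e : R, 0 < e -> exists N, forall k, (N <= k)%N ->
    (\int[mu]_(x in D) ((a k x - g x) ^+ 2)%:E <= e%:E)%E.
Proof.
move=> La ca.
have hN k : exists N, forall i l, (N <= i)%N -> (N <= l)%N ->
    (\int[mu]_(x in D) ((a i x - a l x) ^+ 2)%:E <= ((4^-1 : R) ^+ k)%:E)%E.
  by apply: ca; rewrite exprn_gt0.
have [N_ N_P] := choice hN.
(* n_ is increasing, and dominates both N_ and the identity. *)
pose n_ k := (\sum_(i < k.+1) (N_ i).+1)%N.
have n_S k : n_ k.+1 = (n_ k + (N_ k.+1).+1)%N by rewrite /n_ big_ord_recr.
have n_ge k : (N_ k <= n_ k)%N.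
  by rewrite /n_ big_ord_recr /= -[leqLHS]add0n leq_add.
have n_gek k : (k <= n_ k)%N.
  elim: k => // k IH; rewrite n_S addnS ltnS; exact: leq_trans IH (leq_addr _ _).
pose q k x := a (n_ k.+1) x - a (n_ k) x.
have mq k : measurable_fun D (q k).
  by apply: measurable_funB; [case: (La (n_ k.+1))|case: (La (n_ k))].
have qi k : (\int[mu]_(x in D) ((q k x) ^+ 2)%:E <= ((4^-1 : R) ^+ k)%:E)%E.
  apply: N_P; last exact: n_ge.
  by rewrite n_S; apply: leq_trans (n_ge k) (leq_addr _ _).
pose f k x := (2 ^+ k * q k x ^+ 2)%:E.
have f0 k x : D x -> (0 <= f k x)%E by rewrite lee_fin mulr_ge0 ?sqr_ge0 ?exprn_ge0.
have mf k : measurable_fun D (f k).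
  by apply/measurable_EFinP; apply: measurable_funM => //; exact: measurable_funX.
pose h x := (\sum_(0 <= k <oo) f k x)%E.
have mh : measurable_fun D h.
  by apply: (@ge0_emeasurable_sum _ _ _ D f xpredT) => // k x Dx _; exact: f0.
have h0 x : D x -> (0 <= h x)%E by move=> Dx; apply: nneseries_ge0 => k _ _; exact: f0.
have hfin : (\int[mu]_(x in D) h x <= 2%:E)%E.
  rewrite integral_nneseries//; apply: lime_le.
    by apply: is_cvg_nneseries => k _ _; apply: integral_ge0 => x; exact: f0.
  apply: nearW => k; rewrite big_mkord; apply: (@le_trans _ _ (\sum_(i < k) (2^-1 ^+ i)%:E)%E).
    apply: lee_sum => i _; rewrite /f; under eq_integral do rewrite EFinM.
    rewrite ge0_integralZl//; [|by apply/measurable_EFinP; exact: measurable_funX|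
      by move=> x _; rewrite lee_fin sqr_ge0].
    apply: le_trans (lee_wpmul2l _ (qi i)) _; first by rewrite lee_fin exprn_ge0.
    rewrite -EFinM lee_fin -exprMn (_ : 2 * 4^-1 = 2^-1 :> R)//; lra.
  by rewrite sumEFin lee_fin; exact: sum_geometric_half.
have hi : mu.-integrable D h.
  apply/integrableP; split=> //; apply: le_lt_trans (ltry 2).
  by under eq_integral => x /[!inE] Dx do rewrite (gee0_abs (h0 x Dx)).
(* On G, which has full measure in D, the subsequence converges. *)
pose G := D `&` [set x | (h x < +oo)%E].
have mG : measurable G by exact: emeasurable_fun_infty_o.
have GD x : G x -> D x by case.
have hG x : G x -> cvgn (fun k => a (n_ k) x).
  move=> [Dx hx]; apply: (@cvg_of_weighted_increments _ (fine (h x))) => k.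
  rewrite -lee_fin fineK ?ge0_fin_numE ?h0// -sumEFin -(big_mkord xpredT (fun i => f i x)).
  by apply: nneseries_lim_ge => i _ _; exact: f0.
pose iG := (\1_G : T -> R).
have iG1 x : G x -> iG x = 1 by move=> Gx; rewrite /iG indicE mem_set.
have iG0 x : ~ G x -> iG x = 0 by move=> Gx; rewrite /iG indicE memNset.
have miG : measurable_fun D iG by exact: measurable_indic.
pose g x := if x \in G then lim ((fun k => a (n_ k) x) @ \oo) else 0.
have bg x : D x -> (fun k => a (n_ k) x * iG x) @ \oo --> g x.
  move=> Dx; rewrite /g; case: ifPn => [/set_mem Gx|/negP Gx].
    by under eq_fun do rewrite (iG1 _ Gx) mulr1; exact: hG.
  rewrite inE in Gx; under eq_fun do rewrite (iG0 _ Gx) mulr0; exact: cvg_cst.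
have mg : measurable_fun D g.
  apply: (measurable_fun_cvg (h := fun k x => a (n_ k) x * iG x)) => // k.
  by apply: measurable_funM => //; case: (La (n_ k)).
(* Fatou's lemma along the subsequence, started at N. *)
have ae (e : R) m N : (N <= m)%N -> (forall k l, (N <= k)%N -> (N <= l)%N ->
    (\int[mu]_(x in D) ((a k x - a l x) ^+ 2)%:E <= e%:E)%E) ->
    (\int[mu]_(x in D) ((a m x - g x) ^+ 2)%:E <= e%:E)%E.
  move=> Nm hm; have mam : measurable_fun D (a m) by case: (La m).
  rewrite (@ge0_ae_eq_integral _ _ _ mu D _ (fun x => ((a m x * iG x - g x) ^+ 2)%:E))//.
  - apply: (@fatou_le (fun k x => (a m x * iG x - a (n_ (k + N)%N) x * iG x) ^+ 2)).
    + move=> k; apply: measurable_funX; apply: measurable_funB; apply: measurable_funM => //.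
      by case: (La (n_ (k + N)%N)).
    + by move=> k x _; exact: sqr_ge0.
    + move=> x Dx; have c1 : (fun k => a m x * iG x - a (n_ (k + N)%N) x * iG x) @ \oo --> a m x * iG x - g x.
        apply: cvgB; first exact: cvg_cst.
        by have := bg x Dx; rewrite -(cvg_shiftn N).
      by under eq_fun do rewrite expr2; rewrite expr2; exact: cvgM.
    + move=> k; apply: le_trans (hm m (n_ (k + N)%N) Nm _); last first.
        exact: leq_trans (leq_addl _ _) (n_gek _).
      apply: ge0_le_integral => //.
      * by move=> x _; rewrite lee_fin sqr_ge0.
      * apply/measurable_EFinP; apply: measurable_funX; apply: measurable_funB; apply: measurable_funM => //.
        by case: (La (n_ (k + N)%N)).
      * apply/measurable_EFinP; apply: measurable_funX; apply: measurable_funB => //.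
        by case: (La (n_ (k + N)%N)).
      * move=> x _; rewrite lee_fin; have [Gx|Gx] := pselect (G x).
          by rewrite iG1// !mulr1.
        by rewrite iG0// !mulr0 subrr expr0n /= sqr_ge0.
  - by apply/measurable_EFinP; apply: measurable_funX; exact: measurable_funB.
  - apply/measurable_EFinP; apply: measurable_funX; apply: measurable_funB => //.
    exact: measurable_funM.
  - by move=> x _; rewrite lee_fin sqr_ge0.
  - by move=> x _; rewrite lee_fin sqr_ge0.
  - have := integrable_ae mD hi; apply: filterS => x hx Dx; rewrite iG1 ?mulr1//.
    by split=> //=; have := hx Dx; rewrite ge0_fin_numE// h0.
have [N1 hN1] := ca 1 ltr01.
exists g; split; last first.
  by move=> e /ca[N hN']; exists N => k Nk; exact: (ae e k N).
have Lag : L2f (fun x => a N1 x - g x).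
  split; first by apply: measurable_funB => //; case: (La N1).
  by apply: le_lt_trans (ae 1 N1 N1 (leqnn _) hN1) _; rewrite ltry.
have := L2fB (La N1) Lag; congr L2f; apply/funext => x; ring.
Qed.

End SquareIntegrable.

Section FormL2.
Context {R : realType} {n : nat}.
Variable Omega : set 'rV[R]_n.
Hypothesis mO : measurable Omega.

Local Notation mu := (lebesgue_rV R n).
Local Notation sqint := (square_integrable Omega).
Local Notation L2f := (L2f mu Omega).
Local Notation re u := (fun x => complex.Re (u x)).
Local Notation im u := (fun x => complex.Im (u x)).

Lemma square_integrableP (u : 'rV[R]_n -> R[i]) : sqint u <-> L2f (re u) /\ L2f (im u).
Proof.
split=> [[m1 m2 ui]|[L1 L2]].
  have h (f g : 'rV[R]_n -> R) : measurable_fun Omega f -> measurable_fun Omega g ->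
      (\int[mu]_(x in Omega) (f x ^+ 2)%:E <= \int[mu]_(x in Omega) (f x ^+ 2 + g x ^+ 2)%:E)%E.
    move=> mf mg; apply: ge0_le_integral => //.
    - by move=> x _; rewrite lee_fin sqr_ge0.
    - by apply/measurable_EFinP; exact: measurable_funX.
    - by apply/measurable_EFinP; apply: measurable_funD; exact: measurable_funX.
    - by move=> x _; rewrite lee_fin lerDl sqr_ge0.
  split; split=> //; first exact: le_lt_trans (h _ _ m1 m2) ui.
  apply: le_lt_trans (h _ _ m2 m1) _; apply: le_lt_trans ui.
  by under eq_integral do rewrite addrC.
have := rintegrableD mO (L2f_sq_integrable L1) (L2f_sq_integrable L2).
move=> /integrableP[_ ui]; split; [by case: L1|by case: L2|].
apply: le_lt_trans ui; rewrite le_eqVlt; apply/orP; left; apply/eqP.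
by apply: eq_integral => x _ /=; rewrite ger0_norm// addr_ge0 ?sqr_ge0.
Qed.

Lemma form_L2_cintegrable (u v : 'rV[R]_n -> R[i]) : sqint u -> sqint v ->
  cintegrable mu Omega (fun x => u x * (v x)^*).
Proof.
move=> /square_integrableP[u1 u2] /square_integrableP[v1 v2]; split.
  have := rintegrableD mO (L2fM_integrable mO u1 v1) (L2fM_integrable mO u2 v2).
  apply: (eq_rintegrable mO) => x _.
  by case: (u x) (v x) => [? ?] [? ?] /=; ring.
have := rintegrableD mO (L2fM_integrable mO u2 v1)
  (rintegrableZ mO (-1) (L2fM_integrable mO u1 v2)).
apply: (eq_rintegrable mO) => x _.
by case: (u x) (v x) => [? ?] [? ?] /=; ring.
Qed.

Lemma form_L2_sqr (u : 'rV[R]_n -> R[i]) : sqint u -> complex.Re (form_L2 Omega u u) =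
  \int[mu]_(x in Omega) (complex.Re (u x) ^+ 2) + \int[mu]_(x in Omega) (complex.Im (u x) ^+ 2).
Proof.
move=> /square_integrableP[u1 u2]; rewrite -RintegralD//; [|exact: L2f_sq_integrable|exact: L2f_sq_integrable].
rewrite /form_L2 /cintegral /=; apply: eq_Rintegral => x _.
by case: (u x) => ? ? /=; ring.
Qed.

Lemma square_integrable_linear a (u v : 'rV[R]_n -> R[i]) : sqint u -> sqint v ->
  sqint (fun x => a * u x + v x).
Proof.
case: a => a b /square_integrableP[u1 u2] /square_integrableP[v1 v2].
apply/square_integrableP; split.
  have := L2fD mO (L2fD mO (L2fZ mO a u1) (L2fZ mO (- b) u2)) v1.
  by congr L2f; apply/funext => x; case: (u x) (v x) => [? ?] [? ?] /=; ring.
have := L2fD mO (L2fD mO (L2fZ mO a u2) (L2fZ mO b u1)) v2.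
by congr L2f; apply/funext => x; case: (u x) (v x) => [? ?] [? ?] /=; ring.
Qed.

Lemma L2f0 : L2f (fun=> 0).
Proof.
split; first exact: measurable_cst.
by under eq_integral do rewrite expr0n /=; rewrite integral0 ltry.
Qed.

Lemma hermitian_form_L2 : hermitian_form sqint (form_L2 Omega).
Proof.
split.
- by apply/square_integrableP; split; exact: L2f0.
- exact: square_integrable_linear.
- move=> a u v w tu tv tw; rewrite -cintegral_linear//; [|exact: form_L2_cintegrable..].
  by apply: eq_cintegral => // x _; rewrite mulrDl mulrA.
- move=> u v tu tv; rewrite -cintegral_conj//; last exact: form_L2_cintegrable.
  by apply: eq_cintegral => // x _; rewrite rmorphM /= conjCK mulrC.
- move=> u tu; rewrite form_L2_sqr// addr_ge0//; apply: Rintegral_ge0 => x _; exact: sqr_ge0.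
Qed.

Lemma EFin_Rintegral_sqr (f : 'rV[R]_n -> R) : L2f f ->
  (\int[mu]_(x in Omega) (f x ^+ 2))%:E = (\int[mu]_(x in Omega) (f x ^+ 2)%:E)%E.
Proof.
move=> Lf; rewrite /Rintegral fineK//; apply: integrable_fin_num => //.
exact: L2f_sq_integrable.
Qed.

(** Every element of the space is the class of a function, and [riesz_fischer]
    applies to the real and imaginary parts of representatives. *)
Lemma space_L2_complete (L2 : space_L2 Omega) (PL : polar_bilinear L2) :
  hcomplete (hilbertify PL).
Proof.
move=> u uc; pose q := to_quotient L2.
have qN f : sqint f -> nrm (q f : hilbertify PL) ^+ 2 =
    \int[mu]_(x in Omega) (complex.Re (f x) ^+ 2) + \int[mu]_(x in Omega) (complex.Im (f x) ^+ 2).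
  move=> sf; rewrite nrm_cnorm -form_L2_sqr//.
  exact: (cnorm_j hermitian_form_L2 (@to_quotient_norm _ _ _ _ L2)).
have qB f g : sqint f -> sqint g -> (q f : L2) - q g = q (fun x => -1 * g x + f x).
  move=> sf sg; rewrite /q to_quotient_linear// scaleN1r addrC //.
have hf k : exists f, sqint f /\ q f = u k.
  by have [f sf e] := @to_quotient_surj _ _ _ _ L2 (u k); exists f.
have [f fP] := choice hf.
have sqi0 (g : 'rV[R]_n -> R) : 0 <= \int[mu]_(x in Omega) (g x ^+ 2).
  by apply: Rintegral_ge0 => x _; exact: sqr_ge0.
have reB (a b : R[i]) : complex.Re (-1 * b + a) = complex.Re a - complex.Re b.
  by case: a b => [? ?] [? ?] /=; ring.
have imB (a b : R[i]) : complex.Im (-1 * b + a) = complex.Im a - complex.Im b.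
  by case: a b => [? ?] [? ?] /=; ring.
have ca e : 0 < e -> exists N, forall k l, (N <= k)%N -> (N <= l)%N ->
    (\int[mu]_(x in Omega) ((complex.Re (f k x) - complex.Re (f l x)) ^+ 2)%:E <= e%:E)%E /\
    (\int[mu]_(x in Omega) ((complex.Im (f k x) - complex.Im (f l x)) ^+ 2)%:E <= e%:E)%E.
  move=> e0; have [|N hN] := uc (Num.sqrt e); first by rewrite sqrtr_gt0.
  exists N => k l Nk Nl; have := hN k l Nk Nl.
  have [s1 e1] := fP k; have [s2 e2] := fP l.
  have s3 := square_integrable_linear (-1) s2 s1.
  rewrite -e1 -e2 (_ : (q (f k) : hilbertify PL) - q (f l) = q (fun x => -1 * f l x + f k x)); last exact: qB.
  move=> hn; have : nrm (q (fun x => -1 * f l x + f k x) : hilbertify PL) ^+ 2 <= e.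
    by rewrite -[leRHS]sqr_sqrtr ?(ltW e0)// ler_pXn2r// nnegrE ?nrm_ge0// sqrtr_ge0.
  have [L1 L2'] := (square_integrableP _).1 s3.
  rewrite qN// => hs; split.
    under eq_integral do rewrite -reB; rewrite -EFin_Rintegral_sqr// lee_fin.
    by apply: le_trans hs; rewrite lerDl.
  under eq_integral do rewrite -imB; rewrite -EFin_Rintegral_sqr// lee_fin.
  by apply: le_trans hs; rewrite lerDr.
have Lf k := (square_integrableP _).1 (fP k).1.
have [|g1 [Lg1 hg1]] := @riesz_fischer _ _ _ mu Omega mO (fun k => re (f k)) (fun k => (Lf k).1).
  by move=> e /ca[N hN]; exists N => k l Nk Nl; have [] := hN k l Nk Nl.
have [|g2 [Lg2 hg2]] := @riesz_fischer _ _ _ mu Omega mO (fun k => im (f k)) (fun k => (Lf k).2).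
  by move=> e /ca[N hN]; exists N => k l Nk Nl; have [] := hN k l Nk Nl.
pose g x := g1 x +i* g2 x.
have sg : sqint g by apply/square_integrableP.
exists (q g) => e e0; have e2 : 0 < e ^+ 2 / 2 by rewrite divr_gt0// exprn_gt0.
have [N1 hN1] := hg1 _ e2; have [N2 hN2] := hg2 _ e2.
exists (maxn N1 N2) => k; rewrite geq_max => /andP[k1 k2].
have [sk <-] := fP k; have s3 := square_integrable_linear (-1) sg sk.
rewrite (_ : (q (f k) : hilbertify PL) - q g = q (fun x => -1 * g x + f k x)); last exact: qB.
have [L1 L2'] := (square_integrableP _).1 s3.
rewrite -(@ler_pXn2r _ 2)// ?nnegrE ?nrm_ge0 ?(ltW e0)// qN//.
have h1 := hN1 k k1; have h2 := hN2 k k2.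
rewrite [e ^+ 2]splitr; apply: lerD; rewrite -lee_fin EFin_Rintegral_sqr//.
  by under eq_integral do rewrite reB.
by under eq_integral do rewrite imB.
Qed.

End FormL2.

(** * Density of the test functions in L^2 *)

Section DominatedConvergence.
Context {R : realType} {d : measure_display} {T : measurableType d}.
Variables (mu : {measure set T -> \bar R}) (D : set T).
Hypothesis mD : measurable D.

Lemma Rintegral_dominated (f_ : nat -> T -> R) (f g : T -> R) :
  (forall k, measurable_fun D (f_ k)) ->
  (forall x, D x -> f_ ^~ x @ \oo --> f x) ->
  rintegrable mu D g -> (forall k x, D x -> `|f_ k x| <= g x) ->
  rintegrable mu D f /\
  (fun k => \int[mu]_(x in D) f_ k x) @ \oo --> \int[mu]_(x in D) f x.
Proof.
move=> mf ff ig fg.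
have mf' : measurable_fun D f by exact: measurable_fun_cvg ff.
have [|||||fi _ h] := @dominated_convergence _ T R mu D mD (fun k => EFin \o f_ k)
  (EFin \o f) (EFin \o g) => //.
- by move=> k; exact/measurable_EFinP.
- exact/measurable_EFinP.
- by apply: aeW => x Dx; apply: cvg_EFin; [exact: nearW|exact: ff].
- by apply: aeW => x k Dx; exact: fg.
split=> //; apply: fine_cvg; rewrite fineK//.
exact: integrable_fin_num.
Qed.

End DominatedConvergence.

Section Density.
Context {R : realType} {n : nat}.
Local Notation mu := (lebesgue_rV R n).

Definition orthant (c : 'rV[R]_n) : set 'rV[R]_n := [set x | forall i, c ord0 i < x ord0 i].
Definition orthants : set (set 'rV[R]_n) := range orthant.

Lemma orthant_measurable c : measurable (orthant c).
Proof.
rewrite (_ : orthant c = \bigcap_(i in [set: 'I_n]) (@rV_coord R n i @^-1` `]c ord0 i, +oo[%classic)).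
  apply: fin_bigcap_measurable => // i _.
  by rewrite -[X in measurable X]setTI; exact: measurable_rV_coord.
apply/seteqP; split=> [x h i _|x h i]; first by rewrite /= in_itv /= andbT; exact: h.
by have := h i I; rewrite /= in_itv /= andbT.
Qed.

Lemma setI_closed_orthants : setI_closed orthants.
Proof.
move=> _ _ [c _ <-] [c' _ <-]; exists (\row_i Num.max (c ord0 i) (c' ord0 i)) => //.
apply/seteqP; split=> [x h|x [h1 h2] i].
  by split=> i; have := h i; rewrite mxE gt_max => /andP[].
by rewrite mxE gt_max h1 h2.
Qed.

(** For the sigma-algebra generated by the orthants the coordinates are
    measurable, as the half-spaces are countable unions of orthants. *)
Lemma orthants_generate (A : set 'rV[R]_n) : measurable A -> <<s orthants >> A.
Proof.
move=> mA.
have mi : measurable_fun [set: g_sigma_algebraType orthants]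
    (id : g_sigma_algebraType orthants -> 'rV[R]_n).
  apply: measurable_rVP => i.
  apply: (measurability _ (RGenOInfty.measurableE R)) => _ [_ [b ->] <-].
  rewrite setTI.
  pose c (k : nat) : 'rV[R]_n := \row_j if j == i then b else - k%:R.
  rewrite (_ : _ @^-1` _ = \bigcup_k orthant (c k)).
    apply: bigcup_measurable => k _; apply: sub_sigma_algebra.
    by exists (c k).
  apply/seteqP; split=> [x|x [k _ /(_ i)]]; last first.
    by rewrite mxE eqxx /= in_itv /= andbT.
  rewrite /= in_itv /= andbT /rV_coord => bx.
  have [k hk] : exists k : nat, forall j, - k%:R < x ord0 j.
    exists (Num.truncn (\sum_j `|x ord0 j|)).+1 => j.
    have h1 := truncnS_gt (\sum_j `|x ord0 j|).
    have h2 : `|x ord0 j| <= \sum_j `|x ord0 j| by rewrite (bigD1 j)//= lerDl sumr_ge0.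
    by have := ler_norm (- x ord0 j); rewrite normrN; lra.
  by exists k => // j; rewrite mxE; case: eqP => [->|_]; [|exact: hk].
by have := mi measurableT A mA; rewrite setTI.
Qed.

(** Orthants are stable under intersection and generate the sigma-algebra, so
    an integrable function is determined by its integrals over them. *)
Lemma orthant_null (g : 'rV[R]_n -> R) : rintegrable mu setT g ->
  (forall c, (\int[mu]_(x in orthant c) (g x)%:E = 0)%E) ->
  ae_eq mu setT (EFin \o g) (cst 0%E).
Proof.
move=> ig g0.
pose nu : {charge set 'rV[R]_n -> \bar R} := induced_charge ig.
have nuE E : nu E = (\int[mu]_(x in E) (g x)%:E)%E by [].
pose H := [set E : set 'rV[R]_n | measurable E /\ nu E = 0%E].
have HD : setSD_closed H.
  move=> A B BA [mA A0] [mB B0]; split; first exact: measurableD.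
  have := chargeD nu mA mB; rewrite (_ : A `&` B = B); last exact: setIidr.
  by rewrite A0 B0 oppe0 adde0.
have Hnd : ndseq_closed H.
  move=> F ndF HF; split; first by apply: bigcup_measurable => k _; case: (HF k).
  have sD k : H (seqD F k).
    case: k => [|k]; first exact: HF.
    apply: HD => //; apply/subsetPset; exact: ndF.
  rewrite -eq_bigcup_seqD.
  have h := @charge_semi_sigma_additive _ _ _ nu (seqD F) (fun k => (sD k).1) (trivIset_seqD ndF).
  have {}h := h (bigcup_measurable (fun k _ => (sD k).1)).
  have z : (fun n0 : nat => (\sum_(0 <= i < n0) nu (seqD F i))%E) = fun=> 0%E.
    by apply/funext => k; rewrite big1// => i _; case: (sD i).
  rewrite z in h; apply: (cvg_unique _ h); first exact: ereal_hausdorff.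
  exact: cvg_cst.
have HT : H setT.
  rewrite (_ : setT = \bigcup_k orthant (\row_j - k%:R)).
    apply: Hnd => [k l kl|k].
      apply/subsetPset => x h i; have := h i; rewrite !mxE.
      have : (k%:R : R) <= l%:R by rewrite ler_nat.
      by lra.
    by split; [exact: orthant_measurable|exact: g0].
  apply/esym; rewrite -subTset => x _; exists (Num.truncn (\sum_j `|x ord0 j|)).+1 => // j.
  have h1 := truncnS_gt (\sum_j `|x ord0 j|).
  have h2 : `|x ord0 j| <= \sum_j `|x ord0 j| by rewrite (bigD1 j)//= lerDl sumr_ge0.
  by rewrite mxE; have := ler_norm (- x ord0 j); rewrite normrN; lra.
apply: integral_ae_eq => // E _ mE; rewrite integral0.
suff [] : H E by [].
apply: (lambda_system_subset setI_closed_orthants (D := setT) (H := H)) => //.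
- by move=> _ [c _ <-]; split; [exact: orthant_measurable|exact: g0].
- exact: orthants_generate.
Qed.

Lemma cvg_bigprod (I : Type) (s : seq I) (u : I -> nat -> R) (l : I -> R) :
  (forall i, u i @ \oo --> l i) ->
  (fun k => \prod_(i <- s) u i k) @ \oo --> \prod_(i <- s) l i.
Proof.
move=> ul; elim: s => [|i s IH].
  by rewrite big_nil; under eq_fun do rewrite big_nil; exact: cvg_cst.
by rewrite big_cons; under eq_fun do rewrite big_cons; exact: cvgM.
Qed.

Lemma step_cvg (t : R) : 0 < t -> (fun k : nat => step (k%:R * t)) @ \oo --> (1 : R).
Proof.
move=> t0; apply/cvgrPdist_le => e e0.
have [N hN] := inv_succ_small (mulr_gt0 e0 t0).
exists N.+1 => // -[//|k] /=; rewrite ltnS => Nk.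
have kt0 : 0 < k.+1%:R * t by rewrite mulr_gt0.
have h := step_ge kt0; rewrite ger0_norm ?subr_ge0 ?step_le1//.
rewrite invfM in h; have h2 := hN k Nk.
have h3 : k.+1%:R^-1 * t^-1 <= e by rewrite ler_pdivrMr.
by apply: le_trans h3; rewrite lerBlDl -lerBlDr.
Qed.

(** Smooth, and positive exactly on the open cube of centre q and radius r. *)
Definition bump (q : 'rV[R]_n) (r : R) (x : 'rV[R]_n) : R :=
  \prod_i (step (r + (x ord0 i - q ord0 i)) * step (r - (x ord0 i - q ord0 i))).

Lemma smooth_step_affine (i : 'I_n) (a b : R) :
  smooth (fun x : 'rV[R]_n => step (a * x ord0 i + b)).
Proof.
apply: (@smooth_affine _ _ _ step (fun x : 'rV[R]_n => a * x ord0 i + b)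
  (fun v => a * v ord0 i)).
- exact: (smooth_continuous (smoothD (smoothZ a (smooth_coord i)) (@smooth_cst _ _ b))).
- by move=> x v h; rewrite !mxE /GRing.scale /=; ring.
- exact: smooth_step.
Qed.

Lemma smooth_bump q r : smooth (bump q r).
Proof.
apply: smooth_prod => i; apply: smoothM.
  have := smooth_step_affine i 1 (r - q ord0 i).
  by congr smooth; apply/funext => x; congr step; ring.
have := smooth_step_affine i (-1) (r + q ord0 i).
by congr smooth; apply/funext => x; congr step; ring.
Qed.

Lemma bump_gt0 (q x : 'rV[R]_n) r : (forall i, `|x ord0 i - q ord0 i| < r) -> 0 < bump q r x.
Proof.
move=> h; apply: prodr_gt0 => i _; have := h i; rewrite ltr_norml => /andP[h1 h2].
by rewrite mulr_gt0// step_gt0; lra.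
Qed.

Lemma bump_eq0 (q x : 'rV[R]_n) r i : r <= `|x ord0 i - q ord0 i| -> bump q r x = 0.
Proof.
rewrite lter_normr => h; rewrite /bump (bigD1 i)//=.
case/orP: h => h; first by rewrite (@step_eq0 _ (r - _)) ?mulr0 ?mul0r//; lra.
by rewrite (@step_eq0 _ (r + _)) ?mul0r//; lra.
Qed.

Lemma tsupport_bump (q : 'rV[R]_n) r : tsupport (bump q r) `<=` [set x : 'rV[R]_n | forall i, `|x ord0 i - q ord0 i| <= r].
Proof.
set A := [set x | _]; have cl : closed A.
  apply: compact_closed; first exact: norm_hausdorff.
  have -> : A = [set v : 'rV[R]_n | forall i, `[q ord0 i - r, q ord0 i + r]%classic (v ord0 i)].
    by apply/seteqP; split=> x h i; have := h i; rewrite /= in_itv /= ler_distl.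
  apply: (@rV_compact _ _ (fun i => `[q ord0 i - r, q ord0 i + r]%classic)) => i.
  exact: segment_compact.
rewrite /tsupport (closure_id A).1//; apply: closureS => x /= bx i.
by rewrite leNgt; apply/negP => /ltW h; case/eqP: bx; exact: bump_eq0 h.
Qed.

(** A smooth approximation of the indicator function of an orthant. *)
Definition tail (c : 'rV[R]_n) (k : nat) (x : 'rV[R]_n) : R :=
  \prod_i step (k%:R * (x ord0 i - c ord0 i)).

Lemma smooth_tail c k : smooth (tail c k).
Proof.
apply: smooth_prod => i; have := smooth_step_affine i k%:R (- k%:R * c ord0 i).
by congr smooth; apply/funext => x; congr step; ring.
Qed.

Lemma tail_ge0_le1 c k x : 0 <= tail c k x <= 1.
Proof.
rewrite prodr_ge0/=; last by move=> i _; exact: step_ge0.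
by apply: prodr_ile1 => i _; rewrite step_ge0 step_le1.
Qed.

Lemma tail_cvg c x : tail c ^~ x @ \oo --> (\1_(orthant c) x : R).
Proof.
rewrite indicE; case: (boolP (x \in orthant c)) => [/set_mem xc|/negP xc].
  rewrite /= (_ : 1%:R = \prod_(i < n) (1 : R)); last by rewrite big1.
  by apply: cvg_bigprod => i; apply: step_cvg; rewrite subr_gt0.
have [i ci] : exists i, x ord0 i <= c ord0 i.
  apply/not_existsP => h; apply: xc; rewrite inE => i.
  by rewrite ltNge; apply/negP; exact: h.
rewrite (_ : tail c ^~ x = fun=> 0); first exact: cvg_cst.
apply/funext => k; rewrite /tail (bigD1 i)//= step_eq0 ?mul0r//.
by rewrite mulr_ge0_le0// subr_le0.
Qed.

Variable Omega : set 'rV[R]_n.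
Hypothesis mO : measurable Omega.
Hypothesis oO : open Omega.
Hypothesis bO : bounded_set Omega.
Local Notation L2f := (L2f mu Omega).

Lemma Cc_L2f (f : 'rV[R]_n -> R) : Cc f -> L2f f.
Proof.
move=> cf; apply: L2fP => //.
  by apply: measurable_funTS; apply: continuous_measurable_rV; exact: Cc_cont.
by apply: Cc_integrable => //; exact: (CcMl (Cc_cont cf) cf).
Qed.

Definition real_test (f : 'rV[R]_n -> R) :=
  [/\ smooth f, compact (tsupport f) & tsupport f `<=` Omega].

Lemma real_test_Cc f : real_test f -> Cc f.
Proof. by move=> [sf cf _]; apply: Cc_smooth => //; exact: test_bounded_support cf. Qed.

Lemma real_testMr f g : real_test f -> smooth g -> real_test (fun x => f x * g x).
Proof.
move=> [sf cf tf] sg; have s : tsupport (fun x => f x * g x) `<=` tsupport f.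
  by apply: tsupportS => x ->; rewrite mul0r.
split; [exact: smoothM| |exact: subset_trans tf].
by apply: compact_tsupportS cf => x ->; rewrite mul0r.
Qed.

Lemma real_test_bump q r : 0 < r -> ball q (r + r) `<=` Omega -> real_test (bump q r).
Proof.
move=> r0 qO; have tO : tsupport (bump q r) `<=` Omega.
  move=> x /tsupport_bump h; apply: qO; split=> [|i j]; first by lra.
  by rewrite (ord1 i) /ball /= distrC (le_lt_trans (h j))//; lra.
split=> //; first exact: smooth_bump.
have [M OM] := bounded_box bO.
apply: (subclosed_compact _ (box_compact (M := M))); first exact: closed_closure.
exact: subset_trans OM.
Qed.

Section Orthogonal.
Variable a : 'rV[R]_n -> R.
Hypothesis La : L2f a.
Hypothesis a0 : forall phi, real_test phi -> \int[mu]_(x in Omega) (a x * phi x) = 0.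

(** Multiplying the test function th by [tail c k] and letting k grow, the
    integral of a th over each orthant vanishes. *)
Lemma orthogonal_bump th : real_test th -> ae_eq mu setT
  (EFin \o ((fun x => a x * th x) \_ Omega)) (cst 0%E).
Proof.
move=> tth; have Lth := Cc_L2f (real_test_Cc tth).
have iath := L2fM_integrable mO La Lth.
apply: orthant_null.
  rewrite /rintegrable -restrict_EFin.
  exact/(integrable_mkcond _ mO).
move=> c; set g := fun x => a x * th x.
have mphi k : rintegrable mu Omega (fun x => a x * (th x * tail c k x)).
  by apply: L2fM_integrable => //; apply: Cc_L2f; apply: real_test_Cc; apply: real_testMr => //; exact: smooth_tail.
have [ig cg] : rintegrable mu Omega (fun x => g x * \1_(orthant c) x) /\
    (fun k => \int[mu]_(x in Omega) (a x * (th x * tail c k x))) @ \oo -->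
    \int[mu]_(x in Omega) (g x * \1_(orthant c) x).
  apply: (@Rintegral_dominated _ _ _ mu Omega mO _ _ (fun x => `|g x|)).
  - by move=> k; apply/measurable_EFinP; exact: measurable_int (mphi k).
  - move=> x _; under eq_fun do rewrite mulrA.
    by apply: cvgM; [exact: cvg_cst|exact: tail_cvg].
  - exact: (integrable_abse iath).
  - move=> k x _; have /andP[t0 t1] := tail_ge0_le1 c k x.
    by rewrite mulrA normrM [X in _ * X]ger0_norm// ler_piMr.
have {cg} : \int[mu]_(x in Omega) (g x * \1_(orthant c) x) = 0.
  apply: (cvg_unique _ cg); first exact: Rhausdorff.
  rewrite (_ : (fun k => _) = fun=> 0); first exact: cvg_cst.
  by apply/funext => k; apply: a0; apply: real_testMr => //; exact: smooth_tail.
have mor := orthant_measurable c.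
rewrite /Rintegral => h; have := congr1 EFin h; rewrite fineK; last exact: integrable_fin_num.
move=> e; apply: etrans e; rewrite [RHS]integral_mkcond [LHS]integral_mkcond; apply: eq_integral => x _.
rewrite !patchE indicE; case: (x \in orthant c); case: (x \in Omega) => //=.
  by rewrite mulr1.
by rewrite mulr0.
Qed.

(** Omega is a countable union of cubes, on each of which some bump is
    positive. *)
Lemma orthogonal_null : ae_eq mu Omega (EFin \o a) (cst 0%E).
Proof.
pose B (q : 'rV[rat]_n) (k : nat) := ball (map_mx ratr q : 'rV[R]_n) (k.+1%:R^-1).
pose B2 (q : 'rV[rat]_n) (k : nat) := ball (map_mx ratr q : 'rV[R]_n) (k.+1%:R^-1 + k.+1%:R^-1).
have neg q k : B2 q k `<=` Omega -> mu.-negligible (Omega `&` B q k `&` [set x | a x != 0]).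
  move=> sO; have k0 : (0 : R) < k.+1%:R^-1 by rewrite invr_gt0.
  have := orthogonal_bump (real_test_bump k0 sO).
  apply: negligibleS => x [[Ox [_ Bx]] /= ax]; rewrite /= not_implyP; split=> //=.
  rewrite patchE mem_set//= => -[/eqP]; rewrite mulf_eq0 (negPf ax) /= gt_eqF//.
  apply: bump_gt0 => i; have := Bx ord0 i.
  by rewrite /ball /= distrC.
(* The rational balls, enumerated by the natural numbers. *)
pose F (j : nat) : set 'rV[R]_n := if unpickle j is Some (q, k) then
  [set x | B2 q k `<=` Omega /\ (Omega `&` B q k `&` [set x | a x != 0]) x] else set0.
have nF j : mu.-negligible (F j).
  rewrite /F; case: unpickle => [[q k]|]; last exact: negligible_set0.
  have [sO|sO] := pselect (B2 q k `<=` Omega).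
    by apply: negligibleS (neg q k sO) => x [].
  by apply: negligibleS (negligible_set0 mu) => x [/sO].
have := negligible_bigcup nF; apply: negligibleS => x /= /not_implyP[Ox /= ax].
have [q [k [Bx sO]]] := open_rational_balls oO Ox.
exists (pickle (q, k)) => //; rewrite /F pickleK; split=> //; split=> //=.
by apply: contra_notN ax => /eqP ->.
Qed.

Lemma orthogonal_sqr0 : \int[mu]_(x in Omega) (a x ^+ 2) = 0.
Proof.
have [ma _] := La.
rewrite /Rintegral (_ : (\int[mu]_(x in Omega) (a x ^+ 2)%:E = 0)%E)//.
rewrite (@ge0_ae_eq_integral _ _ _ mu Omega _ (cst 0%E)) ?integral0//.
- by apply/measurable_EFinP; exact: measurable_funX.
- by move=> x _; rewrite lee_fin sqr_ge0.
- have := orthogonal_null; apply: filterS => x h Ox; have := h Ox => -[/= ->].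
  by rewrite expr0n.
Qed.

End Orthogonal.

Lemma test_dense (f : 'rV[R]_n -> R[i]) : square_integrable Omega f ->
  (forall phi, test_fun Omega phi -> form_L2 Omega f phi = 0) ->
  complex.Re (form_L2 Omega f f) = 0.
Proof.
move=> sf f0; have [L1 L2'] := (square_integrableP mO _).1 sf.
have tphi (phi : 'rV[R]_n -> R) : real_test phi -> test_fun Omega (fun x => (phi x)%:C).
  move=> [sp cp tp]; have e0 x : phi x = 0 -> (phi x)%:C = 0 by move=> ->.
  split; first by split=> //=; exact: smooth_cst.
    exact: compact_tsupportS e0 cp.
  exact: subset_trans (tsupportS e0) tp.
have h (phi : 'rV[R]_n -> R) : real_test phi -> 
    \int[mu]_(x in Omega) (complex.Re (f x) * phi x) = 0 /\
    \int[mu]_(x in Omega) (complex.Im (f x) * phi x) = 0.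
  move=> /tphi/f0; rewrite /form_L2 /cintegral => -[e1 e2]; split.
    rewrite -[RHS]e1; apply: eq_Rintegral => x _; case: (f x) => ? ? /=; ring.
  rewrite -[RHS]e2; apply: eq_Rintegral => x _; case: (f x) => ? ? /=; ring.
rewrite form_L2_sqr// !orthogonal_sqr0 ?addr0// => phi /h[] //.
Qed.

End Density.

(** * Functions of time and space *)

Section SpaceTime.
Context {R : realType} {n : nat}.
Local Notation W := (R * 'rV[R]_n)%type.
Local Notation mu := (lebesgue_rV R n).
Local Notation leb := (@lebesgue_measure R).
Local Notation e_ i := (delta_mx ord0 i : 'rV[R]_n).

(** Test functions on the half-cylinder keep away from s = 0, where the kernel
    may be singular; the number a records by how much. *)
Definition confined (V : zmodType) (a M : R) (f : W -> V) :=
  forall z, z.1 < a \/ M < z.1 \/ ~ box M z.2 -> f z = 0.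

Lemma open_unconfined (a M : R) : open [set z : W | z.1 < a \/ M < z.1 \/ ~ box M z.2].
Proof.
have o1 : open [set z : W | z.1 < a].
  apply: (@open_comp _ _ fst [set x : R | x < a]); last exact: open_lt.
  by move=> z _; exact: cvg_fst.
have o2 : open [set z : W | M < z.1].
  apply: (@open_comp _ _ fst [set x : R | M < x]); last exact: open_gt.
  by move=> z _; exact: cvg_fst.
have o3 : open [set z : W | ~ box M z.2].
  apply: (@open_comp _ _ snd (~` box M)); last exact: box_openC.
  by move=> z _; exact: cvg_snd.
exact: openU o1 (openU o2 o3).
Qed.

Lemma confined_derive a M (f : W -> R) v : confined a M f ->
  confined a M (fun z => 'D_v f z).
Proof.
move=> cf z hz; rewrite -(derive_cst (0 : R) z v); apply: near_eq_derive.
have := open_nbhs_nbhs (conj (@open_unconfined a M) hz).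
by apply: filterS => y /cf.
Qed.

Lemma slice_continuous (s : R) : continuous (fun y : 'rV[R]_n => (s, y) : W).
Proof.
move=> y A [[U V] /= [nU nV] sUV]; apply: filterS nV => z Vz; apply: sUV.
by split=> //=; exact: nbhs_singleton nU.
Qed.

Lemma slice_time_continuous (y : 'rV[R]_n) : continuous (fun s : R => (s, y) : W).
Proof.
move=> s A [[U V] /= [nU nV] sUV]; apply: filterS nU => z Uz; apply: sUV.
by split=> //=; exact: nbhs_singleton nV.
Qed.

Lemma slice_affine (s : R) (x v : 'rV[R]_n) (h : R) :
  ((s, h *: v + x) : W) = h *: ((0, v) : W) + ((s, x) : W).
Proof. by congr pair; rewrite /= /GRing.scale /= mulr0 add0r. Qed.

Lemma smooth_slice (f : W -> R) s : smooth f -> smooth (fun y => f (s, y)).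
Proof.
apply: (smooth_affine (l := fun y => (s, y) : W) (L := fun v => (0, v) : W)).
  exact: slice_continuous.
exact: slice_affine.
Qed.

Lemma derive_slice (f : W -> R) s x v : 'D_v (fun y => f (s, y)) x = 'D_((0, v) : W) f (s, x).
Proof. by have [_ <-] := derive_affine f (@slice_affine s) x v. Qed.

Lemma smooth_fst (f : R -> R) : smooth f -> smooth (fun z : W => f z.1).
Proof.
apply: (smooth_affine (l := fst : W -> R) (L := fst : W -> R)) => // z.
exact: cvg_fst.
Qed.

Lemma smooth_snd (f : 'rV[R]_n -> R) : smooth f -> smooth (fun z : W => f z.2).
Proof.
apply: (smooth_affine (l := snd : W -> 'rV[R]_n) (L := snd : W -> 'rV[R]_n)) => // z.
exact: cvg_snd.
Qed.

Lemma csmooth_slice (u : W -> R[i]) s : csmooth u -> csmooth (fun y => u (s, y)).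
Proof. by move=> [u1 u2]; split; [exact: smooth_slice u1|exact: smooth_slice u2]. Qed.

Lemma csmooth_snd (u : 'rV[R]_n -> R[i]) : csmooth u -> csmooth (fun z : W => u z.2).
Proof. by move=> [u1 u2]; split; [exact: smooth_snd u1|exact: smooth_snd u2]. Qed.

Definition Cc2 (F : W -> R) := continuous F /\ exists a M, confined a M F.

Lemma confined_compact (a M : R) : compact (`[a, M]%classic `*` @box R n M).
Proof. by apply: compact_setX; [exact: segment_compact|exact: box_compact]. Qed.

Lemma unconfinedP a M (z : W) : ~ (`[a, M]%classic `*` box M) z ->
  z.1 < a \/ M < z.1 \/ ~ box M z.2.
Proof.
rewrite /= in_itv /=; have [h1|h1] := ltP z.1 a; first by left.
have [h2|h2] := ltP M z.1; first by right; left.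
by move=> h; right; right => h3; apply: h.
Qed.

Lemma continuous_bounded_on (F : W -> R) (A : set W) : continuous F -> compact A ->
  exists2 B, 0 <= B & forall z, A z -> `|F z| <= B.
Proof.
move=> cF cA.
have cfb : compact (F @` A).
  by apply: continuous_compact; [exact: continuous_subspaceT|].
have /pinfty_ex_gt0[B B0 fB] := compact_bounded cfb.
by exists B; [exact: ltW|move=> z Az; apply: fB; exists z].
Qed.

Lemma Cc2_bounded (F : W -> R) : Cc2 F -> exists2 B, 0 <= B & forall z, `|F z| <= B.
Proof.
move=> [cF [a [M h]]]; have [B B0 FB] := continuous_bounded_on cF (@confined_compact a M).
exists B => // z; have [|/(@unconfinedP a M _)/h ->] := pselect ((`[a, M]%classic `*` box M) z).
  exact: FB.
by rewrite normr0.
Qed.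

Variable Omega : set 'rV[R]_n.
Hypothesis mO : measurable Omega.
Hypothesis bO : bounded_set Omega.

Lemma Omega_finite : (mu Omega < +oo)%E.
Proof.
have [M OM] := bounded_box bO; apply: le_lt_trans (@box_finite R n M).
by apply: le_measure; rewrite ?inE//; exact: measurable_box.
Qed.

Lemma cst_integrable (B : R) : rintegrable mu Omega (fun=> B).
Proof.
apply: measurable_bounded_integrable => //; first exact: Omega_finite.
by exists `|B|; split; [exact: num_real|move=> r Br x _; exact: ltW].
Qed.

(** Dominated convergence, constants being integrable on the bounded set
    Omega. *)
Lemma param_continuous (F : W -> R) (B : R) : continuous F -> (forall z, `|F z| <= B) ->
  continuous (fun s => \int[mu]_(x in Omega) F (s, x)).
Proof.
move=> cF FB s; apply/continuous_withinNx/cvgr_dnbhsP => u [_ us].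
apply: (Rintegral_dominated mO _ _ (cst_integrable B) _).2.
- move=> k; apply: measurable_funTS; apply: continuous_measurable_rV => y.
  by apply: continuous_comp; [exact: slice_continuous|exact: cF].
- move=> x _; apply: (@cvg_comp _ _ _ u (fun r : R => F (r, x)) _ (nbhs s) _ us).
  have ct := @slice_time_continuous x s.
  exact: (@continuous_comp _ _ _ (fun r : R => (r, x) : W) F s ct (cF _)).
- by move=> k x _; exact: FB.
Qed.

Lemma time_integrable (f : R -> R) (a M : R) D : continuous f ->
  (forall s, s < a \/ M < s -> f s = 0) -> measurable D -> rintegrable leb D f.
Proof.
move=> cf h mD; apply: (@integrableS _ _ _ _ setT) => //.
have mi : measurable (`[a, M]%classic : set (measurableTypeR R)) by exact: measurable_itv.
have -> : EFin \o f = (EFin \o f) \_ (`[a, M]%classic : set R).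
  apply/funext => s; rewrite patchE; case: ifPn => //; rewrite notin_setE => ns.
  rewrite /= h//; rewrite /= in_itv /= in ns.
  have [h1|h1] := ltP s a; first by left.
  have [h2|h2] := ltP M s; first by right.
  by case: ns; rewrite h1 h2.
apply/(@integrable_mkcond _ _ _ leb _ (EFin \o f) mi).
have /pinfty_ex_gt0[B B0 fB] : bounded_set (f @` `[a, M]%classic).
  apply: compact_bounded; apply: continuous_compact; last exact: segment_compact.
  exact: continuous_subspaceT.
apply: measurable_bounded_integrable => //.
- exact: (itv_finite a M).
- by apply: measurable_funTS; exact: continuous_measurable_fun.
- exists B; split; first exact: num_real.
  by move=> r Br x ax; apply: le_trans (ltW Br); apply: fB; exists x.
Qed.

Lemma Cc2_integrable (F : W -> R) D : Cc2 F -> measurable D ->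
  continuous (fun s => \int[mu]_(x in Omega) F (s, x)) /\
  rintegrable leb D (fun s => \int[mu]_(x in Omega) F (s, x)).
Proof.
move=> cF mD; have [B B0 FB] := Cc2_bounded cF; case: cF => cF [a [M h]].
have cI := param_continuous cF FB; split=> //.
apply: (time_integrable (a := a) (M := M) cI) => // s hs.
have e x : F (s, x) = 0 by apply: h; case: hs => ?; [left|right; left].
under eq_Rintegral do rewrite e.
by rewrite /Rintegral integral0.
Qed.

End SpaceTime.

(** * The form of M *)

Section MemoryForm.
Context {R : realType} {n : nat}.
Local Notation W := (R * 'rV[R]_n)%type.
Local Notation mu := (lebesgue_rV R n).
Local Notation leb := (@lebesgue_measure R).
Local Notation e_ i := (delta_mx ord0 i : 'rV[R]_n).
Local Notation sl u s := (fun y : 'rV[R]_n => u (s, y)).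
Local Notation re u := (fun x => complex.Re (u x)).
Local Notation im u := (fun x => complex.Im (u x)).

Definition gdot (u v : W -> R[i]) (z : W) : R[i] :=
  cdot (grad (sl u z.1) z.2) (grad (sl v z.1) z.2).

Lemma gdot_Re (u v : W -> R[i]) z : complex.Re (gdot u v z) =
  \sum_i ('D_((0, e_ i) : W) (re u) z * 'D_((0, e_ i) : W) (re v) z +
          'D_((0, e_ i) : W) (im u) z * 'D_((0, e_ i) : W) (im v) z).
Proof.
case: z => s x; rewrite /gdot cdot_Re; apply: eq_bigr => i _.
rewrite !mxE /=.
by rewrite (derive_slice (re u)) (derive_slice (im u)) (derive_slice (re v)) (derive_slice (im v)).
Qed.

Lemma gdot_Im (u v : W -> R[i]) z : complex.Im (gdot u v z) =
  \sum_i ('D_((0, e_ i) : W) (im u) z * 'D_((0, e_ i) : W) (re v) z -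
          'D_((0, e_ i) : W) (re u) z * 'D_((0, e_ i) : W) (im v) z).
Proof.
case: z => s x; rewrite /gdot cdot_Im; apply: eq_bigr => i _.
rewrite !mxE /=.
by rewrite (derive_slice (re u)) (derive_slice (im u)) (derive_slice (re v)) (derive_slice (im v)).
Qed.

Lemma gdot_continuous (u v : W -> R[i]) : csmooth u -> csmooth v ->
  continuous (fun z => complex.Re (gdot u v z)) /\
  continuous (fun z => complex.Im (gdot u v z)).
Proof.
move=> [u1 u2] [v1 v2]; split; apply: smooth_continuous.
  under eq_fun do rewrite gdot_Re; apply: smooth_sum => i.
  by apply: smoothD; apply: smoothM; exact: smooth_derive.
under eq_fun do rewrite gdot_Im; apply: smooth_sum => i.
by apply: smoothB; apply: smoothM; exact: smooth_derive.
Qed.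

Lemma confined_ReIm a M (u : W -> R[i]) : confined a M u ->
  confined a M (re u) /\ confined a M (im u).
Proof. by move=> cu; split=> z /cu ->. Qed.

Lemma gdot_confined a M (u v : W -> R[i]) : confined a M u ->
  confined a M (fun z => complex.Re (gdot u v z)) /\
  confined a M (fun z => complex.Im (gdot u v z)).
Proof.
move=> /confined_ReIm[c1 c2]; split=> z hz.
  rewrite gdot_Re big1// => i _.
  by rewrite (confined_derive _ c1 hz) (confined_derive _ c2 hz) !mul0r addr0.
rewrite gdot_Im big1// => i _.
by rewrite (confined_derive _ c1 hz) (confined_derive _ c2 hz) !mul0r subr0.
Qed.

Lemma gdot_linear a (u v w : W -> R[i]) z : csmooth u -> csmooth v ->
  gdot (fun z => a * u z + v z) w z = a * gdot u w z + gdot v w z.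
Proof.
move=> su sv; rewrite /gdot grad_linear; [|exact: csmooth_slice..].
by rewrite cdot_linear.
Qed.

Variable Omega : set 'rV[R]_n.
Hypothesis mO : measurable Omega.
Hypothesis bO : bounded_set Omega.
Variables (p : R) (m g : W -> R).
Hypothesis sg : smooth g.
Hypothesis mg : forall z, 0 <= z.1 -> m z = g z.
Hypothesis m0 : forall z, 0 <= z.1 -> 0 <= m z.

Local Notation testM := (test_fun (half_cylinder Omega)).
Local Notation formM := (form_M Omega p m).

(** On the compact support the time coordinate has a positive minimum. *)
Lemma testM_confined u : testM u -> exists a M, 0 < a /\ confined a M u.
Proof.
move=> [su cu tu].
have [K0 | K0] := pselect (tsupport u !=set0); last first.
  exists 1, 1; split=> // z _; apply: tsupport0 => hz; apply: K0; by exists z.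
have cfst : continuous (fst : W -> R) by move=> z; exact: cvg_fst.
have csnd : continuous (snd : W -> 'rV[R]_n) by move=> z; exact: cvg_snd.
have [z0 z0K z0min] := compact_EVT_min K0 cu (continuous_subspaceT cfst).
have [M1 M1P] : exists M1, forall z, tsupport u z -> z.1 <= M1.
  have [B B0 h] := continuous_bounded_on cfst cu.
  by exists B => z /h; apply: le_trans; exact: ler_norm.
have [M2 M2P] : exists M2, snd @` tsupport u `<=` box M2.
  apply: compact_box; apply: continuous_compact => //.
  exact: continuous_subspaceT.
exists z0.1, (Num.max M1 M2); split.
  by have [] := tu z0 (set_mem z0K).
move=> z hz; apply: tsupport0 => tz; case: hz => [h|[h|h]].
- by have := z0min z (mem_set tz); rewrite leNgt h.
- by move: h; rewrite gt_max => /andP[]; rewrite ltNge M1P.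
- apply: h; apply: boxS (M2P _ _); first by rewrite le_max lexx orbT.
  by exists z.
Qed.

(** The kernel, modified near s = 0 so as to be continuous. *)
Definition kap (a : R) (z : W) : R := Num.max z.1 a `^ (p - 1) * g z.

Lemma kap_continuous a : 0 < a -> continuous (kap a).
Proof.
move=> a0 z; apply: cvgM; last exact: smooth_continuous.
apply: (@continuous_comp _ _ _ (fun z : W => Num.max z.1 a) (fun r : R => r `^ (p - 1))).
  by apply: (@continuous_max _ _ (fst : W -> R) (fun=> a)); [exact: cvg_fst|exact: cvg_cst].
have c0 : 0 < Num.max z.1 a by rewrite lt_max a0 orbT.
apply: differentiable_continuous; apply/derivable1_diffP.
by have [] := is_derive1_powR (p - 1) c0.
Qed.

Lemma kapE a s x : 0 < a -> a <= s -> kap a (s, x) = memory_kernel p m s x.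
Proof.
move=> a0 sa; rewrite /kap /memory_kernel /= mg/= ?(le_trans (ltW a0))//.
by rewrite max_l.
Qed.

Lemma kernel_ge0 s x : 0 <= s -> 0 <= memory_kernel p m s x.
Proof. by move=> s0; rewrite /memory_kernel mulr_ge0 ?powR_ge0 ?m0. Qed.

(** The integrand in time of [form_M]. *)
Definition form_density (u v : W -> R[i]) (s : R) : R[i] :=
  cintegral mu Omega (fun x => (memory_kernel p m s x)%:C * gdot u v (s, x)).

Lemma form_ME u v : formM u v = cintegral leb `]0, +oo[%classic (form_density u v).
Proof. by []. Qed.

Lemma ReZ (k : R) (w : R[i]) : complex.Re (k%:C * w) = k * complex.Re w.
Proof. by case: w => ? ? /=; ring. Qed.

Lemma ImZ (k : R) (w : R[i]) : complex.Im (k%:C * w) = k * complex.Im w.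
Proof. by case: w => ? ? /=; ring. Qed.

Lemma inner_kap a M u v s : 0 < a -> confined a M u -> 0 < s ->
  form_density u v s = (\int[mu]_(x in Omega) (kap a (s, x) * complex.Re (gdot u v (s, x)))) +i*
                (\int[mu]_(x in Omega) (kap a (s, x) * complex.Im (gdot u v (s, x)))).
Proof.
move=> a0 cu s0; have [c1 c2] := gdot_confined v cu.
rewrite /form_density /cintegral; congr (_ +i* _); apply: eq_Rintegral => x _.
  rewrite ReZ; have [sa|sa] := leP a s; first by rewrite kapE.
  by rewrite c1 ?mulr0//; left.
rewrite ImZ; have [sa|sa] := leP a s; first by rewrite kapE.
by rewrite c2 ?mulr0//; left.
Qed.

Lemma Cc2_kap a M u v : 0 < a -> csmooth u -> confined a M u -> csmooth v ->
  Cc2 (fun z => kap a z * complex.Re (gdot u v z)) /\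
  Cc2 (fun z => kap a z * complex.Im (gdot u v z)).
Proof.
move=> a0 su cu sv; have [c1 c2] := gdot_continuous su sv.
have [d1 d2] := gdot_confined v cu; have ck := kap_continuous a0.
split; split.
- by move=> z; exact: (cvgM (ck z) (c1 z)).
- by exists a, M => z /d1 ->; rewrite mulr0.
- by move=> z; exact: (cvgM (ck z) (c2 z)).
- by exists a, M => z /d2 ->; rewrite mulr0.
Qed.

Lemma mI : measurable (`]0, +oo[%classic : set (measurableTypeR R)).
Proof. exact: measurable_itv. Qed.

Lemma inner_cintegrable u v : testM u -> csmooth v ->
  cintegrable leb `]0, +oo[%classic (form_density u v).
Proof.
move=> tu sv; have [a [M [a0 cu]]] := testM_confined tu; have [su _ _] := tu.
have [k1 k2] := Cc2_kap a0 su cu sv.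
have e s : `]0, +oo[%classic s -> form_density u v s = 
    (\int[mu]_(x in Omega) (kap a (s, x) * complex.Re (gdot u v (s, x)))) +i*
    (\int[mu]_(x in Omega) (kap a (s, x) * complex.Im (gdot u v (s, x)))).
  by rewrite /= in_itv /= andbT => s0; exact: (inner_kap v a0 cu s0).
split.
  apply: (eq_rintegrable mI _ (Cc2_integrable mO bO k1 mI).2).
  by move=> s /e ->.
apply: (eq_rintegrable mI _ (Cc2_integrable mO bO k2 mI).2).
by move=> s /e ->.
Qed.

Lemma inner_integrand u v s : testM u -> csmooth v -> 0 < s ->
  cintegrable mu Omega (fun x => (memory_kernel p m s x)%:C * gdot u v (s, x)).
Proof.
move=> tu sv s0; have [a [M [a0 cu]]] := testM_confined tu; have [su _ _] := tu.
have cg : continuous (fun x => s `^ (p - 1) * g (s, x)).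
  apply: smooth_continuous; apply: smoothZ; exact: smooth_slice.
have bs : bounded_support (sl u s) by exists M => x xM; apply: cu; right; right.
have := Cc_wgrad_cintegrable mO cg (csmooth_slice s su) (csmooth_slice s sv) bs.
apply: (eq_cintegrable mO) => x _.
by rewrite /wgrad /memory_kernel mg//= ltW.
Qed.

Lemma hermitian_form_M : hermitian_form testM formM.
Proof.
split.
- exact: test_fun0.
- exact: test_fun_linear.
- move=> a u v w tu tv tw; have [su _ _] := tu; have [sv _ _] := tv; have [sw _ _] := tw.
  rewrite !form_ME -(cintegral_linear mI); [|exact: inner_cintegrable..].
  apply: eq_cintegral => s; rewrite /= in_itv /= andbT => s0.
  rewrite /form_density -(cintegral_linear mO); [|exact: inner_integrand..].
  by apply: eq_cintegral => x _; rewrite gdot_linear//; ring.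
- move=> u v tu tv; have [su _ _] := tu; have [sv _ _] := tv.
  rewrite !form_ME -(cintegral_conj mI); last exact: inner_cintegrable.
  apply: eq_cintegral => s; rewrite /= in_itv /= andbT => s0.
  rewrite /form_density -(cintegral_conj mO); last exact: inner_integrand.
  apply: eq_cintegral => x _; rewrite /gdot [RHS]rmorphM /= cdot_conj; congr (_ * _).
  by apply/eqP; rewrite eq_complex /= ?oppr0 !eqxx.
- move=> u tu; rewrite form_ME /cintegral /=; apply: Rintegral_ge0 => s.
  rewrite /= in_itv /= andbT => s0; apply: Rintegral_ge0 => x _.
  by rewrite ReZ mulr_ge0 ?cdot_ge0// kernel_ge0// ltW.
Qed.

End MemoryForm.

(** * The shift semigroup *)

Section Translation.
Context {R : realType} {n : nat}.
Local Notation W := (R * 'rV[R]_n)%type.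
Local Notation mu := (lebesgue_rV R n).
Local Notation leb := (@lebesgue_measure R).
Local Notation e_ i := (delta_mx ord0 i : 'rV[R]_n).
Local Notation re u := (fun x => complex.Re (u x)).
Local Notation im u := (fun x => complex.Im (u x)).

Lemma le_substs (x y x' y' : R) : x = x' -> y = y' -> x' <= y' -> x <= y.
Proof. by move=> -> ->. Qed.

Definition translate (t : R) (z : W) : W := (z.1 - t, z.2).

Lemma translate_continuous t : continuous (translate t).
Proof.
move=> z; have c1 : (fun z : W => z.1 - t) @ z --> z.1 - t.
  by apply: cvgB; [exact: cvg_fst|exact: cvg_cst].
move=> A [[U V] /= [nU nV] sUV].
have n1 : \forall y \near z, U (y.1 - t) by exact: c1 nU.
have n2 : \forall y \near z, V y.2 by exact: (@cvg_snd _ _ (nbhs z.1) (nbhs z.2) _ _ nV).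
by near=> y; apply: sUV; split=> /=; near: y.
Unshelve. all: by end_near. Qed.

Lemma translate_affine t (x v : W) (h : R) : translate t (h *: v + x) = h *: v + translate t x.
Proof. by congr pair; rewrite /= -addrA. Qed.

Lemma smooth_translate t (f : W -> R) : smooth f -> smooth (f \o translate t).
Proof.
apply: (smooth_affine (L := id)); first exact: translate_continuous.
exact: translate_affine.
Qed.

Lemma derive_translate t (f : W -> R) z v : 'D_v (f \o translate t) z = 'D_v f (translate t z).
Proof. by have [_ ->] := derive_affine f (L := id) (@translate_affine t) z v. Qed.

Lemma time_slice_affine (y : 'rV[R]_n) (r v h : R) :
  ((h *: v + r, y) : W) = h *: ((v, 0) : W) + ((r, y) : W).
Proof. by congr pair; rewrite /= scaler0 add0r. Qed.

Lemma is_derive_time (f : W -> R) (x : 'rV[R]_n) (r : R) : smooth f ->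
  is_derive r (1 : R) (fun r : R => f (r, x)) ('D_((1, 0) : W) f (r, x)).
Proof.
move=> sf; have [h1 h2] := derive_affine f (l := fun r : R => (r, x) : W) (L := fun v : R => (v, 0) : W) (@time_slice_affine x) r (1 : R).
by apply: DeriveDef => //; apply: h1; exact: smooth_derivable.
Qed.

Lemma time_mvt (f : W -> R) (x : 'rV[R]_n) (r s : R) : smooth f -> r <= s ->
  exists2 c, r <= c <= s & f (s, x) - f (r, x) = 'D_((1, 0) : W) f (c, x) * (s - r).
Proof.
move=> sf rs; have ct : {within `[r, s], continuous (fun r => f (r, x))}.
  apply: continuous_subspaceT => y; apply: (@continuous_comp _ _ _ (fun r : R => (r, x) : W) f).
    exact: slice_time_continuous.
  exact: smooth_continuous.
have [c + e] := MVT_segment rs (fun y _ => is_derive_time x y sf) ct.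
by rewrite in_itv /= => h; exists c.
Qed.

(** By the mean value theorem, applied to f and then to its time derivative,
    each quotient is within C h of minus the time derivative. *)
Lemma quotient_cauchy a M (f : W -> R) : smooth f -> confined a M f ->
  exists2 C, 0 <= C & forall h k z, 0 < h -> 0 < k ->
  `|h^-1 * (f (translate h z) - f z) - k^-1 * (f (translate k z) - f z)| <= C * (h + k).
Proof.
move=> sf cf; pose f1 z := 'D_((1, 0) : W) f z; pose f2 z := 'D_((1, 0) : W) f1 z.
have sf1 : smooth f1 by exact: smooth_derive.
have cf2 : Cc2 f2.
  split; first exact/smooth_continuous/smooth_derive.
  by exists a, M; do 2 apply: confined_derive.
have [C C0 f2C] := Cc2_bounded cf2; exists C => // h k z h0 k0.
have key l : 0 < l -> `|l^-1 * (f (translate l z) - f z) + f1 z| <= C * l.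
  case: z => s x l0; rewrite /translate /=; have sl : s - l <= s by rewrite gerBl ltW.
  have [c /andP[c1 c2]] := time_mvt x sf sl; rewrite -/(f1 _) (_ : s - (s - l) = l) => [e1|]; last by ring.
  have [c' _] := time_mvt x sf1 c2; rewrite -/(f2 _) => e2.
  have -> : l^-1 * (f (s - l, x) - f (s, x)) + f1 (s, x) = f1 (s, x) - f1 (c, x).
    have -> : f (s - l, x) - f (s, x) = - (f1 (c, x) * l) by rewrite -e1 opprB.
    by field; rewrite gt_eqF.
  rewrite e2 normrM ler_pM//; rewrite ger0_norm; lra.
have -> : h^-1 * (f (translate h z) - f z) - k^-1 * (f (translate k z) - f z) =
  (h^-1 * (f (translate h z) - f z) + f1 z) - (k^-1 * (f (translate k z) - f z) + f1 z) by ring.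
by apply: le_trans (ler_normB _ _) _; rewrite [C * _]mulrDr; apply: lerD; exact: key.
Qed.

Lemma derive_quotient h k (f : W -> R) z v : smooth f ->
  'D_v (fun z => h^-1 * (f (translate h z) - f z) - k^-1 * (f (translate k z) - f z)) z =
  h^-1 * ('D_v f (translate h z) - 'D_v f z) - k^-1 * ('D_v f (translate k z) - 'D_v f z).
Proof.
move=> sf; have -> : (fun z => h^-1 * (f (translate h z) - f z) - k^-1 * (f (translate k z) - f z)) =
    fun z => h^-1 * (f \o translate h) z + (- k^-1) * (f \o translate k) z + (k^-1 - h^-1) * f z.
  by apply/funext => y /=; ring.
rewrite derive_lin3; [|exact: smooth_translate..|exact: smoothZ].
rewrite !derive_translate (_ : 'D_v (fun y => (k^-1 - h^-1) * f y) z = (k^-1 - h^-1) * 'D_v f z).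
  by ring.
exact: (deriveZ (k^-1 - h^-1) (@smooth_derivable _ _ f z v sf)).
Qed.

Lemma Cc2_slice (F : W -> R) s : Cc2 F -> Cc (fun x => F (s, x)).
Proof.
move=> [cF [a [M h]]]; split.
  move=> x; apply: (@continuous_comp _ _ _ (fun x : 'rV[R]_n => (s, x) : W) F).
    exact: slice_continuous.
  exact: cF.
by exists M => x xM; apply: h; right; right.
Qed.

Lemma Rintegral_translate (G : R -> R) t : continuous G -> (forall x, 0 <= G x) ->
  \int[leb]_x G x = \int[leb]_x G (x + t).
Proof.
move=> cG G0; have d x : is_derive x (1 : R) (fun x : R => x + t) 1.
  by apply: is_derive_eq; rewrite addr0.
have dE : (fun x : R => x + t)^`()%classic = cst 1.
  by apply/funext => x; rewrite derive1E; exact: derive_val.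
rewrite /Rintegral (@increasing_ge0_integration_by_substitutionT _ (fun x => x + t) G)//.
- by congr fine; apply: eq_integral => x _; rewrite dE !fctE mulr1.
- by move=> x y xy; rewrite ltrD2r.
- by rewrite dE; exact: cst_continuous.
- by rewrite dE; exact: is_cvg_cst.
- by rewrite dE; exact: is_cvg_cst.
- exact: cvg_addrr_Ny.
- exact: cvg_addrr.
Qed.

Variable Omega : set 'rV[R]_n.
Hypothesis mO : measurable Omega.
Hypothesis bO : bounded_set Omega.
Variables (p : R) (m g : W -> R).
Hypothesis sg : smooth g.
Hypothesis mg : forall z, 0 <= z.1 -> m z = g z.
Hypothesis m0 : forall z, 0 <= z.1 -> 0 <= m z.

Local Notation testM := (test_fun (half_cylinder Omega)).
Local Notation formM := (form_M Omega p m).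

(** Since u vanishes for s <= 0, the zero-filled shift is a translation, and
    is therefore smooth. *)
Lemma right_shiftE t u : testM u -> right_shift t u = u \o translate t.
Proof.
move=> [_ _ tu]; apply/funext => z; rewrite /right_shift /= /translate.
case: ifPn => // zt; apply/esym/tsupport0 => /tu[/=].
by rewrite subr_gt0 ltNge zt.
Qed.

Lemma testM_shift t u : 0 <= t -> testM u -> testM (right_shift t u).
Proof.
move=> t0 tu'; rewrite right_shiftE//; have [[u1 u2] cu tu] := tu'.
have s1 : tsupport (u \o translate t) `<=` translate t @^-1` tsupport u.
  rewrite {1}/tsupport.
  have cl : closed (translate t @^-1` tsupport u).
    by apply: (iffLR (@continuous_closedP _ _ (translate t)) (@translate_continuous t)); exact: closed_closure.
  rewrite [X in _ `<=` X](closure_id _).1//; apply: closureS => z /= uz.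
  exact: subset_closure.
split.
- by split; [exact: (smooth_translate t u1)|exact: (smooth_translate t u2)].
- apply: (@subclosed_compact _ _ (translate (- t) @` tsupport u)); first exact: closed_closure.
    apply: continuous_compact => //; apply: continuous_subspaceT.
    exact: translate_continuous.
  move=> z /s1 tz; exists (translate t z) => //.
  by case: (z) => a b; rewrite /translate /= opprK subrK.
- move=> z /s1/tu[/=]; rewrite subr_gt0 => tz Oz; split=> //.
  exact: le_lt_trans tz.
Qed.

Lemma gdot_translate t (u v : W -> R[i]) z :
  gdot (u \o translate t) (v \o translate t) z = gdot u v (translate t z).
Proof. by []. Qed.

Hypothesis kernel_decr : forall (s : R) (x : 'rV[R]_n), 0 < s ->
  derive1 (fun r => memory_kernel p m r x) s <= 0.

Lemma kernel_derivable (s : R) (x : 'rV[R]_n) : 0 < s ->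
  derivable (fun r => memory_kernel p m r x) s 1.
Proof.
move=> s0; apply: (near_eq_derivable (f := fun r : R => r `^ (p - 1) * g (r, x))).
  near=> r; rewrite /memory_kernel mg//=.
  by apply: ltW; near: r; exact: lt_nbhsr.
apply: derivableM; first by have [] := is_derive1_powR (p - 1) s0.
by have [] := is_derive_time x s sg.
Unshelve. all: by end_near. Qed.

Lemma kernel_le (s t : R) (x : 'rV[R]_n) : 0 < s -> 0 <= t ->
  memory_kernel p m (s + t) x <= memory_kernel p m s x.
Proof.
move=> s0 t0; apply: (@ler0_derive1_nincr _ (fun r => memory_kernel p m r x) s (s + t)).
- move=> r; rewrite in_itv /= => /andP[sr _]; apply: kernel_derivable.
  exact: lt_trans sr.
- move=> r; rewrite in_itv /= => /andP[sr _]; apply: kernel_decr.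
  exact: lt_trans sr.
- apply: derivable_within_continuous => r; rewrite in_itv /= => /andP[sr _].
  by apply: kernel_derivable; exact: lt_le_trans sr.
- by [].
- by rewrite lerDl.
- by [].
Qed.

Let Phi a u s := \int[mu]_(x in Omega) (kap p g a (s, x) * complex.Re (gdot u u (s, x))).

Lemma form_M_Phi a M u : 0 < a -> csmooth u -> confined a M u ->
  [/\ complex.Re (formM u u) = \int[leb]_s Phi a u s, continuous (Phi a u),
      forall s, 0 <= Phi a u s & rintegrable leb setT (Phi a u)].
Proof.
move=> a0 su cu; have [k1 _] := Cc2_kap p sg a0 su cu su.
have [h1 h2] := Cc2_integrable mO bO k1 measurableT.
have z s : s <= 0 -> Phi a u s = 0.
  move=> s0; rewrite /Phi.
  have e x : kap p g a (s, x) * complex.Re (gdot u u (s, x)) = 0.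
    have [c1 _] := gdot_confined u cu.
    by rewrite c1 ?mulr0//; left; exact: le_lt_trans a0.
  by under eq_Rintegral do rewrite e; rewrite /Rintegral integral0.
have e s : 0 < s -> Phi a u s = complex.Re (form_density Omega p m u u s).
  by move=> s0; rewrite (inner_kap Omega p mg u a0 cu s0).
split=> //.
- rewrite form_ME /cintegral /= Rintegral_mkcond; apply: eq_Rintegral => s _.
  rewrite patchE; case: ifPn => [/set_mem|]; rewrite ?notin_setE /= in_itv /= andbT.
    by move=> /e.
  by move=> /negP; rewrite -leNgt => /z.
- move=> s; have [s0|s0] := leP s 0; first by rewrite z.
  rewrite e//; apply: Rintegral_ge0 => x _.
  by rewrite ReZ mulr_ge0 ?cdot_ge0// kernel_ge0// ltW.
Qed.

Lemma confined_translate (V : zmodType) a M t (u : W -> V) : 0 <= t ->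
  confined a M u -> confined (a + t) (M + t) (u \o translate t).
Proof.
move=> t0 cu z hz; apply: cu => /=; case: hz => [h|[h|h]].
- by left; rewrite ltrBlDr.
- by right; left; rewrite ltrBrDr.
- by right; right; apply: contra_not h; apply: boxS; rewrite lerDl.
Qed.

(** Translate time back: the gradients are unchanged and the kernel is taken
    at the later time s + t, where it is smaller. *)
Lemma shift_contraction t u : 0 <= t -> testM u ->
  complex.Re (formM (right_shift t u) (right_shift t u)) <= complex.Re (formM u u).
Proof.
move=> t0 tu; have [su' _ _] := testM_shift t0 tu; rewrite (right_shiftE t tu) in su' *.
have [su _ _] := tu; have [a [M [a0 cu]]] := testM_confined tu.
have at0 : 0 < a + t by rewrite ltr_wpDr.
have cut := confined_translate t0 cu.
have [e1 c1 g1 i1] := form_M_Phi at0 su' cut.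
have [e0 c0 g0 i0] := form_M_Phi a0 su cu.
apply: (le_substs (etrans e1 (Rintegral_translate t c1 g1)) e0).
have le s : Phi (a + t) (u \o translate t) (s + t) <= Phi a u s.
  have [k1 _] := Cc2_kap p sg a0 su cu su.
  have [k2 _] := Cc2_kap p sg at0 su' cut su'.
  apply: le_Rintegral => //.
  - exact: (Cc_integrable (Cc2_slice (s + t) k2) mO).
  - exact: (Cc_integrable (Cc2_slice s k1) mO).
  move=> x _; rewrite gdot_translate /translate /= addrK.
  have [sa|sa] := leP a s; last first.
    have [d _] := gdot_confined u cu.
    have -> : complex.Re (gdot u u (s, x)) = 0 by apply: d; left.
    by rewrite !mulr0.
  have k3 : kap p g a (s, x) = memory_kernel p m s x by exact: kapE.
  have k4 : kap p g (a + t) (s + t, x) = memory_kernel p m (s + t) x.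
    by apply: kapE; rewrite ?lerD2r.
  rewrite k3 k4; apply: ler_wpM2r; first exact: cdot_ge0.
  exact: (kernel_le x (lt_le_trans a0 sa) t0).
have i2 : rintegrable leb setT (fun s => Phi (a + t) (u \o translate t) (s + t)); last first.
  exact: (le_Rintegral measurableT i2 i0 (fun s _ => le s)).
apply: (time_integrable (a := a) (M := M) _ _ measurableT).
- move=> s; apply: (@continuous_comp _ _ _ (fun s : R => s + t) (Phi (a + t) (u \o translate t))).
    by apply: cvgD; [exact: cvg_id|exact: cvg_cst].
  exact: c1.
- move=> s hs; apply/eqP; rewrite eq_le g1 andbT; apply: le_trans (le s) _.
  have [d _] := gdot_confined u cu.
  have e x : kap p g a (s, x) * complex.Re (gdot u u (s, x)) = 0.
    rewrite (d (s, x)); first by rewrite mulr0.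
    by case: hs => hs; [left|right; left].
  by rewrite /Phi; under eq_Rintegral do rewrite e; rewrite /Rintegral integral0.
Qed.

Lemma form_M_le a M : 0 < a -> exists2 B, 0 <= B & forall w c, testM w -> confined a M w ->
  0 <= c -> (forall z, complex.Re (gdot w w z) <= c) -> complex.Re (formM w w) <= B * c.
Proof.
move=> a0; have [K K0 kK] := continuous_bounded_on (@kap_continuous _ _ p g sg a a0) (@confined_compact R n a M).
pose mm := fine (mu Omega); have mm0 : 0 <= mm by exact: (fine_ge0 (measure_ge0 mu Omega)).
have mi : measurable (`[a, M]%classic : set (measurableTypeR R)) by exact: measurable_itv.
have ii : rintegrable leb setT (\1_(`[a, M]%classic : set (measurableTypeR R))).
  exact: (integrable_indic_itv a M true false).
pose I1 := \int[leb]_s (\1_(`[a, M]%classic : set (measurableTypeR R)) s : R).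
have I10 : 0 <= I1 by apply: Rintegral_ge0 => s _; rewrite indicE.
exists (K * mm * I1); first by rewrite !mulr_ge0.
move=> w c tw cw c0 wc; have [sw _ _] := tw.
have [e1 cP P0 iP] := form_M_Phi a0 sw cw; apply: (le_substs e1 erefl).
have [k1 _] := Cc2_kap p sg a0 sw cw sw.
have [d _] := gdot_confined w cw.
apply: (@le_trans _ _ (\int[leb]_s ((K * mm * c) * \1_(`[a, M]%classic : set (measurableTypeR R)) s))).
  apply: le_Rintegral => //; first exact: rintegrableZ.
  move=> s _; rewrite indicE; case: (boolP (s \in _)) => [_|]; last first.
    rewrite notin_setE /= in_itv /= => ns; rewrite mulr0.
    have e x : kap p g a (s, x) * complex.Re (gdot w w (s, x)) = 0.
      rewrite (d (s, x)); first by rewrite mulr0.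
      rewrite /=; have [h1|h1] := ltP s a; first by left.
      by have [h2|h2] := ltP M s; [right; left|case: ns; rewrite h1 h2].
    by rewrite /Phi; under eq_Rintegral do rewrite e; rewrite /Rintegral integral0.
  rewrite mulr1; have -> : K * mm * c = \int[mu]_(x in Omega) (K * c).
    by rewrite (Rintegral_cst mu mO) -/mm; ring.
  apply: (le_Rintegral mO (Cc_integrable (Cc2_slice s k1) mO) (cst_integrable mO bO _)).
  move=> x _; have [zK|/unconfinedP h] := pselect ((`[a, M]%classic `*` box M) (s, x)); last first.
    by rewrite (d (s, x) h) mulr0 mulr_ge0.
  have kle : kap p g a (s, x) <= K by apply: le_trans (ler_norm _) (kK _ zK).
  exact: (le_trans (ler_wpM2r (cdot_ge0 _) kle) (ler_wpM2l K0 (wc _))).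
rewrite (RintegralZl (K * mm * c) measurableT ii) -/I1.
by rewrite le_eqVlt; apply/orP; left; apply/eqP; ring.
Qed.

(** The pointwise estimate of [quotient_cauchy] for the gradients carries over
    to the form by [form_M_le]. *)
Lemma shift_quotient u : testM u -> exists K d, [/\ 0 <= K, 0 < d &
  forall h k, 0 < h < d -> 0 < k < d ->
  let w z := (h^-1)%:C * (right_shift h u z - u z)
           - (k^-1)%:C * (right_shift k u z - u z) in
  complex.Re (formM w w) <= (K * (h + k)) ^+ 2].
Proof.
move=> tu; have [[u1 u2] _ _] := tu; have [a [M [a0 cu]]] := testM_confined tu.
have [c1 c2] := confined_ReIm cu; have [B B0 hB] := form_M_le (M + 1) a0.
have h1 i := quotient_cauchy (smooth_derive ((0, e_ i) : W) u1) (confined_derive ((0, e_ i) : W) c1).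
have h2 i := quotient_cauchy (smooth_derive ((0, e_ i) : W) u2) (confined_derive ((0, e_ i) : W) c2).
have {h1} h1 i : exists C, forall h k z, 0 < h -> 0 < k ->
    `|h^-1 * ('D_((0, e_ i) : W) (re u) (translate h z) - 'D_((0, e_ i) : W) (re u) z) -
      k^-1 * ('D_((0, e_ i) : W) (re u) (translate k z) - 'D_((0, e_ i) : W) (re u) z)| <= C * (h + k).
  by have [C _ hC] := h1 i; exists C.
have {h2} h2 i : exists C, forall h k z, 0 < h -> 0 < k ->
    `|h^-1 * ('D_((0, e_ i) : W) (im u) (translate h z) - 'D_((0, e_ i) : W) (im u) z) -
      k^-1 * ('D_((0, e_ i) : W) (im u) (translate k z) - 'D_((0, e_ i) : W) (im u) z)| <= C * (h + k).
  by have [C _ hC] := h2 i; exists C.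
have [C1 hC1] := choice h1; have [C2 hC2] := choice h2.
pose C := \sum_i (C1 i ^+ 2 + C2 i ^+ 2).
have C0 : 0 <= C by apply: sumr_ge0 => i _; rewrite addr_ge0 ?sqr_ge0.
exists (Num.sqrt (B * C)), 1; split; [exact: sqrtr_ge0|exact: ltr01|].
move=> h k /andP[hp hd] /andP[kp kd].
pose w z := (h^-1)%:C * (right_shift h u z - u z) - (k^-1)%:C * (right_shift k u z - u z).
suff : complex.Re (formM w w) <= (Num.sqrt (B * C) * (h + k)) ^+ 2 by [].
have wE : w = fun z => (h^-1)%:C * (-1 * u z + right_shift h u z) +
    ((- k^-1)%:C * (-1 * u z + right_shift k u z) + (fun=> 0) z).
  by apply/funext => z; rewrite /w rmorphN /=; ring.
have tw : testM w.
  rewrite wE; apply: test_fun_linear.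
    by apply: test_fun_linear => //; apply: testM_shift => //; exact: ltW.
  apply: test_fun_linear; last exact: test_fun0.
  by apply: test_fun_linear => //; apply: testM_shift => //; exact: ltW.
have wE' z : w z = (h^-1)%:C * (u (translate h z) - u z) - (k^-1)%:C * (u (translate k z) - u z).
  by rewrite /w !(right_shiftE _ tu).
have reB (b c : R) (x y z : R[i]) : complex.Re (b%:C * (x - z) - c%:C * (y - z)) =
    b * (complex.Re x - complex.Re z) - c * (complex.Re y - complex.Re z).
  by case: x y z => [? ?] [? ?] [? ?] /=; ring.
have imB (b c : R) (x y z : R[i]) : complex.Im (b%:C * (x - z) - c%:C * (y - z)) =
    b * (complex.Im x - complex.Im z) - c * (complex.Im y - complex.Im z).
  by case: x y z => [? ?] [? ?] [? ?] /=; ring.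
have rwE : (re w : W -> R) = fun z => h^-1 * (complex.Re (u (translate h z)) - complex.Re (u z)) -
    k^-1 * (complex.Re (u (translate k z)) - complex.Re (u z)).
  by apply/funext => z; rewrite wE' reB.
have iwE : (im w : W -> R) = fun z => h^-1 * (complex.Im (u (translate h z)) - complex.Im (u z)) -
    k^-1 * (complex.Im (u (translate k z)) - complex.Im (u z)).
  by apply/funext => z; rewrite wE' imB.
have cw : confined a (M + 1) w.
  move=> z hz; have u0 l : 0 <= l -> l <= 1 -> u (translate l z) = 0.
    move=> l0 l1; apply: cu; rewrite /translate /=; case: hz => [q|[q|q]].
    - by left; lra.
    - by right; left; lra.
    - by right; right; apply: contra_not q; apply: boxS; lra.
  have uz : u z = 0.
    have := u0 0 (lexx _) ler01; rewrite (_ : translate 0 z = z)//.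
    by case: (z) => ? ?; rewrite /translate /= subr0.
  by rewrite wE' uz !u0 ?ltW// !subr0 !mulr0 subr0.
have := hB w (C * (h + k) ^+ 2) tw cw; rewrite mulr_ge0 ?sqr_ge0// => /(_ isT) hw.
rewrite exprMn sqr_sqrtr ?mulr_ge0// -mulrA; apply: hw => z.
rewrite gdot_Re /C mulr_suml; apply: ler_sum => i _.
have hk0 : 0 <= h + k by rewrite addr_ge0// ltW.
rewrite rwE iwE !derive_quotient// -!expr2 mulrDl -!exprMn.
apply: lerD.
  rewrite -[leLHS]real_normK ?num_real// -[leRHS]real_normK ?num_real// ler_pXn2r ?nnegrE//.
  by apply: le_trans (hC1 i h k z hp kp) _; exact: ler_norm.
rewrite -[leLHS]real_normK ?num_real// -[leRHS]real_normK ?num_real// ler_pXn2r ?nnegrE//.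
by apply: le_trans (hC2 i h k z hp kp) _; exact: ler_norm.
Qed.

End Translation.

(** * Histories constant in time *)

Section Cutoffs.
Context {R : realType}.

Lemma step_near1 (e t : R) : 0 < e -> e^-1 <= t -> `|1 - step t| <= e.
Proof.
move=> e0 et; have t0 : 0 < t by apply: lt_le_trans et; rewrite invr_gt0.
rewrite ger0_norm ?subr_ge0 ?step_le1//; have h := step_ge t0.
have : t^-1 <= e by rewrite -[e]invrK lef_pV2// posrE ?invr_gt0.
lra.
Qed.

(** Supported in [1 / j, j]; at fixed s > 0 both factors tend to 1. *)
Definition cutoff (j : nat) (s : R) : R :=
  step (j%:R * s - 1) * step (j%:R * (j%:R - s)).

Lemma cutoff_support j s : cutoff j s != 0 -> (j > 0)%N /\ j%:R^-1 <= s <= j%:R.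
Proof.
rewrite /cutoff mulf_eq0 negb_or => /andP[h1 h2].
have {}h1 : 0 < j%:R * s - 1 by rewrite -step_gt0 lt_def h1 step_ge0.
have {}h2 : 0 < j%:R * (j%:R - s) by rewrite -step_gt0 lt_def h2 step_ge0.
have j0 : (0 < j)%N by case: j h1 {h2} => //; lra.
have j1 : (0 : R) < j%:R by rewrite ltr0n.
split=> //; rewrite -[j%:R^-1]mul1r ler_pdivrMr// mulrC.
rewrite pmulr_rgt0// in h2; lra.
Qed.

Lemma cutoff_cutoff_seq : cutoff_seq cutoff.
Proof.
have ss (a b : R) : smooth (fun s : R => step (a * s + b)).
  apply: (@smooth_affine _ _ _ step (fun s : R => a * s + b) (fun v => a * v)).
  - have sid : smooth (id : R -> R).
      by move=> k; apply: dc_linear; [move=> x; exact: cvg_id|].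
    exact: (smooth_continuous (smoothD (smoothZ a sid) (@smooth_cst _ _ b))).
  - by move=> x v h; rewrite /GRing.scale /=; ring.
  - exact: smooth_step.
have s1 j : tsupport (cutoff j) `<=` `[j%:R^-1, j%:R]%classic.
  rewrite [X in _ `<=` X](closure_id _).1; last exact: itv_closed.
  by apply: closureS => s /= /cutoff_support[_]; rewrite in_itv.
split.
- move=> j; split.
  + apply: smoothM.
      have := ss j%:R (-1); congr smooth.
    have := ss (- j%:R) (j%:R * j%:R); congr smooth; apply/funext => s.
    by congr step; ring.
  + by apply: subclosed_compact (s1 j); [exact: closed_closure|exact: segment_compact].
  + case: j => [|j].
      have -> : cutoff 0 = fun=> 0.
        apply/funext => s; apply/eqP; apply/negP => /negP/cutoff_support[] //.
      rewrite /tsupport (_ : [set x | _] = set0) ?closure0//.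
      by apply/seteqP; split=> // x /=; rewrite eqxx.
    apply: subset_trans (s1 j.+1) _ => s /=; rewrite !in_itv /= andbT => /andP[h _].
    by apply: lt_le_trans h; rewrite invr_gt0.
- by move=> j s; rewrite mulr_ge0 ?step_ge0//= mulr_ile1 ?step_ge0 ?step_le1.
- move=> s s0; rewrite -[1]mulr1; apply: cvgM; apply/cvgrPdist_le => e e0; near=> j.
    apply: step_near1 => //; rewrite lerBrDr -ler_pdivrMr//.
    by near: j; exact: nbhs_infty_ger.
  apply: step_near1 => //.
  have j1 : e^-1 <= j%:R :> R by near: j; exact: nbhs_infty_ger.
  have j2 : s + 1 <= j%:R :> R by near: j; exact: nbhs_infty_ger.
  apply: le_trans j1 _; rewrite ler_peMr//; lra.
Unshelve. all: by end_near. Qed.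

Lemma cutoff_measurable (chi : nat -> R -> R) k D : cutoff_seq chi ->
  measurable_fun (D : set (measurableTypeR R)) (chi k).
Proof.
move=> [h _ _]; have [sc _ _] := h k.
by apply: measurable_funTS; apply: continuous_measurable_fun; exact: smooth_continuous.
Qed.

End Cutoffs.

Section NonnegativeIntegrals.
Context {R : realType} {d : measure_display} {T : measurableType d}.
Variable mu : {measure set T -> \bar R}.

(** Monotonicity for possibly nonmeasurable functions: the integral of a
    nonnegative function is a supremum over simple functions below it. *)
Lemma ge0_le_integral_any (D : set T) (f1 f2 : T -> \bar R) :
  (forall x, D x -> (0 <= f1 x)%E) -> (forall x, D x -> (f1 x <= f2 x)%E) ->
  (\int[mu]_(x in D) f1 x <= \int[mu]_(x in D) f2 x)%E.
Proof.
move=> f0 f12; rewrite !ge0_integralE//; last first.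
  by move=> x Dx; apply: le_trans (f12 x Dx); exact: f0.
apply: ereal_sup_le => _ [h hf <-]; exists h => // x; apply: le_trans (hf x) _.
by rewrite !patchE; case: ifPn => // /set_mem; exact: f12.
Qed.

End NonnegativeIntegrals.

Section Histories.
Context {R : realType} {n : nat}.
Local Notation W := (R * 'rV[R]_n)%type.
Local Notation mu := (lebesgue_rV R n).
Local Notation leb := (@lebesgue_measure R).
Local Notation I := (`]0, +oo[%classic : set (measurableTypeR R)).

Lemma grad_scale a (v : 'rV[R]_n -> R[i]) x : csmooth v ->
  grad (fun y => a * v y) x = a *: grad v x.
Proof.
move=> sv; have s0 : csmooth (fun _ : 'rV[R]_n => 0 : R[i]) by split; exact: smooth_cst.
have := grad_linear a x sv s0; under eq_fun do rewrite addr0; move=> ->.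
rewrite [X in _ + X](_ : _ = 0) ?addr0//; apply/rowP => i; rewrite !mxE /=.
by rewrite !derive_cst.
Qed.

Definition tens (tau : R -> R) (v : 'rV[R]_n -> R[i]) : W -> R[i] :=
  fun z => (tau z.1)%:C * v z.2.

Lemma cdotZl a (u v : 'rV[R[i]]_n) : cdot (a *: u) v = a * cdot u v.
Proof. by rewrite /cdot mulr_sumr; apply: eq_bigr => i _; rewrite !mxE mulrA. Qed.

Lemma conj_real (a : R) : (a%:C)^* = a%:C :> R[i].
Proof. by apply/eqP; rewrite eq_complex /= ?oppr0 !eqxx. Qed.

Lemma cdotZr (a : R) (u v : 'rV[R[i]]_n) : cdot u (a%:C *: v) = a%:C * cdot u v.
Proof. by rewrite -cdot_conj cdotZl [LHS]rmorphM /= cdot_conj conj_real. Qed.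

Lemma gdot_tensr tau (u : W -> R[i]) v z : csmooth v ->
  gdot u (tens tau v) z = (tau z.1)%:C * gdot u (fun z => v z.2) z.
Proof. by move=> sv; rewrite /gdot /tens /= grad_scale// cdotZr. Qed.

Lemma gdot_tens tau v z : csmooth v -> complex.Re (gdot (tens tau v) (tens tau v) z) =
  tau z.1 ^+ 2 * complex.Re (cdot (grad v z.2) (grad v z.2)).
Proof.
move=> sv; rewrite gdot_tensr// ReZ /gdot /tens /= grad_scale// cdotZl ReZ.
by rewrite mulrA -expr2.
Qed.

Variable Omega : set 'rV[R]_n.
Hypothesis mO : measurable Omega.
Hypothesis bO : bounded_set Omega.
Variables (p : R) (m g : W -> R).
Hypothesis sg : smooth g.
Hypothesis mg : forall z, 0 <= z.1 -> m z = g z.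
Hypothesis m0 : forall z, 0 <= z.1 -> 0 <= m z.

Local Notation test := (test_fun Omega).
Local Notation testM := (test_fun (half_cylinder Omega)).
Local Notation formM := (form_M Omega p m).
Local Notation dens := (form_density Omega p m).

Lemma testM_tens (tau : R -> R) v : smooth tau -> compact (tsupport tau) ->
  tsupport tau `<=` `]0, +oo[%classic -> test v -> testM (tens tau v).
Proof.
move=> st ct it [[v1 v2] cv iv].
have cP : compact (tsupport tau `*` tsupport v) by exact: compact_setX.
have sP : tsupport (tens tau v) `<=` tsupport tau `*` tsupport v.
  have clP : closed (tsupport tau `*` tsupport v).
    by apply: compact_closed cP; exact: norm_hausdorff.
  rewrite [X in _ `<=` X](closure_id _).1//; apply: closureS => -[s x] /= h.
  split; apply: subset_closure => /=; apply: contra_neq h; rewrite /tens /= => ->.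
    by rewrite mul0r.
  by rewrite mulr0.
split.
- split.
    have := smoothM (smooth_fst st) (smooth_snd v1).
    by congr smooth; apply/funext => z; rewrite /tens ReZ.
  have := smoothM (smooth_fst st) (smooth_snd v2).
  by congr smooth; apply/funext => z; rewrite /tens ImZ.
- by apply: subclosed_compact cP sP; exact: closed_closure.
- move=> [s x] /sP[/= /it + /iv]; rewrite /= in_itv /= andbT => h1 h2.
  by split.
Qed.

Lemma testM_cutoff chi k v : cutoff_seq chi -> test v -> testM (tens (chi k) v).
Proof. by move=> [h _ _] tv; have [st ct it] := h k; exact: testM_tens. Qed.

Section OneTest.
Variable v : 'rV[R]_n -> R[i].
Hypothesis tv : test v.

Let sv : csmooth v. Proof. by case: tv. Qed.

Let D x := complex.Re (cdot (grad v x) (grad v x)).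

Let D0 x : 0 <= D x. Proof. exact: cdot_ge0. Qed.

Let Cc_D : Cc D.
Proof.
have bv : bounded_support v by have [_ cv _] := tv; exact: test_bounded_support cv.
have [h _] := Cc_wgrad (@cst_continuous _ _ (1 : R)) sv sv bv.
by move: h; congr Cc; apply/funext => x; rewrite wgrad_Re mul1r.
Qed.

(** The energy density in time of the history constantly equal to v. *)
Definition energy s := \int[mu]_(x in Omega) (memory_kernel p m s x * D x).

Lemma Cc_energy s : 0 < s -> Cc (fun x => s `^ (p - 1) * g (s, x) * D x).
Proof.
move=> s0; apply: CcMl => //.
by apply: smooth_continuous; apply: smoothZ; exact: smooth_slice.
Qed.

Lemma energy_integrand s : 0 < s -> rintegrable mu Omega (fun x => memory_kernel p m s x * D x).
Proof.
move=> s0; apply: (eq_rintegrable mO _ (Cc_integrable (Cc_energy s0) mO)) => x _.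
by rewrite /memory_kernel mg//= ltW.
Qed.

Lemma energy_ge0 s : 0 < s -> 0 <= energy s.
Proof. by move=> s0; apply: Rintegral_ge0 => x _; rewrite mulr_ge0// kernel_ge0// ltW. Qed.

Lemma inner_tens tau s : 0 < s ->
  complex.Re (dens (tens tau v) (tens tau v) s) = tau s ^+ 2 * energy s.
Proof.
move=> s0; rewrite /energy -(RintegralZl (tau s ^+ 2) mO (energy_integrand s0)).
rewrite /form_density /cintegral /=; apply: eq_Rintegral => x _.
by rewrite ReZ gdot_tens//= -/(D x); ring.
Qed.

Lemma form_tens tau : complex.Re (formM (tens tau v) (tens tau v)) =
  \int[leb]_(s in I) (tau s ^+ 2 * energy s).
Proof.
rewrite form_ME /cintegral /=; apply: eq_Rintegral => s; rewrite inE /= in_itv /= andbT.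
exact: inner_tens.
Qed.

(** At each time the energy is the limit of the time densities of the form at
    the test functions [tens (cutoff k) v], which are measurable. *)
Lemma measurable_energy : measurable_fun I energy.
Proof.
have cc : cutoff_seq (@cutoff R) := cutoff_cutoff_seq.
apply: (measurable_fun_cvg (h := fun k s => complex.Re (dens (tens (cutoff k) v) (tens (cutoff k) v) s))).
  move=> k; have tt := testM_cutoff k cc tv; have [st _ _] := tt.
  have [h _] := inner_cintegrable mO bO p sg mg tt st.
  by have := measurable_int _ h => /measurable_EFinP.
move=> s Is; have s0 : 0 < s by move: Is; rewrite /= in_itv /= andbT.
have -> : (fun k s => complex.Re (dens (tens (cutoff k) v) (tens (cutoff k) v) s)) ^~ s =
    fun k => cutoff k s ^+ 2 * energy s by apply/funext => k; exact: inner_tens.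
rewrite -[X in _ --> X]mul1r; apply: cvgM; last exact: cvg_cst.
rewrite -[X in _ --> X](expr1n _ 2); have [_ _ h] := cc.
by under eq_fun do rewrite expr2; rewrite expr2; apply: cvgM; exact: h.
Qed.

Lemma energy_le (s K : R) : 0 < s ->
  (\forall x \ae mu, Omega x -> memory_kernel p m s x <= K) -> 0 <= K ->
  energy s <= K * \int[mu]_(x in Omega) D x.
Proof.
move=> s0 kK K0; have iD : rintegrable mu Omega D by exact: Cc_integrable.
rewrite -(RintegralZl K mO iD) /energy /Rintegral; apply: fine_le.
- by apply: integrable_fin_num => //; exact: energy_integrand.
- by apply: integrable_fin_num => //; exact: (rintegrableZ mO K iD).
apply: (ae_ge0_le_integral mO).
- by move=> x _; rewrite lee_fin mulr_ge0// kernel_ge0// ltW.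
- exact: measurable_int (energy_integrand s0).
- by move=> x _; rewrite lee_fin mulr_ge0.
- exact: measurable_int (rintegrableZ mO K iD).
- by apply: filterS kK => x kx Ox; rewrite lee_fin ler_wpM2r// kx.
Qed.

Hypothesis kernel_L1 : (\int[leb]_(s in I)
   'N[mu]_(+oo)[EFin \o memory_kernel p m s] < +oo)%E.

(** The total mass of the kernel. *)
Definition kernel_mass : R := fine (\int[leb]_(s in I)
   'N[mu]_(+oo)[EFin \o memory_kernel p m s])%E.

Lemma energy_norm s : 0 < s -> (0 < mu setT)%E -> 0 < \int[mu]_(x in Omega) D x ->
  ((energy s / \int[mu]_(x in Omega) D x)%:E <= 'N[mu]_(+oo)[EFin \o memory_kernel p m s])%E.
Proof.
move=> s0 muT Dp; have := Lnorm_ge0 mu +oo (EFin \o memory_kernel p m s).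
rewrite unlock /= muT; set N := ess_sup mu _.
have ae : \forall x \ae mu, ((abse \o (EFin \o memory_kernel p m s)) x <= N)%E.
  exact: ess_sup_ge.
clearbody N; case: N ae => [r| |] //=; last by move=> *; rewrite leey.
move=> ae r0; rewrite lee_fin in r0.
rewrite lee_fin ler_pdivrMr//; apply: energy_le => //.
by apply: filterS ae => x /= h _; rewrite lee_fin in h; apply: le_trans h; exact: ler_norm.
Qed.

Let DI := \int[mu]_(x in Omega) D x.

Let DI0 : 0 <= DI. Proof. by apply: Rintegral_ge0 => x _. Qed.

(** When the Dirichlet integral of v vanishes, [energy_norm] says nothing; the
    kernel at the fixed time s is bounded on Omega. *)
Lemma energy_null s : 0 < s -> DI = 0 -> energy s = 0.
Proof.
move=> s0 DI_; apply/eqP; rewrite eq_le energy_ge0// andbT.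
have [M OM] := bounded_box bO.
have [K K0 gK] := continuous_bounded_on (smooth_continuous sg) (@confined_compact R n s (Num.max s M)).
have := @energy_le s (s `^ (p - 1) * K) s0; rewrite -/DI DI_ mulr0; apply.
  apply: aeW => x Ox; rewrite /memory_kernel mg/=; last exact: ltW.
  apply: ler_wpM2l; first exact: powR_ge0.
  apply: le_trans (ler_norm _) (gK _ _); split=> /=.
    by rewrite in_itv /= lexx le_max lexx.
  by apply: boxS (OM _ Ox); rewrite le_max lexx orbT.
by rewrite mulr_ge0 ?powR_ge0.
Qed.

(** The essential supremum of the kernel majorizes the energy, up to the
    Dirichlet integral, at each time; its measurability in time is avoided by
    [ge0_le_integral_any]. *)
Lemma energy_bound : (\int[leb]_(s in I) (energy s)%:E <= (kernel_mass * DI)%:E)%E.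
Proof.
have N0 s : (0 <= 'N[mu]_(+oo)[EFin \o memory_kernel p m s])%E by exact: Lnorm_ge0.
have kE : (kernel_mass%:E = \int[leb]_(s in I) 'N[mu]_(+oo)[EFin \o memory_kernel p m s])%E.
  by rewrite fineK// ge0_fin_numE//; apply: integral_ge0.
have : 0 <= DI by []; rewrite le_eqVlt => /predU1P[DI_|Dp].
  rewrite -DI_ mulr0; under eq_integral => s.
    by rewrite inE /= in_itv /= andbT => s0; rewrite energy_null//; over.
  by rewrite integral0.
have muT : (0 < mu setT)%E.
  rewrite lt_def measure_ge0 andbT; apply/eqP => mu0.
  have muO : (mu Omega = 0)%E.
    by apply/eqP; rewrite eq_le measure_ge0 andbT -mu0 le_measure// inE.
  have mD : measurable_fun Omega (EFin \o D) := measurable_int mu (Cc_integrable Cc_D mO).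
  by move: Dp; rewrite /DI /Rintegral (null_set_integral mO mD muO) ltxx.
have mq : measurable_fun I (fun s => energy s / DI).
  by apply: measurable_funM => //; exact: measurable_energy.
have -> : (\int[leb]_(s in I) (energy s)%:E = DI%:E * \int[leb]_(s in I) (energy s / DI)%:E)%E.
  rewrite -ge0_integralZl//.
  - by apply: eq_integral => s _; rewrite -EFinM mulrCA divff ?mulr1// gt_eqF.
  - exact/measurable_EFinP.
  - move=> s; rewrite /= in_itv /= andbT => s0.
    by rewrite lee_fin divr_ge0// energy_ge0.
rewrite mulrC EFinM; apply: lee_wpmul2l; first by rewrite lee_fin.
rewrite kE; apply: ge0_le_integral_any => s; rewrite /= in_itv /= andbT => s0.
  by rewrite lee_fin divr_ge0// energy_ge0.
exact: energy_norm.
Qed.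

Lemma energy_integrable : rintegrable leb I energy.
Proof.
apply/integrableP; split; first by apply/measurable_EFinP; exact: measurable_energy.
apply: le_lt_trans (ltry (kernel_mass * DI)); apply: le_trans energy_bound.
rewrite le_eqVlt; apply/orP; left; apply/eqP; apply: eq_integral => s.
by rewrite inE /= in_itv /= andbT => s0; rewrite ger0_norm// energy_ge0.
Qed.

Lemma energy_mass : \int[leb]_(s in I) energy s <= kernel_mass * DI.
Proof.
rewrite -lee_fin /Rintegral fineK; first exact: energy_bound.
by apply: integrable_fin_num; [exact: mI|exact: energy_integrable].
Qed.

Lemma weighted_energy_integrable (w : R -> R) : measurable_fun I w ->
  (forall s, 0 <= w s <= 1) -> rintegrable leb I (fun s => w s ^+ 2 * energy s).
Proof.
move=> mw w01; apply: (le_integrable mI _ _ energy_integrable).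
  apply/measurable_EFinP; apply: measurable_funM; last exact: measurable_energy.
  exact: measurable_funX.
move=> s; rewrite /= in_itv /= andbT => s0; rewrite lee_fin normrM ler_piMl//.
have /andP[w0 w1] := w01 s.
by rewrite ger0_norm ?sqr_ge0// expr_le1.
Qed.

Lemma form_cutoff_le (chi : nat -> R -> R) k : cutoff_seq chi ->
  complex.Re (formM (tens (chi k) v) (tens (chi k) v)) <= kernel_mass * DI.
Proof.
move=> cc; have [_ c01 _] := cc; rewrite form_tens; apply: le_trans energy_mass.
apply: (le_Rintegral mI (weighted_energy_integrable (cutoff_measurable k cc) (c01 k)) energy_integrable).
move=> s; rewrite /= in_itv /= andbT => s0; have /andP[w0 w1] := c01 k s.
by rewrite ler_piMl ?energy_ge0// expr_le1.
Qed.

Lemma onem_cutoff (chi : nat -> R -> R) k s : cutoff_seq chi -> 0 <= 1 - chi k s <= 1.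
Proof. by move=> [_ c01 _]; have /andP[w0 w1] := c01 k s; rewrite subr_ge0 w1 gerBl. Qed.

Lemma onem_measurable (chi : nat -> R -> R) k : cutoff_seq chi -> measurable_fun I (fun s => 1 - chi k s).
Proof. by move=> cc; apply: measurable_funB => //; exact: cutoff_measurable. Qed.

(** The energy is integrable and dominates the integrands. *)
Lemma cutoff_remainder (chi : nat -> R -> R) : cutoff_seq chi ->
  (fun k => \int[leb]_(s in I) ((1 - chi k s) ^+ 2 * energy s)) @ \oo --> (0 : R).
Proof.
move=> cc; have [_ c01 cvg1] := cc.
have z : \int[leb]_(s in I) (0 : R) = 0 by rewrite /Rintegral integral0.
rewrite -[X in _ --> X]z.
apply: (Rintegral_dominated mI _ _ energy_integrable _).2.
- move=> k; apply: measurable_funM; last exact: measurable_energy.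
  by apply: measurable_funX; exact: onem_measurable.
- move=> s; rewrite /= in_itv /= andbT => /cvg1 h.
  have h1 : (fun k => 1 - chi k s) @ \oo --> (0 : R).
    by rewrite -[X in _ --> X](subrr (1 : R)); apply: cvgB => //; exact: cvg_cst.
  rewrite -[X in _ --> X](mul0r (energy s)); apply: cvgM; last exact: cvg_cst.
  rewrite -[X in _ --> X](mul0r (0 : R)); under eq_fun do rewrite expr2.
  exact: cvgM.
- move=> k s; rewrite /= in_itv /= andbT => s0.
  have /andP[w0 w1] := onem_cutoff k s cc.
  by rewrite normrM !ger0_norm ?sqr_ge0 ?energy_ge0// ler_piMl ?energy_ge0// expr_le1.
Qed.

(** Two cutoff sequences give equivalent Cauchy sequences of histories. *)
Lemma cutoffs_cauchy chi chi' e : cutoff_seq chi -> cutoff_seq chi' -> 0 < e ->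
  exists N, forall k l, (N <= k)%N -> (N <= l)%N ->
  complex.Re (formM (fun z => -1 * tens (chi' l) v z + tens (chi k) v z)
                    (fun z => -1 * tens (chi' l) v z + tens (chi k) v z)) <= e.
Proof.
move=> cc cc' e0; have e4 : 0 < e / 4 by rewrite divr_gt0.
have rem (c : nat -> R -> R) : cutoff_seq c -> exists N, forall k, (N <= k)%N ->
    \int[leb]_(s in I) ((1 - c k s) ^+ 2 * energy s) <= e / 4.
  move=> /cutoff_remainder/cvgrPdist_le/(_ _ e4)[N _ hN]; exists N => k Nk.
  by have := hN k Nk; rewrite sub0r normrN; apply: le_trans; exact: ler_norm.
have [N hN] := rem _ cc; have [N' hN'] := rem _ cc'.
exists (maxn N N') => k l; rewrite !geq_max => /andP[k1 _] /andP[_ l2].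
have -> : (fun z => -1 * tens (chi' l) v z + tens (chi k) v z) = tens (fun s => chi k s - chi' l s) v.
  by apply/funext => z; rewrite /tens rmorphB /=; ring.
rewrite form_tens.
have i1 := weighted_energy_integrable (onem_measurable k cc) (fun s => onem_cutoff k s cc).
have i2 := weighted_energy_integrable (onem_measurable l cc') (fun s => onem_cutoff l s cc').
have j1 := rintegrableZ mI 2 i1; have j2 := rintegrableZ mI 2 i2.
apply: (@le_trans _ _ (\int[leb]_(s in I)
    (2 * ((1 - chi k s) ^+ 2 * energy s) + 2 * ((1 - chi' l s) ^+ 2 * energy s)))).
  have le s : 0 < s -> (chi k s - chi' l s) ^+ 2 * energy s <=
      2 * ((1 - chi k s) ^+ 2 * energy s) + 2 * ((1 - chi' l s) ^+ 2 * energy s).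
    move=> s0; rewrite !mulrA -mulrDl ler_wpM2r ?energy_ge0//.
    have := sqr_ge0 ((1 - chi k s) + (1 - chi' l s)); rewrite !expr2; lra.
  apply: (le_Rintegral mI _ (rintegrableD mI j1 j2)).
    apply: (le_integrable mI _ _ (rintegrableD mI j1 j2)).
      apply/measurable_EFinP; apply: measurable_funM; last exact: measurable_energy.
      by apply: measurable_funX; apply: measurable_funB; exact: cutoff_measurable.
    move=> s; rewrite /= in_itv /= andbT => s0; rewrite lee_fin.
    rewrite ger0_norm; last by apply: mulr_ge0; [exact: sqr_ge0|exact: energy_ge0].
    by apply: le_trans (le s s0) _; exact: ler_norm.
  by move=> s; rewrite /= in_itv /= andbT; exact: le.
rewrite (RintegralD mI j1 j2) (RintegralZl 2 mI i1) (RintegralZl 2 mI i2).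
have := hN k k1; have := hN' l l2; lra.
Qed.

Lemma inner_tensr tau u s : testM u -> 0 < s ->
  dens u (tens tau v) s = (tau s)%:C * dens u (fun z => v z.2) s.
Proof.
move=> tu s0; have [i1 i2] := inner_integrand mO p sg mg tu (csmooth_snd sv) s0.
have e : (tau s)%:C * dens u (fun z => v z.2) s = (tau s * complex.Re (dens u (fun z => v z.2) s)) +i*
    (tau s * complex.Im (dens u (fun z => v z.2) s)).
  by apply/eqP; rewrite eq_complex ReZ ImZ !eqxx.
rewrite e /form_density /cintegral /= -(RintegralZl (tau s) mO i1) -(RintegralZl (tau s) mO i2).
congr (_ +i* _); apply: eq_Rintegral => x _.
  by rewrite gdot_tensr// !ReZ /=; ring.
by rewrite gdot_tensr// !ImZ /=; ring.
Qed.

Lemma form_cutoff_cvg chi u : cutoff_seq chi -> testM u ->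
  (fun k => formM u (tens (chi k) v) : R[i]^o) @ \oo --> (formM u (fun z => v z.2) : R[i]^o).
Proof.
move=> cc tu; have [_ c01 cvg1] := cc.
have [i1 i2] := inner_cintegrable mO bO p sg mg tu (csmooth_snd sv).
have key (f : R -> R) : rintegrable leb I f ->
    (fun k => \int[leb]_(s in I) (chi k s * f s)) @ \oo --> \int[leb]_(s in I) f s.
  move=> fi; have mf : measurable_fun I f.
    by have := measurable_int _ fi => /measurable_EFinP.
  have ai : rintegrable leb I (fun s => `|f s|) := integrable_abse fi.
  apply: (Rintegral_dominated mI _ _ ai _).2.
  - by move=> k; apply: measurable_funM => //; exact: cutoff_measurable.
  - move=> s; rewrite /= in_itv /= andbT => /cvg1 h.
    by rewrite -[X in _ --> X]mul1r; apply: cvgM => //; exact: cvg_cst.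
  - move=> k s _; have /andP[w0 w1] := c01 k s.
    by rewrite normrM (ger0_norm w0) ler_piMl.
have e k s : I s -> dens u (tens (chi k) v) s = (chi k s)%:C * dens u (fun z => v z.2) s.
  by rewrite /= in_itv /= andbT; exact: inner_tensr.
have reE k : complex.Re (formM u (tens (chi k) v)) =
    \int[leb]_(s in I) (chi k s * complex.Re (dens u (fun z => v z.2) s)).
  change (\int[leb]_(s in I) complex.Re (dens u (tens (chi k) v) s) =
    \int[leb]_(s in I) (chi k s * complex.Re (dens u (fun z => v z.2) s))).
  by apply: eq_Rintegral => s; rewrite inE => Is; rewrite e// ReZ.
have imE k : complex.Im (formM u (tens (chi k) v)) =
    \int[leb]_(s in I) (chi k s * complex.Im (dens u (fun z => v z.2) s)).
  change (\int[leb]_(s in I) complex.Im (dens u (tens (chi k) v) s) =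
    \int[leb]_(s in I) (chi k s * complex.Im (dens u (fun z => v z.2) s))).
  by apply: eq_Rintegral => s; rewrite inE => Is; rewrite e// ImZ.
apply: complex_cvg.
  by under eq_fun do rewrite reE; exact: key.
by under eq_fun do rewrite imE; exact: key.
Qed.

End OneTest.
End Histories.

(** * The wave equation with memory *)

Theorem theorem7p1 (R : realType) (n : nat) (hn : (2 <= n)%N)
  (Omega : set 'rV[R]_n) (hOmega : smooth_bounded_domain Omega)
  (sigma : 'rV[R]_n -> R) (sigma_smooth : smooth_on (closure Omega) sigma)
  (sigma_gt0 : forall x : 'rV[R]_n, closure Omega x -> 0 < sigma x)
  (p : R) (hp : 0 < p < 1)
  (m : R * 'rV[R]_n -> R)
  (m_smooth : smooth_on [set z : R * 'rV[R]_n | 0 <= z.1] m)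
  (m_ge0 : forall (s : R) (x : 'rV[R]_n), 0 <= s -> 0 <= m (s, x))
  (m_supp : exists2 K : set 'rV[R]_n, compact K &
     forall (s : R) (x : 'rV[R]_n), 0 <= s -> ~ K x -> m (s, x) = 0)
  (kernel_decr : forall (s : R) (x : 'rV[R]_n), 0 < s -> derive1 (fun r => memory_kernel p m r x) s <= 0)
  (kernel_L1 : (\int[lebesgue_measure]_(s in `]0%R, +oo[)
     'N[lebesgue_rV R n]_(+oo)[EFin \o memory_kernel p m s] < +oo)%E)
  (HD : space_HD Omega sigma) (L2 : space_L2 Omega) (M : space_M Omega p m) :
  generates_contraction_semigroup (norm_H HD L2 M)
    (L_dom HD L2 M) (L_op HD L2 M).
Proof.
move: hn Omega hOmega sigma sigma_smooth sigma_gt0 m m_smooth m_ge0 m_supp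
  kernel_decr kernel_L1 HD L2 M.
case: n => [//|n] _ Omega [ne oO _ bO _] sigma [sg sg_smooth sgE] sigma_gt0
  m [g g_smooth gE] m_ge0 _ kernel_decr kernel_L1 HD L2 M.
have mO := open_measurable_rV oO.
have sigmaE x : Omega x -> sigma x = sg x by move=> Ox; apply: sgE; exact: subset_closure.
(* sigma is bounded away from 0 on Omega, as its closure is compact. *)
have [c c0 sigmac] : exists2 c, 0 < c & forall x, Omega x -> c <= sigma x.
  have [B OB] := bounded_box bO.
  have cO : compact (closure Omega).
    apply: (@subclosed_compact _ _ (@box R n.+1 B)); [exact: closed_closure|exact: box_compact|].
    have cB : closed (@box R n.+1 B).
      by apply: compact_closed (@box_compact R n.+1 B); exact: norm_hausdorff.
    by rewrite [X in _ `<=` X](closure_id _).1//; exact: closureS.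
  have O0' : closure Omega !=set0 by case: ne => x Ox; exists x; exact: subset_closure.
  have [x /set_mem xO xmin] := compact_EVT_min O0' cO (continuous_subspaceT (smooth_continuous sg_smooth)).
  exists (sg x); first by rewrite -sgE//; exact: sigma_gt0.
  by move=> y Oy; rewrite sigmaE//; apply: xmin; rewrite inE; exact: subset_closure.
have mg z : 0 <= z.1 -> m z = g z by exact: gE.
have m0 z : 0 <= z.1 -> 0 <= m z by case: z => s x; exact: m_ge0.
have [CP CP0 poinc] := poincare_forms mO bO sg_smooth sigmaE c0 sigmac.
have mass0 : 0 <= kernel_mass p m.
  by apply: fine_ge0; apply: integral_ge0 => s _; exact: Lnorm_ge0.
apply: (@generation_of_forms R n.+1 Omega sigma p m HD L2 M _ _ _ _ _ CP _ _ _ _ _ _ _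
  (@cutoff R) (Num.sqrt (kernel_mass p m * c^-1))).
- by apply: (hermitian_form_HD mO sg_smooth sigmaE) => x Ox; exact: le_trans (ltW c0) (sigmac x Ox).
- exact: hermitian_form_L2.
- exact: (hermitian_form_M mO bO p g_smooth mg m0).
- exact: space_L2_complete.
- exact: test_square_integrable.
- exact: poinc.
- exact: CP0.
- exact: (form_HD_green mO sg_smooth sigmaE).
- exact: test_dense.
- exact: testM_shift.
- exact: (shift_contraction mO bO g_smooth mg m0 kernel_decr).
- exact: (shift_quotient mO bO p g_smooth mg m0).
- exact: cutoff_cutoff_seq.
- by move=> chi v k cc tv; exact: testM_cutoff.
- move=> chi v e cc tv; exact: (cutoffs_cauchy mO bO g_smooth mg m0 tv kernel_L1 cc cutoff_cutoff_seq).
- move=> v k tv.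
  have := form_cutoff_le mO bO g_smooth mg m0 tv kernel_L1 k (@cutoff_cutoff_seq R).
  move=> h; apply: le_trans h _; rewrite sqr_sqrtr; last by rewrite mulr_ge0 ?invr_ge0 ?(ltW c0).
  have := ler_wpM2l mass0 (dirichlet_le mO sg_smooth sigmaE c0 sigmac tv).
  by rewrite mulrA.
- exact: sqrtr_ge0.
- by move=> eta v te tv; exact: (form_cutoff_cvg mO bO g_smooth mg tv cutoff_cutoff_seq te).
Qed.
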